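(* Let $a$ and $b$ be real numbers such that $a \geq 2$ and $b \in [0, 2/a]$. There is a Cantor-like set $E \subseteq [0,1]$ such that, for the uniform measure on $E$, almost all real numbers in $E$ have irrationality exponent equal to $a$ and effective Hausdorff dimension equal to $b$.
   Context: **Irrationality exponent.** The irrationality exponent of a real number $x$ is the supremum of the set of real numbers $z$ for which the inequality $0 < \left| x - \frac{p}{q}\right| < \frac{1}{q^z}$ is satisfied by infinitely many integer pairs $(p,q)$ with $q>0$. **Effective Hausdorff dimension.** Let $\mathbb{W}$ be the set of finite binary sequences and $\mathbb{N}$ the set of non-negative integers. A set is computably enumerable if it is the range of a computable function with domain $\mathbb{N}$ (computability on countable sets such as $\mathbb{N} \times \mathbb{W}$ is defined via standard effective enumerations). For a real $s \geq 0$, a set $X$ of real numbers has effective $s$-dimensional Hausdorff measure zero if there exists a computably enumerable set $C \subseteq \mathbb{N} \times \mathbb{W}$ such that for every $n \in \mathbb{N}$, the set $C_n = \{ w \in \mathbb{W} : (n,w) \in C\}$ satisfies: for every $x \in X$ there is a length $\ell$ such that the sequence of the first $\ell$ digits in the base-2 expansion of $x$ is in $C_n$; and $\sum_{w \in C_n} 2^{-\mathrm{length}(w)\, s} < 2^{-n}$. The effective Hausdorff dimension of $X$ is the infimum of the set of non-negative reals $s$ such that $X$ has effective $s$-dimensional Hausdorff measure zero. The effective Hausdorff dimension of an individual real number $x$ is the effective Hausdorff dimension of the singleton $\{x\}$. **Cantor-like set and its uniform measure.** A Cantor-like set is a set of the form $E = \bigcap_{k \geq 0} E_k$, where $E_0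 = [0,1]$ and, for each $k \geq 1$, $E_k \subseteq E_{k-1}$ is a finite union of pairwise disjoint non-degenerate closed intervals (the level-$k$ intervals), each contained in a level-$(k-1)$ interval, such that all level-$(k-1)$ intervals contain the same number $i_k \geq 1$ of level-$k$ intervals, and the maximal length of the level-$k$ intervals tends to $0$ as $k \to \infty$. (The value $i_k = 1$ is allowed, so a singleton may occur as a degenerate case.) The uniform measure on $E$ (with respect to this construction) is the unique Borel probability measure $\mu$ supported on $E$ that assigns mass $1/(i_1 \cdots i_k)$ to each level-$k$ interval, for every $k\ge 1$. The assertion that there is a Cantor-like set means that there is a set together with such a construction, and ''the uniform measure'' refers to that construction. No computability of $a$, $b$ or of the construction of $E$ is assumed or asserted. *)

(* Defs.v *)
From HB Require Import structures.
From mathcomp Require Import all_boot all_order all_algebra.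
From mathcomp Require Import all_classical all_reals all_analysis.

Set Implicit Arguments.
Unset Strict Implicit.
Unset Printing Implicit Defensive.

Import Order.TTheory GRing.Theory Num.Theory.
Import numFieldNormedType.Exports.

Local Open Scope classical_set_scope.
Local Open Scope ring_scope.

Definition irrationality_exponent (R : realType) (x : R) : \bar R :=
  ereal_sup [set z%:E | z in
    [set z : R | infinite_set [set pq : int * int |
      (0 < pq.2)%R /\
      0 < `|x - pq.1%:~R / pq.2%:~R| < (pq.2%:~R `^ z)^-1]]].

(* Kleene's total recursive functions of several variables.  Minimization is
   only applied to functions f such that every v admits some y with
   f (y, v) = 0, which is witnessed by the resulting function m. *)
Inductive computable : forall k : nat, (k.-tuple nat -> nat) -> Prop :=
| computable_zero k : computable (fun _ : k.-tuple nat => 0%N)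
| computable_succ : computable (fun v : 1.-tuple nat => (thead v).+1)
| computable_proj k (i : 'I_k) : computable (fun v : k.-tuple nat => tnth v i)
| computable_comp k m (f : m.-tuple nat -> nat)
    (g : 'I_m -> k.-tuple nat -> nat) :
    computable f -> (forall i, computable (g i)) ->
    computable (fun v => f [tuple g i v | i < m])
| computable_primrec k (f : k.-tuple nat -> nat)
    (g : k.+2.-tuple nat -> nat) :
    computable f -> computable g ->
    computable (fun v : k.+1.-tuple nat =>
      nat_rect (fun _ => nat) (f [tuple of behead v])
        (fun n r => g [tuple of n :: r :: behead v]) (thead v))
| computable_min k (f : k.+1.-tuple nat -> nat) (m : k.-tuple nat -> nat) :
    computable f ->
    (forall v, f [tuple of m v :: v] = 0%N) ->
    (forall v y, (y < m v)%N -> f [tuple of y :: v] <> 0%N) ->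
    computable m.

(* The rank of w in the length-lexicographic enumeration of binary words. *)
Definition word_code (w : seq bool) : nat :=
  foldl (fun (c : nat) (d : bool) => (c.*2 + d).+1%N) 0%N w.

(* Cantor's bijective pairing, (m + n) (m + n + 1) / 2 + n. *)
Definition pair_code (m n : nat) : nat := ('C((m + n).+1, 2) + n)%N.

Definition computably_enumerable (C : set (nat * seq bool)) : Prop :=
  exists2 F : nat -> nat * seq bool,
    computable (fun v : 1.-tuple nat =>
      pair_code (F (thead v)).1 (word_code (F (thead v)).2)) &
    C = range F.

(* Digit i of the fractional part of x, at position 2 ^ -(i + 1); a dyadic
   rational gets its expansion ending in zeros. *)
Definition binary_digit (R : realType) (x : R) (i : nat) : bool :=
  odd `|Num.floor (2 ^+ i.+1 * x)|%N.

Definition binary_prefix (R : realType) (x : R) (l : nat) : seq bool :=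
  mkseq (binary_digit x) l.

Definition effective_hausdorff_null (R : realType) (s : R) (X : set R) : Prop :=
  exists2 C : set (nat * seq bool), computably_enumerable C &
    forall n : nat,
      (forall x, X x -> exists l : nat, C (n, binary_prefix x l)) /\
      (\esum_(w in [set w | C (n, w)]) (2 `^ (- (size w)%:R * s))%:E
         < (2 ^- n)%:E)%E.

Definition effective_hausdorff_dim (R : realType) (X : set R) : \bar R :=
  ereal_inf [set s%:E | s in
    [set s : R | 0 <= s /\ effective_hausdorff_null s X]].

(* A pair J = (l, r) stands for the closed interval [l, r]. *)
Definition cinterval (R : realType) (J : R * R) : set R := `[J.1, J.2]%classic.

(* lev k lists the level-k intervals, and d k (k >= 1) is the number of level-k
   intervals contained in each level-(k-1) interval; d 0 is irrelevant. *)
Record cantor_construction (R : realType) (lev : nat -> seq (R * R))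
    (d : nat -> nat) : Prop := CantorConstruction {
  cantor_lev0 : lev 0%N = [:: (0, 1)];
  cantor_uniq : forall k, uniq (lev k);
  cantor_nondegenerate : forall k J, J \in lev k -> J.1 < J.2;
  cantor_disjoint : forall k J K, J \in lev k -> K \in lev k -> J <> K ->
    cinterval J `&` cinterval K = set0;
  cantor_nested : forall k K, K \in lev k.+1 ->
    exists2 J, J \in lev k & cinterval K `<=` cinterval J;
  cantor_branching_gt0 : forall k, (0 < d k.+1)%N;
  cantor_branching : forall k J, J \in lev k ->
    count (fun K => `[< cinterval K `<=` cinterval J >]) (lev k.+1) = d k.+1;
  cantor_mesh :
    (fun k => \big[Num.max/0]_(J <- lev k) (J.2 - J.1)) @ \oo --> (0 : R)
}.

Definition cantor_level (R : realType) (lev : nat -> seq (R * R)) (k : nat) :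
    set R :=
  [set x | exists2 J, J \in lev k & cinterval J x].

Definition cantor_set (R : realType) (lev : nat -> seq (R * R)) : set R :=
  \bigcap_k cantor_level lev k.

Definition is_uniform_measure (R : realType) (lev : nat -> seq (R * R))
    (d : nat -> nat) (mu : probability (measurableTypeR R) R) : Prop :=
  mu (~` cantor_set lev) = 0%E /\
  forall k J, (0 < k)%N -> J \in lev k ->
    mu (cinterval J) = ((\prod_(1 <= j < k.+1) d j)%:R^-1)%:E.

(* Main.v *)
(** The branching numbers of a Cantor-like set may all be 1, so it suffices to
    find one real x in (0, 1) with irrationality exponent a and effective
    dimension b: nested intervals shrinking to x define the set {x}, whose
    uniform measure is the point mass at x.

    Such an x is an infinite composition of unimodular maps
    y |-> (P' y + P) / (Q' y + Q), chosen in stages. A stage starts with a very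
    long run of free levels, at each of which (P, Q) ranges over about 4 ^ w
    coprime pairs with Q close to 2 ^ w. When the denominator of the convergents
    has reached 2 ^ m, continued fraction digits equal to 2 ^ w are appended
    until it is about 2 ^ (2 m / (a b)). The stage ends with one continued
    fraction digit that ranges over an interval [A, 2 A) with A close to
    q ^ (a - 2), where q is the current denominator, so that x is at distance
    about q ^ (- a) from the current convergent p / q. All other
    factors are negligible with respect to q, so the exponent of x is a.

    The convergent p / q before the large digit is determined by the 2 m bits of
    a pair (P, Q) of entries below 2 ^ m and o(m) further bits, and it determines
    the first 2 m / b bits of x; hence the dimension of x is at most b.
    Conversely, distinct products of n blocks give distinct, hence separated,
    fractions, so that only a small proportion of them is close to a given dyadic
    interval. For s < b, the paths that meet an s-cover of small weight are thus
    rare. There are countably many computably enumerable covers, so some path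
    avoids one cover from each null sequence. *)
Require Import Defs.
From HB Require Import structures.
From mathcomp Require Import all_boot all_order all_algebra.
From mathcomp Require Import all_classical all_reals all_analysis.
From mathcomp Require Import finmap zify ring lra.

Import Order.TTheory GRing.Theory Num.Theory.
Import numFieldNormedType.Exports.

Local Open Scope nat_scope.

(** * Coprime pairs with large denominator *)

(** At the end of a digit run log2 q is about m', about 2 m bits have been chosen, and p / q fixes
    about a m' bits of x. The ratio 2 m / (a m') is b for m' = 2 m / (a b), and m' >= m is exactly b
    <= 2 / a. The run must be cheap to describe, hence one repeated digit 2 ^ w, given by w and a
    count; a single digit leading from 2 ^ m to 2 ^ m' would create the exponent 1 + m' / m, which
    may exceed a. The large digit has to be free: with it fixed, the precision would still rise to
    about 2 (a - 1) m' and the ratio would fall to a b / (2 (a - 1)), below b when a > 2 and b > 0.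
    The bound 8 P <= Q confines compositions to [0, 1/8], so that a block maps into a neighbourhood
    of P / Q of radius 1 / (8 Q ^ 2). Different fractions whose denominators agree up to a factor 4
    are further apart than that, which is why Q ranges over [N / 4, N]. *)

Definition pool_pred (N : nat) (z : nat * nat) : bool :=
  [&& 0 < z.1, 8 * z.1 <= z.2, z.2 <= N, N <= 4 * z.2 & coprime z.1 z.2].

Definition free_pool (N : nat) : seq (nat * nat) :=
  [seq z <- [seq (P, Q) | Q <- iota 1 N, P <- iota 1 (Q %/ 8)] | pool_pred N z].

Lemma free_pool_uniq N : uniq (free_pool N).
Proof.
rewrite filter_uniq // allpairs_uniq_dep ?iota_uniq // => [Q _|[Q P] [Q' P'] _ _ [-> ->]//].
exact: iota_uniq.
Qed.

Lemma mem_free_pool N z : (z \in free_pool N) = pool_pred N z.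
Proof.
rewrite mem_filter andb_idr //; case: z => P Q /and5P[/= P0 PQ QN _ _].
apply/allpairsPdep; exists Q, P; split=> //; rewrite mem_iota; first lia.
by rewrite P0 /= add1n ltnS leq_divRL // mulnC.
Qed.

Lemma sumn_divn8 K : sumn [seq y %/ 8 | y <- iota 1 (8 * K)] + 3 * K = 4 * K ^ 2.
Proof.
elim: K => [//|K IH].
have -> : iota 1 (8 * K.+1) = iota 1 (8 * K) ++ iota (1 + 8 * K) 8 by rewrite -iotaD; congr iota; lia.
rewrite map_cat sumn_cat [iota (1 + _) 8]/= !map_cons.
have -> : 4 * K.+1 ^ 2 = 4 * K ^ 2 + 8 * K + 4 by rewrite -(addn1 K) sqrnD; lia.
rewrite -IH /=; lia.
Qed.

(* A pair (x, y) with 8 x <= y <= N is g times a coprime pair (P, Q): those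
   with Q < N / 4 are at most half of all pairs, and the others have g <= 4. *)
Lemma leq_size_free_pool K : 1 < K -> K ^ 2 <= 4 * size (free_pool (8 * K)).
Proof.
move=> K1; set N := 8 * K.
pose T := [seq (x, y) | y <- iota 1 N, x <- iota 1 (y %/ 8)].
pose U1 := [seq (z.1, y, z.2) | y <- iota 1 (2 * K).-1,
  z <- [seq (x, g) | x <- iota 1 (y %/ 8), g <- iota 1 (N %/ y)]].
pose U2 := [seq (z, g) | z <- free_pool N, g <- iota 1 4].
pose red (z : nat * nat) :=
  (z.1 %/ gcdn z.1 z.2, z.2 %/ gcdn z.1 z.2, gcdn z.1 z.2).
have redK : cancel red (fun t => (t.1.1 * t.2, t.1.2 * t.2)).
  by move=> [x y]; rewrite /red /= !divnK ?dvdn_gcdl ?dvdn_gcdr.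
have Tuniq : uniq T.
  rewrite allpairs_uniq_dep ?iota_uniq // => [Q _|[Q P] [Q' P'] _ _ [-> ->]//].
  exact: iota_uniq.
have TU : {subset map red T <= U1 ++ U2}.
  move=> t /mapP[[x y] /allpairsPdep[y0 [x0 [+ + [-> ->]]]] ->] /=.
  move: y0 x0 => {x y} y x; rewrite !mem_iota => /andP[y1 yN] /andP[x1 xy].
  rewrite add1n ltnS leq_divRL // in xy.
  set g := gcdn x y; have g0 : 0 < g by rewrite gcdn_gt0 x1.
  have [gx gy] : g %| x /\ g %| y by rewrite dvdn_gcdl dvdn_gcdr.
  have [Ex Ey] := (divnK gx, divnK gy).
  have cop : coprime (x %/ g) (y %/ g) by rewrite /coprime -(eqn_pmul2r g0) muln_gcdl Ex Ey mul1n.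
  rewrite /red /= -/g; move: Ex Ey cop.
  set P := x %/ g; set Q := y %/ g => Ex Ey cop.
  have P0 : 0 < P by rewrite divn_gt0 // dvdn_leq.
  have Q0 : 0 < Q by rewrite divn_gt0 // dvdn_leq.
  have PQ : P * 8 <= Q by rewrite -(leq_pmul2r g0) -mulnA (mulnC 8) mulnA Ex Ey.
  have gN : g <= N %/ Q by rewrite leq_divRL // mulnC Ey; lia.
  rewrite mem_cat; have [QK|QK] := ltnP Q (2 * K).
    apply/orP; left; apply/allpairsPdep; exists Q, (P, g); split => //.
      by rewrite mem_iota; lia.
    apply/allpairsPdep; exists P, g; rewrite !mem_iota.
    by rewrite !add1n !ltnS P0 g0 gN leq_divRL.
  apply/orP; right; apply/allpairsPdep; exists (P, Q), g; split => //.
    rewrite mem_free_pool /pool_pred /= P0 cop (mulnC 8) PQ andbT /=.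
    have : Q <= y by rewrite -Ey leq_pmulr.
    by lia.
  rewrite mem_iota g0 /= add1n ltnS.
  by apply: (leq_trans gN); rewrite -ltnS ltn_divLR //; lia.
have := uniq_leq_size _ TU; rewrite map_inj_uniq; last exact: can_inj redK.
move=> /(_ Tuniq); rewrite size_map size_cat.
have -> : size T = sumn [seq y %/ 8 | y <- iota 1 N].
  by rewrite size_allpairs_dep; congr sumn; apply: eq_map => y; rewrite size_iota.
have -> : size U2 = size (free_pool N) * 4 by rewrite size_allpairs.
(* A denominator y contributes at most (y / 8) (8 K / y) <= K triples. Of the 4 K ^ 2 - 3 K pairs in
   [T], at most 2 K ^ 2 - K are lost in this way, and the other 2 K ^ 2 - 2 K are at least K ^ 2
   because K >= 2. *)
have : size U1 <= (2 * K).-1 * K.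
  rewrite size_allpairs_dep -{2}[(2 * K).-1](size_iota 1).
  have : {in iota 1 (2 * K).-1, forall y, (y %/ 8) * (N %/ y) <= K}.
    move=> y; rewrite mem_iota => /andP[y1 _].
    rewrite -(leq_pmul2l (ltn0Sn 7)) mulnA.
    apply: (@leq_trans (y * (N %/ y))); first by rewrite leq_mul2r mulnC leq_divM orbT.
    by rewrite mulnC leq_divM.
  elim: (iota _ _) => [//|y s IH] H; rewrite /= mulSn. apply: leq_add.
    by rewrite size_allpairs !size_iota H ?mem_head.
  by apply: IH => z zs; apply: H; rewrite in_cons zs orbT.
have := sumn_divn8 K; rewrite -/N.
have -> : (2 * K).-1 * K = 2 * K ^ 2 - K by rewrite -subn1 mulnBl mul1n expnS expn1 mulnA.
have : 2 * K <= K ^ 2 by rewrite expnS expn1 leq_mul2r K1 orbT.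
move: (sumn _) (size U1) (size _) (K ^ 2) => A B C D.
lia.
Qed.

(** * Computable functions *)

Lemma pair_codeE m n : pair_code m n = 'C((m + n).+1, 2) + n.
Proof. by []. Qed.

Lemma triangularS s : 'C(s.+2, 2) = 'C(s.+1, 2) + s.+1.
Proof. by rewrite binS bin1. Qed.

(** The diagonal on which Cantor's pairing puts [e]: the largest s with s (s + 1) / 2 <= e.
    Recursion on [e], rather than a search, makes it primitive recursive as written. *)
Fixpoint pair_diag (e : nat) : nat :=
  if e is e'.+1 then pair_diag e' + ('C((pair_diag e').+2, 2) <= e) else 0.

Lemma pair_diagP e : 'C((pair_diag e).+1, 2) <= e < 'C((pair_diag e).+2, 2).
Proof.
elim: e => [//|e]; rewrite [pair_diag e.+1]/=; move: (pair_diag e) => s.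
case: (leqP 'C(s.+2, 2) e.+1); rewrite ?addn0 ?addn1 !triangularS; lia.
Qed.

Definition unpair2 (e : nat) : nat := e - 'C((pair_diag e).+1, 2).
Definition unpair1 (e : nat) : nat := pair_diag e - unpair2 e.

Lemma pair_diagK m n : pair_diag (pair_code m n) = m + n.
Proof.
have := pair_diagP (pair_code m n); rewrite pair_codeE.
set s := pair_diag _ => /andP[H1 H2].
have mono : {homo (fun i => 'C(i.+1, 2)) : x y / x <= y}.
  by apply: homo_leq => [//|y x z|i]; [exact: leq_trans|rewrite triangularS leq_addr].
have [lt|gt|//] := ltngtP s (m + n).
  have := mono _ _ lt; rewrite /= triangularS; move: H2; rewrite triangularS; lia.
have := mono _ _ gt; rewrite /= triangularS; lia.
Qed.

Lemma pair_codeK2 m n : unpair2 (pair_code m n) = n.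
Proof. by rewrite /unpair2 pair_diagK pair_codeE addKn. Qed.

Lemma pair_codeK1 m n : unpair1 (pair_code m n) = m.
Proof. by rewrite /unpair1 pair_codeK2 pair_diagK addnK. Qed.

Lemma word_code_rcons w d : word_code (rcons w d) = ((word_code w).*2 + d).+1.
Proof. by rewrite /word_code foldl_rcons. Qed.

Lemma word_code_inj : injective word_code.
Proof.
move=> w; elim/last_ind: w => [|w d IH] w'; case/lastP: w' => [|w' d'] //;
  rewrite ?word_code_rcons // => -[].
by case: d; case: d'; rewrite ?addn0 ?addn1 => E; rewrite (IH w') //; lia.
Qed.

Lemma computable_ext k (f g : k.-tuple nat -> nat) :
  f =1 g -> computable f -> computable g.
Proof. by move=> /funext ->. Qed.

Lemma computable_comp1 k (h : nat -> nat) (f : k.-tuple nat -> nat) :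
  computable (fun v : 1.-tuple nat => h (thead v)) -> computable f ->
  computable (fun v => h (f v)).
Proof.
move=> hc fc; apply: computable_ext (computable_comp (g := fun=> f) hc _) => // v.
by rewrite /thead tnth_mktuple.
Qed.

(** [computable_primrec] recurses on the first entry of its argument; precomposition with the tuple
    [n v :: v] lets depth, base and step depend on all of [v]. *)
Lemma computable_rec k (n b : k.-tuple nat -> nat)
    (s : k.+2.-tuple nat -> nat) :
  computable n -> computable b -> computable s ->
  computable (fun v => nat_rect (fun=> nat) (b v)
    (fun i r => s [tuple of [:: i, r & v]]) (n v)).
Proof.
move=> nc bc sc.
pose F (i : 'I_k.+1) : k.-tuple nat -> nat :=
  if unlift ord0 i is Some j then fun v => tnth v j else n.
have Fc i : computable (F i).
  by rewrite /F; case: unliftP => [j _|_//]; exact: computable_proj.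
apply: computable_ext (computable_comp (computable_primrec bc sc) Fc) => v.
have E : [tuple F i v | i < k.+1] = [tuple of n v :: v].
  apply: eq_from_tnth => i; rewrite tnth_mktuple /F.
  by case: unliftP => [j ->|->]; rewrite ?tnthS ?tnth0.
rewrite E theadE; congr nat_rect.
- by congr b; apply: val_inj.
- by apply/funext => i; apply/funext => r; congr s; apply: val_inj.
Qed.

Lemma computable_cst k c : computable (fun _ : k.-tuple nat => c).
Proof.
elim: c => [|c IH]; first exact: computable_zero.
exact: (computable_comp1 k succn (fun=> c) computable_succ IH).
Qed.

Lemma computable_thead k : computable (fun v : k.+1.-tuple nat => thead v).
Proof. exact: computable_proj. Qed.

Lemma computable_thead2 k :
  computable (fun v : k.+2.-tuple nat => thead (behead_tuple v)).
Proof.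
apply: computable_ext (computable_proj (inord 1 : 'I_k.+2)) => v.
by rewrite /thead tnth_behead; congr tnth; apply: val_inj.
Qed.

Lemma computable_drop2 k (f : k.-tuple nat -> nat) : computable f ->
  computable (fun w : k.+2.-tuple nat => f (behead_tuple (behead_tuple w))).
Proof.
move=> fc; pose F (i : 'I_k) (w : k.+2.-tuple nat) :=
  tnth w (lift ord0 (lift ord0 i)).
apply: computable_ext (computable_comp (g := F) fc _) => [w|i].
  by congr f; apply: eq_from_tnth => i; rewrite tnth_mktuple /F !(tnth_nth 0) !nth_behead.
exact: computable_proj.
Qed.

Lemma computableS k (f : k.-tuple nat -> nat) :
  computable f -> computable (fun v => (f v).+1).
Proof. exact: computable_comp1 computable_succ. Qed.

Lemma computableD k (f g : k.-tuple nat -> nat) :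
  computable f -> computable g -> computable (fun v => f v + g v).
Proof.
move=> fc gc; have sc := computableS _ _ (computable_thead2 k).
apply: computable_ext (computable_rec _ _ _ _ fc gc sc) => v.
by elim: (f v) => [//|n] /= ->.
Qed.

Lemma computable_pred k (f : k.-tuple nat -> nat) :
  computable f -> computable (fun v => (f v).-1).
Proof.
move=> fc.
apply: computable_ext (computable_rec _ _ _ _ fc (computable_cst _ 0)
  (computable_thead k.+1)) => v.
by case: (f v).
Qed.

Lemma computableB k (f g : k.-tuple nat -> nat) :
  computable f -> computable g -> computable (fun v => f v - g v).
Proof.
move=> fc gc; have sc := computable_pred _ _ (computable_thead2 k).
apply: computable_ext (computable_rec _ _ _ _ gc fc sc) => v.
by elim: (g v) => [|n /= ->]; rewrite ?subn0 ?subnS.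
Qed.

Lemma computableM k (f g : k.-tuple nat -> nat) :
  computable f -> computable g -> computable (fun v => f v * g v).
Proof.
move=> fc gc.
have sc := computableD _ _ _ (computable_drop2 _ _ gc) (computable_thead2 k).
apply: computable_ext (computable_rec _ _ _ _ fc (computable_cst _ 0) sc) => v.
elim: (f v) => [//|n /= ->]; rewrite mulSn; congr (g _ + _).
exact: val_inj.
Qed.

Lemma computable_exp2 k (f : k.-tuple nat -> nat) :
  computable f -> computable (fun v => 2 ^ f v).
Proof.
move=> fc; have rc := computable_thead2 k.
apply: computable_ext (computable_rec _ _ _ _ fc (computable_cst _ 1)
  (computableD _ _ _ rc rc)) => v.
by elim: (f v) => [//|n /= ->]; rewrite expnS mul2n addnn.
Qed.

Lemma computable_leq k (f g : k.-tuple nat -> nat) :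
  computable f -> computable g -> computable (fun v => f v <= g v).
Proof.
move=> fc gc.
apply: computable_ext (computableB _ _ _ (computable_cst _ 1)
  (computableB _ _ _ fc gc)) => v.
by case: leqP => [|lt]; lia.
Qed.

Lemma computable_and k (p q : k.-tuple nat -> bool) :
  computable (fun v => p v : nat) -> computable (fun v => q v : nat) ->
  computable (fun v => p v && q v : nat).
Proof.
move=> pc qc; apply: computable_ext (computableM _ _ _ pc qc) => v.
by case: (p v); case: (q v).
Qed.

Lemma computable_or k (p q : k.-tuple nat -> bool) :
  computable (fun v => p v : nat) -> computable (fun v => q v : nat) ->
  computable (fun v => p v || q v : nat).
Proof.
move=> pc qc; apply: computable_ext
  (computable_leq _ _ _ (computable_cst _ 1) (computableD _ _ _ pc qc)) => v.
by case: (p v); case: (q v).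
Qed.

Lemma computable_eqn k (f g : k.-tuple nat -> nat) :
  computable f -> computable g -> computable (fun v => f v == g v : nat).
Proof.
move=> fc gc; apply: computable_ext (computable_and _ _ _
  (computable_leq _ _ _ fc gc) (computable_leq _ _ _ gc fc)) => v.
by rewrite eqn_leq.
Qed.

Lemma computable_triangular k (f : k.-tuple nat -> nat) :
  computable f -> computable (fun v => 'C((f v).+1, 2)).
Proof.
move=> fc.
have sc := computableD _ _ _ (computable_thead2 k)
  (computableS _ _ (computable_thead k.+1)).
apply: computable_ext (computable_rec _ _ _ _ fc (computable_cst _ 0) sc) => v.
by elim: (f v) => [//|n /= ->]; rewrite triangularS theadE.
Qed.

Lemma computable_pair_code k (f g : k.-tuple nat -> nat) :
  computable f -> computable g -> computable (fun v => pair_code (f v) (g v)).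
Proof.
move=> fc gc; apply: computableD => //.
exact: computable_triangular (computableD _ _ _ fc gc).
Qed.

Lemma computable_pair_diag k (f : k.-tuple nat -> nat) :
  computable f -> computable (fun v => pair_diag (f v)).
Proof.
move=> fc; have rc := computable_thead2 k; have ic := computable_thead k.+1.
have sc := computableD _ _ _ rc (computable_leq _ _ _
  (computable_triangular _ _ (computableS _ _ rc)) (computableS _ _ ic)).
apply: computable_ext (computable_rec _ _ _ _ fc (computable_cst _ 0) sc) => v.
by elim: (f v) => [//|n /= ->]; rewrite /= !theadE.
Qed.

Lemma computable_unpair2 k (f : k.-tuple nat -> nat) :
  computable f -> computable (fun v => unpair2 (f v)).
Proof.
move=> fc; apply: computableB => //.
exact/computable_triangular/computable_pair_diag.
Qed.

Lemma computable_unpair1 k (f : k.-tuple nat -> nat) :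
  computable f -> computable (fun v => unpair1 (f v)).
Proof.
by move=> fc; apply: computableB;
  [exact: computable_pair_diag|exact: computable_unpair2].
Qed.

Definition pell_step (B : nat) (z : nat * nat) := (z.2, B * z.2 + z.1).
(* Consecutive continuants of the word B, ..., B of length r. *)
Definition pell (B r : nat) : nat * nat := iter r (pell_step B) (0, 1).

(** Primitive recursion carries a single number, so the two continuants are carried as one
    [pair_code]. *)
Lemma computable_pell k (f g : k.-tuple nat -> nat) :
  computable f -> computable g ->
  computable (fun v => (pell (f v) (g v)).1) /\
  computable (fun v => (pell (f v) (g v)).2).
Proof.
move=> fc gc; pose F v := pair_code (pell (f v) (g v)).1 (pell (f v) (g v)).2.
suff Fc : computable F.
  split; [have := computable_unpair1 _ _ Fc|have := computable_unpair2 _ _ Fc].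
    by apply: computable_ext => v; rewrite pair_codeK1.
  by apply: computable_ext => v; rewrite pair_codeK2.
have rc := computable_thead2 k.
have xc := computable_unpair1 _ _ rc; have yc := computable_unpair2 _ _ rc.
have sc := computable_pair_code _ _ _ yc (computableD _ _ _
  (computableM _ _ _ (computable_drop2 _ _ fc) yc) xc).
apply: computable_ext (computable_rec _ _ _ _ gc
  (computable_cst _ (pair_code 0 1)) sc) => v.
rewrite /F; elim: (g v) => [//|n /= ->]; rewrite /= pair_codeK1 pair_codeK2.
congr pair_code; congr (f _ * _ + _); exact: val_inj.
Qed.

Local Open Scope classical_set_scope.

(** * A computably enumerable cover *)

Definition word_of (l v : nat) : seq bool :=
  mkseq (fun i => odd (v %/ 2 ^ (l - i.+1))) l.

Lemma size_word_of l v : size (word_of l v) = l.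
Proof. exact: size_mkseq. Qed.

Lemma word_code_word_of l v : v < 2 ^ l -> word_code (word_of l v) = 2 ^ l - 1 + v.
Proof.
elim: l v => [|l IH] v; first by case: v.
move=> vl; have -> : word_of l.+1 v = rcons (word_of l v./2) (odd v).
  rewrite /word_of mkseqS subnn divn1; congr rcons.
  apply/eq_in_map => i; rewrite mem_iota add0n => /= il.
  by rewrite -divn2 -divnMA -expnS subSn.
rewrite word_code_rcons IH; last by rewrite ltn_half_double -mul2n -expnS.
have := odd_double_half v; rewrite expnS; have := expn_gt0 2 l; lia.
Qed.

(* v / 2 ^ l approximates the value at continuants of a word of r digits
   2 ^ c of a unimodular map with entries at most 2 ^ mu. *)
Definition cover_rel (mu l P' P Q' Q c r v : nat) : bool :=
  let X := (pell (2 ^ c) r).1 in let Y := (pell (2 ^ c) r).2 in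
  let p := P' * X + P * Y in let q := Q' * X + Q * Y in
  [&& [&& P <= 2 ^ mu, Q <= 2 ^ mu & Q' < Q],
      (P * Q' == (P' * Q).+1) || (P' * Q == (P * Q').+1),
      [&& c <= mu, r <= mu * mu & v < 2 ^ l] &
      (v * q <= 2 ^ l * p + 2 * q) && (2 ^ l * p <= v * q + 2 * q)].

(** Words of length lam j are described by matrix entries of kap j bits. Index n only uses j >= n +
    j1, so its weight is the tail of a convergent series. The parameters are natural numbers, which
    makes the cover enumerable whatever the reals a and b are. *)
Definition ce_cover (kap lam j1 : nat) : set (nat * seq bool) :=
  [set z | exists i P' P Q' Q c r v, let j := z.1 + i + j1 in
    cover_rel (kap * j) (lam * j) P' P Q' Q c r v /\ z.2 = word_of (lam * j) v].

Lemma ce_cover_enumerable kap lam j1 : computably_enumerable (ce_cover kap lam j1).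
Proof.
pose arg k (e : nat) := unpair1 (iter k unpair2 e).
pose j e := arg 0 e + arg 1 e + j1.
pose ok e := cover_rel (kap * j e) (lam * j e)
  (arg 2 e) (arg 3 e) (arg 4 e) (arg 5 e) (arg 6 e) (arg 7 e) (iter 8 unpair2 e).
(* A code that fails the relation must still produce an element of the set: it yields the word of 0,
   which the identity matrix with an empty run puts into the cover. *)
pose val e := ok e * iter 8 unpair2 e.
pose F e := (arg 0 e, word_of (lam * j e) (val e)).
have val_lt e : val e < 2 ^ (lam * j e).
  rewrite /val; case: (boolP (ok e)) => [/and4P[_ _ /and3P[_ _ vl] _]|_].
    by rewrite mul1n.
  by rewrite mul0n expn_gt0.
exists F.
  pose C (f : nat -> nat) := computable (fun v : 1.-tuple nat => f (thead v)).
  have iterC k : C (iter k unpair2).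
    by elim: k => [|k IH]; [exact: computable_thead|exact: computable_unpair2].
  have argC k : C (arg k) by exact/computable_unpair1/iterC.
  have cC n : C (fun=> n) by exact: computable_cst.
  have jC : C j.
    exact: computableD _ _ _ (computableD _ _ _ (argC 0) (argC 1)) (cC j1).
  have [XC YC] := computable_pell _ _ _ (computable_exp2 _ _ (argC 6)) (argC 7).
  have okC : C (fun e => ok e).
    do ![apply: computable_and|apply: computable_or|apply: computable_leq
        |apply: computable_eqn|apply: computableD|apply: computableM
        |apply: computable_exp2|apply: computableS|exact: argC|exact: cC
        |exact: iterC|exact: jC|exact: XC|exact: YC].
  have valC : C val by exact: computableM _ _ _ okC (iterC 8).
  have lC : C (fun e => 2 ^ (lam * j e)) 
    by apply/computable_exp2; exact: computableM _ _ _ (cC lam) jC.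
  apply: computable_ext (computable_pair_code _ _ _ (argC 0)
    (computableD _ _ _ (computableB _ _ _ lC (cC 1)) valC)) => v /=.
  by rewrite word_code_word_of.
apply/seteqP; split=> [[n w] /= [i [P' [P [Q' [Q [c [r [v [H /= ->]]]]]]]]]|_ [e _ <-]].
  pose e := pair_code n (pair_code i (pair_code P' (pair_code P (pair_code Q'
    (pair_code Q (pair_code c (pair_code r v))))))).
  have E : (iter 8 unpair2 e = v) * (arg 0 e = n) * (arg 1 e = i) * (arg 2 e = P')
    * (arg 3 e = P) * (arg 4 e = Q') * (arg 5 e = Q) * (arg 6 e = c) * (arg 7 e = r).
    by rewrite /arg /e /= !(pair_codeK1, pair_codeK2).
  exists e => //; rewrite /F /val /ok /j !E.
  by rewrite H mul1n.
rewrite /ce_cover /= /F; exists (arg 1 e); rewrite -/(j e).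
rewrite /val; case: (boolP (ok e)) => [H|_].
  by do 7!eexists; rewrite mul1n; split; first exact: H.
exists 1, 0, 0, 1, 0, 0, 0; split => //.
by rewrite /cover_rel /= !expn_gt0 !muln0 !mul0n.
Qed.

(** The determinant makes P prime to Q and fixes P Q1 modulo Q, hence fixes Q1 among the numbers
    below Q. *)
Lemma unimodular_uniq P Q P1 Q1 P2 Q2 : Q1 < Q -> Q2 < Q ->
  (P * Q1 == (P1 * Q).+1) && (P * Q2 == (P2 * Q).+1)
    || (P1 * Q == (P * Q1).+1) && (P2 * Q == (P * Q2).+1) ->
  P1 = P2 /\ Q1 = Q2.
Proof.
wlog le12 : P1 Q1 P2 Q2 / Q1 <= Q2.
  move=> H l1 l2 D; have [le12|/ltnW le12] := leqP Q1 Q2; first exact: H.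
  by have [||//||-> ->//] := H P2 Q2 P1 Q1; rewrite // ![(P * Q2 == _) && _]andbC
    [(P2 * Q == _) && _]andbC.
move=> l1 l2 D; have Q0 : 0 < Q by lia.
have cop : coprime Q P.
  rewrite /coprime -dvdn1; set g := gcdn Q P.
  have [gQ gP] : g %| Q /\ g %| P by rewrite dvdn_gcdl dvdn_gcdr.
  have [d1 d2] : g %| P1 * Q /\ g %| P * Q1 by rewrite dvdn_mull // dvdn_mulr.
  case/orP: D => /andP[/eqP E _].
    by rewrite -(dvdn_addr _ d1) addn1 -E.
  by rewrite -(dvdn_addr _ d2) addn1 -E.
have E12 : Q1 = Q2.
  have : Q %| P * (Q2 - Q1).
    apply/dvdnP; exists (P2 - P1); rewrite mulnBr mulnBl.
    by case/orP: D => /andP[/eqP E1 /eqP E2]; lia.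
  rewrite Gauss_dvdr // => /dvdn_leq; lia.
split=> //; apply/eqP; rewrite -(eqn_pmul2r Q0); rewrite E12 in D.
by case/orP: D => /andP[/eqP E1 /eqP E2]; apply/eqP; lia.
Qed.

(* The column (P', Q') is determined by (P, Q) and the sign of the
   determinant, so there are about 4 ^ mu choices rather than 16 ^ mu. *)
Lemma cover_rel_values mu l : exists2 vs : seq nat,
  size vs <= 10 * (2 ^ mu).+1 ^ 2 * (mu.+1 * (mu * mu).+1) &
  forall P' P Q' Q c r v, cover_rel mu l P' P Q' Q c r v -> v \in vs.
Proof.
pose A v := exists P' P Q' Q c r, cover_rel mu l P' P Q' Q c r v.
pose vs := [seq v <- iota 0 (2 ^ l) | `[< A v >]].
pose T : finType := ('I_(2 ^ mu).+1 * 'I_(2 ^ mu).+1 * bool *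
  'I_mu.+1 * 'I_(mu * mu).+1 * 'I_5)%type.
pose pq (P' P Q' Q c r : nat) := let z := pell (2 ^ c) r in
  (P' * z.1 + P * z.2, Q' * z.1 + Q * z.2).
pose B (t : T) v := let: (P, Q, sg, c, r, d) := t in exists P' Q',
  [/\ Q' < Q, (if sg then P * Q' == (P' * Q).+1 else P' * Q == (P * Q').+1) &
    v + 2 = 2 ^ l * (pq P' P Q' Q c r).1 %/ (pq P' P Q' Q c r).2 + d].
have AB v : exists t, v \in vs -> B t v.
  have [/[!mem_filter]/andP[/asboolP[P' [P [Q' [Q [c [r H]]]]]] _]|] := boolP (v \in vs); last first.
    by move=> _; exists (ord0, ord0, true, ord0, ord0, ord0).
  have /and4P[/and3P[hP hQ hQ'] hdet /and3P[hc hr hv] /andP[h1 h2]] := H.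
  pose z := pq P' P Q' Q c r.
  have {}h1 : v * z.2 <= 2 ^ l * z.1 + 2 * z.2 by [].
  have {}h2 : 2 ^ l * z.1 <= v * z.2 + 2 * z.2 by [].
  (* Since v is within 2 of 2 ^ l p / q, [v + 2] exceeds the integer part of the latter by 0 to 4.
     These five values and the two signs of the determinant make up the factor 10. *)
  pose d := v + 2 - 2 ^ l * z.1 %/ z.2.
  have z2 : 0 < z.2.
    have Q0 : 0 < Q by apply: leq_ltn_trans hQ'.
    have Y0 : 0 < (pell (2 ^ c) r).2.
      by elim: r {H hr z d h1 h2} => [//|r IH]; rewrite /pell /= ltn_addr // muln_gt0 expn_gt0.
    by rewrite /z /= addn_gt0 !muln_gt0 Q0 Y0 orbT.
  have [d1 d2] : 2 ^ l * z.1 %/ z.2 <= v + 2 /\ v <= 2 ^ l * z.1 %/ z.2 + 2.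
    split.
      by rewrite -ltnS ltn_divLR // mulSn mulnDl; move: z2 h2; move: (_ * z.1) (v * _) => x y; lia.
    rewrite addnC -leq_subLR leq_divRL // mulnBl.
    by move: h1; move: (_ * z.1) (v * _) => x y; lia.
  have d5 : d < 5 by rewrite /d; lia.
  have hP' : P < (2 ^ mu).+1 by [].
  have hQ'' : Q < (2 ^ mu).+1 by [].
  exists (Ordinal hP', Ordinal hQ'', P * Q' == (P' * Q).+1, Ordinal (hc : c < mu.+1),
    Ordinal (hr : r < (mu * mu).+1), Ordinal d5) => _; exists P', Q'; split => //=.
    by case: ifP hdet => //= ->.
  by rewrite /d subnKC.
have [key Hkey] := choice AB.
have key_inj : {in vs &, injective key}.
  move=> v v' /Hkey + /Hkey + E; rewrite -E.
  case: (key v) => [[[[[P Q] sg] c] r] d] [P1 [Q1 [q1 D1 E1]]] [P2 [Q2 [q2 D2 E2]]].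
  have [e1 e2] : P1 = P2 /\ Q1 = Q2.
    apply: (unimodular_uniq P Q) => //.
    by move: D1 D2; case: sg => -> ->; rewrite ?orbT.
  by rewrite e1 e2 -E2 in E1; lia.
exists vs.
  have /uniq_leq_size : uniq (map key vs).
    by rewrite map_inj_in_uniq // filter_uniq // iota_uniq.
  move=> /(_ (enum T)); rewrite size_map => /(_ _)/leq_trans; apply.
    by move=> t _; rewrite mem_enum.
  rewrite -cardE !card_prod !card_ord card_bool.
  by apply: eq_leq; ring.
move=> P' P Q' Q c r v H; rewrite mem_filter; apply/andP; split.
  by apply/asboolP; exists P', P, Q', Q, c, r.
by rewrite mem_iota add0n; have /and4P[_ _ /and3P[_ _ ->]] := H.
Qed.

Local Open Scope ring_scope.

Lemma esum_le_seq (R : realType) (T : choiceType) (C : set T) (f : T -> R) (B : R) :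
  (forall s, uniq s -> (forall x, x \in s -> C x) -> \sum_(x <- s) f x <= B) ->
  (\esum_(x in C) (f x)%:E <= B%:E)%E.
Proof.
move=> H; apply: ge_ereal_sup => _ [X [Xfin XC] <-].
rewrite fsbig_finite //= sumEFin lee_fin; apply: H; first exact: fset_uniq.
by move=> x; rewrite in_fset_set // => /set_mem /XC.
Qed.

Lemma ler_sum_subseq (R : realType) (T : eqType) (f : T -> R) (s1 s2 : seq T) :
  (forall x, 0 <= f x) -> uniq s1 -> {subset s1 <= s2} ->
  \sum_(x <- s1) f x <= \sum_(x <- s2) f x.
Proof.
move=> f0; elim: s1 s2 => [|x s1 IH] s2; first by rewrite big_nil sumr_ge0.
move=> /andP[xs1 us1] sub; have xs2 : x \in s2 by rewrite sub ?mem_head.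
rewrite big_cons (perm_big _ (perm_to_rem xs2)) /= big_cons lerD2l.
apply: IH => // y ys1; have := sub y; rewrite in_cons ys1 orbT => /(_ isT).
rewrite (perm_mem (perm_to_rem xs2)) in_cons => /orP[/eqP yx|//].
by rewrite -yx ys1 in xs1.
Qed.

(** A bound of degree 4 leaves a spare factor j + 1, which absorbs [A]. The constant 1296 = 6 ^ 4
    settles j <= 5; from there on (j + 2) ^ 4 <= 2 (j + 1) ^ 4. *)
Lemma leq_cube_exp2 (A : nat) : exists j1 : nat,
  forall j : nat, (j1 <= j)%N -> (A * j.+1 ^ 3 <= 2 ^ j)%N.
Proof.
have H4 j : (j.+1 ^ 4 <= 1296 * 2 ^ j)%N.
  have [|j5] := ltnP j 5; first by case: j => [|[|[|[|[|]]]]].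
  elim: j j5 => [//|j IH]; rewrite leq_eqVlt => /orP[/eqP<- //|j5].
  have {}IH := IH j5.
  have : (j.+2 ^ 4 <= 2 * j.+1 ^ 4)%N by rewrite !expnS expn0; nia.
  by rewrite (expnS 2); lia.
exists (1296 * A)%N => j jA; have := H4 j.
rewrite (expnS j.+1 3) => H; rewrite -(@leq_pmul2l j.+1) //.
rewrite mulnCA; apply: (@leq_trans (A * (1296 * 2 ^ j))); first by rewrite leq_mul2l H orbT.
by rewrite mulnA (mulnC A) leq_mul2r ltnW ?orbT.
Qed.

(** Parameter j gives at most 2 ^ ((2 kap + 1) j) words, j of these bits dominating the polynomial
    factors, and each word weighs at most 2 ^ (- (2 kap + 3) j). What is left is the geometric
    series of 4 ^ (- j). *)
Lemma cover_sum (R : realType) (s : R) (kap lam : nat) :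
  (2 * kap + 3)%N%:R <= s * lam%:R ->
  exists j1, forall n, (\esum_(w in [set w | ce_cover kap lam j1 (n, w)])
    (2 `^ (- (size w)%:R * s))%:E < (2 ^- n)%:E)%E.
Proof.
move=> sl.
have [j1 Hj1] := leq_cube_exp2 (10 * 4 * kap.+1 ^ 3).
exists j1.+1 => n.
have /choice[vs Hvs] : forall j, exists vs : seq nat,
    (size vs <= 10 * (2 ^ (kap * j)).+1 ^ 2 * ((kap * j).+1 * (kap * j * (kap * j)).+1))%N /\
    forall P' P Q' Q c r v,
      cover_rel (kap * j) (lam * j) P' P Q' Q c r v -> v \in vs.
  by move=> j; have [vs] := cover_rel_values (kap * j) (lam * j); exists vs.
pose words j := [seq word_of (lam * j) v | v <- vs j].
pose f (w : seq bool) : R := 2 `^ (- (size w)%:R * s).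
have f0 w : 0 <= f w by exact: powR_ge0.
have words_sum j : (j1 <= j)%N -> \sum_(w <- words j) f w <= 4 ^- j.
  move=> jj; rewrite big_map (eq_bigr (fun=> 2 `^ (- (lam * j)%:R * s))); last first.
    by move=> v _; rewrite /f size_word_of.
  rewrite big_const_seq count_predT iter_addr_0 -[leLHS]mulr_natl.
  have -> : (4 : R) ^- j = (2 ^ (2 * kap * j + j))%:R * 2 `^ (- ((2 * kap + 3) * j)%:R).
    rewrite powRN powR_mulrn // natrX.
    have -> : ((2 * kap + 3) * j = (2 * kap * j + j) + 2 * j)%N by ring.
    rewrite (exprD _ _ (2 * j)%N) invfM mulrA divff ?expf_neq0 // mul1r exprM.
    by congr (_ ^- _); rewrite expr2; ring.
  apply: ler_pM; rewrite ?ler0n ?powR_ge0 //.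
    rewrite ler_nat; apply: leq_trans (Hvs j).1 _.
    have h1 : ((2 ^ (kap * j)).+1 ^ 2 <= 4 * 2 ^ (2 * kap * j))%N.
      have -> : (4 * 2 ^ (2 * kap * j) = (2 * 2 ^ (kap * j)) ^ 2)%N.
        by rewrite expnMn -expnM; congr (_ * 2 ^ _)%N; ring.
      rewrite leq_exp2r //.
      by have := expn_gt0 2 (kap * j); lia.
    have h2 : ((kap * j).+1 * (kap * j * (kap * j)).+1 <= kap.+1 ^ 3 * j.+1 ^ 3)%N.
      rewrite -expnMn (expnS _ 2); apply: leq_mul; first by nia.
      by rewrite expnS expn1; nia.
    rewrite -mulnA; apply: leq_trans (leq_mul (leqnn 10) (leq_mul h1 h2)) _.
    by have := Hj1 _ jj; rewrite expnD; move: (2 ^ _)%N (2 ^ j)%N (_ ^ 3)%N (_ ^ 3)%N; nia.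
  apply: ler_powR; first by rewrite ler1n.
  rewrite mulNr lerN2 (natrM _ lam) (natrM _ _ j) mulrAC (mulrC _ s).
  by rewrite ler_wpM2r.
(* The sum is a supremum over finite sets of words, and a finite set only involves finitely many
   values of j. *)
have C_le (X : seq (seq bool)) : (forall x, x \in X -> ce_cover kap lam j1.+1 (n, x)) ->
  exists M, {subset X <= flatten [seq words j | j <- iota (n + j1.+1) M]}.
  elim: X => [|x X IH] XC; first by exists 0%N.
  have [|M HM] := IH; first by move=> y yX; apply: XC; rewrite in_cons yX orbT.
  have [i [P' [P [Q' [Q [c [r [v /= [H xE]]]]]]]]] := XC x (mem_head _ _).
  exists (maxn M i.+1) => y; rewrite in_cons => /orP[/eqP ->|/HM].
    apply/flatten_mapP; exists (n + i + j1.+1)%N; first by rewrite mem_iota; lia.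
    by rewrite xE; apply/map_f/(Hvs _).2/H.
  move=> /flatten_mapP[j jM yj]; apply/flatten_mapP; exists j => //.
  by move: jM; rewrite !mem_iota; lia.
apply: (@le_lt_trans _ _ (4 ^- (n + j1.+1) * 4 / 3)%:E); last first.
  rewrite lte_fin addnS exprS exprD !invfM.
  have h1 : 4 ^- n <= 2 ^- n :> R by rewrite lef_pV2 ?posrE ?exprn_gt0 // lerXn2r ?nnegrE //; lra.
  have h2 : 4 ^- j1 <= 1 :> R by rewrite invf_le1 ?exprn_gt0 // exprn_ege1 //; lra.
  have h3 : 0 < 2 ^- n :> R by rewrite invr_gt0 exprn_gt0.
  have h4 : 0 < 4 ^- j1 :> R by rewrite invr_gt0 exprn_gt0.
  have : 4 ^- n * 4 ^- j1 <= 2 ^- n * 1 :> R by rewrite ler_pM // ?invr_ge0 ?exprn_ge0 // ltW.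
  by move: (4 ^- n * _) => z; lra.
apply: esum_le_seq => X uX /C_le[M XM].
apply: le_trans (ler_sum_subseq _ _ f _ _ f0 uX XM) _.
rewrite big_flatten big_map.
apply: (@le_trans _ _ (\sum_(j <- iota (n + j1.+1) M) 4 ^- j)).
  rewrite big_seq [leRHS]big_seq; apply: ler_sum => j; rewrite mem_iota => /andP[nj _].
  by apply: words_sum; lia.
have -> : \sum_(j <- iota (n + j1.+1) M) 4 ^- j =
    (4 ^- (n + j1.+1) - 4 ^- (n + j1.+1 + M)) * 4 / 3 :> R.
  elim: M {XM} (n + j1.+1)%N => [|M IH] a; first by rewrite big_nil addn0 subrr !mul0r.
  rewrite /= big_cons IH addSnnS; move: (4 ^- (a + M.+1)) => z.
  by rewrite exprS invfM; field.
by rewrite ler_pM2r ?invr_gt0 // ler_pM2r // gerBl invr_ge0 exprn_ge0.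
Qed.

(** * Countability of the computably enumerable sets *)

Definition least_zero (f : nat -> nat) : nat :=
  if pselect (exists n, f n == 0%N) is left ex then ex_minn ex else 0%N.

(* Programs are coded by finite trees; an ill-formed tree denotes the
   constant 0, and a diverging minimization takes the value 0. *)
Fixpoint interp (t : GenTree.tree nat) : seq nat -> nat :=
  match t with
  | GenTree.Leaf i => fun v => nth 0%N v i
  | GenTree.Node 1 _ => fun v => (head 0%N v).+1
  | GenTree.Node 2 (f :: gs) =>
      fun v => interp f (map (fun g => g v) (map interp gs))
  | GenTree.Node 3 [:: f; g] => fun v =>
      nat_rect (fun _ => nat) (interp f (behead v))
        (fun n r => interp g [:: n, r & behead v]) (head 0%N v)
  | GenTree.Node 4 [:: f] => fun v => least_zero (fun y => interp f (y :: v))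
  | _ => fun => 0%N
  end.

Lemma computable_interp k (f : k.-tuple nat -> nat) :
  computable f -> exists t, forall v, f v = interp t v.
Proof.
elim=> {k f} [k||k i|k m f g _ [tf Hf] _ Hg|k f g _ [tf Hf] _ [tg Hg]|
  k f m _ [tf Hf] f0 fN].
- by exists (GenTree.Node 0 [::]).
- by exists (GenTree.Node 1 [::]) => v; case/tupleP: v => x v.
- by exists (GenTree.Leaf (i : nat)) => v; rewrite (tnth_nth 0%N).
- have [tg Htg] := choice Hg.
  exists (GenTree.Node 2 (tf :: [seq tg i | i <- enum 'I_m])) => v /=.
  rewrite Hf; congr interp; rewrite -!map_comp /=.
  by rewrite enumT; apply: eq_map => i /=; rewrite Htg.
- exists (GenTree.Node 3 [:: tf; tg]) => v /=.
  have -> : head 0%N v = thead v by case/tupleP: v => x v.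
  by elim: (thead v) => [|n IH] /=; [rewrite Hf | rewrite Hg /= IH].
- exists (GenTree.Node 4 [:: tf]) => v /=; rewrite /least_zero.
  case: pselect => [ex|[]]; last by exists (m v); rewrite -(Hf [tuple of m v :: v]) f0.
  case: ex_minnP => n /eqP n0 nmin; apply/eqP; rewrite eqn_leq; apply/andP; split.
    rewrite leqNgt; apply/negP => nm.
    by have := fN _ _ nm; rewrite Hf.
  by apply: nmin; rewrite -(Hf [tuple of m v :: v]) f0.
Qed.

(** A program for the codes of its elements determines the set, because [pair_code] and [word_code]
    are injective. Numbers that code no tree denote the empty set. *)
Lemma ce_countable : exists E : nat -> set (nat * seq bool),
  forall C, computably_enumerable C -> exists i, C = E i.
Proof.
pose E (t : GenTree.tree nat) : set (nat * seq bool) :=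
  [set z | exists n, interp t [:: n] = pair_code z.1 (word_code z.2)].
exists (fun i => if choice.unpickle i is Some t then E t else set0).
move=> _ [F /computable_interp[t Ht] ->]; exists (choice.pickle t); rewrite choice.pickleK.
apply/seteqP; split=> [_ [n _ <-]|[m w] [n]].
  by exists n; rewrite -(Ht [tuple n]) theadE.
rewrite -(Ht [tuple n]) theadE; set z := F n => /= e; exists n => //.
rewrite -/z (surjective_pairing z); congr (_, _).
  by rewrite -(pair_codeK1 z.1 (word_code z.2)) e pair_codeK1.
apply: word_code_inj.
by rewrite -(pair_codeK2 z.1 (word_code z.2)) e pair_codeK2.
Qed.

(** * Products of unimodular maps *)

(* A coprime pair (P, Q) stands for the unimodular map
   y |-> (P' y + P) / (Q' y + Q) with P Q' = P' Q + 1 and 0 <= Q' < Q; the pair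
   (1, A) gives the continued fraction digit y |-> 1 / (y + A). *)
Definition block (D : nat * nat) : bool :=
  [&& (0 < D.1)%N, (8 * D.1 <= D.2)%N & coprime D.1 D.2].

(** [egcdn] returns the Bezout coefficient of P first; this is Q', hence the swap. *)
Definition block' (D : nat * nat) : nat * nat :=
  ((egcdn D.1 D.2).2, (egcdn D.1 D.2).1).

Lemma block'P D : block D ->
  [/\ (D.1 * (block' D).2 = ((block' D).1 * D.2).+1)%N, ((block' D).1 < D.1)%N,
      ((block' D).2 < D.2)%N & ((block' D).1 < (block' D).2)%N].
Proof.
case: D => P Q /and3P[/= P0 PQ /eqP cop]; rewrite /block' /=.
case: egcdnP => // km kn /= E; rewrite cop muln1 => knP.
rewrite cop addn1 mulnC in E; split=> //.
- rewrite -(ltn_pmul2l P0) E.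
  by have := leq_mul knP (leqnn Q); rewrite mulSn; lia.
- rewrite -(ltn_pmul2l P0) E ltnS mulnC leq_mul2l; apply/orP; right; lia.
Qed.

Lemma block'_digit A : block' (1%N, A) = (0%N, 1%N).
Proof.
rewrite /block' /=; case: egcdnP => // km kn /=.
by rewrite gcd1n !muln1 => E; case: kn E => // ->.
Qed.

(* (p', q') and (p, q) are the columns of the matrix of a composition. *)
Record columns := Columns { colp' : nat; colq' : nat; colp : nat; colq : nat }.

Definition mul_block (M : columns) (D : nat * nat) : columns :=
  Columns (colp' M * (block' D).1 + colp M * (block' D).2)
    (colq' M * (block' D).1 + colq M * (block' D).2)
    (colp' M * D.1 + colp M * D.2) (colq' M * D.1 + colq M * D.2).

Definition prod_blocks (l : seq (nat * nat)) : columns :=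
  foldl mul_block (Columns 1 0 0 1) l.

Lemma prod_blocks_rcons l D : prod_blocks (rcons l D) = mul_block (prod_blocks l) D.
Proof. by rewrite /prod_blocks foldl_rcons. Qed.

(** The second and third inequalities bound the images of 0 and 1 by 1, which composition preserves.
    Each block has determinant -1, so the sign for a product depends on the parity of its length. *)
Lemma prod_blocksP l : all block l -> let M := prod_blocks l in
  [/\ (colq' M < colq M)%N, (colp M <= colq M)%N, (colp M + colp' M <= colq M + colq' M)%N &
  (colp M * colq' M == (colp' M * colq M).+1)%N
    || (colp' M * colq M == (colp M * colq' M).+1)%N].
Proof.
elim/last_ind: l => [//|l D IH]; rewrite all_rcons => /andP[bD /IH].
rewrite prod_blocks_rcons /mul_block.
have := block'P D bD; move: (block' D) => [P' Q'].
case: D bD => P Q /and3P[/= P0 PQ _] [E h1 h2 h3].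
case: (prod_blocks l) => p' q' p q /= [h4 h5 h6 det].
have mono A B : (A <= B)%N -> (p' * A + p * B <= q' * A + q * B)%N.
  move=> /subnKC <-; move: (B - A)%N => d; rewrite !mulnDr.
  by have := leq_mul h5 (leqnn d); have := leq_mul h6 (leqnn A); rewrite !mulnDl; lia.
split.
- rewrite -addnS; apply: leq_add; first by rewrite leq_mul2l (ltnW h1) orbT.
  by rewrite ltn_pmul2l // (leq_ltn_trans _ h4).
- by apply: mono; lia.
- by have := mono (P + P')%N (Q + Q')%N; rewrite !mulnDr; lia.
(* Multiplicativity of the determinant, with the negative terms moved across so that it holds in
   [nat]. *)
have key : ((p' * P + p * Q) * (q' * P' + q * Q') + p * q' =
    (p' * P' + p * Q') * (q' * P + q * Q) + p' * q)%N.
  rewrite -addn1 in E.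
  transitivity (p' * P * (q' * P') + p' * q * (P * Q') + p * q' * (P' * Q + 1)
    + p * Q * (q * Q'))%N; first by ring.
  transitivity (p' * P * (q' * P') + p' * q * (P' * Q + 1) + p * q' * (P * Q')
    + p * Q * (q * Q'))%N; [by rewrite E|by ring].
move: key det; move: ((p' * P + p * Q) * (q' * P' + q * Q'))%N.
move: ((p' * P' + p * Q') * (q' * P + q * Q))%N (p * q')%N (p' * q)%N => y z t x key.
case/orP => /eqP d; apply/orP; [right|left]; apply/eqP; lia.
Qed.

Lemma leq_colq l D : all block l -> block D ->
  (colq (prod_blocks l) * D.2 <= colq (prod_blocks (rcons l D))
    <= 2 * (colq (prod_blocks l) * D.2))%N.
Proof.
move=> /prod_blocksP; rewrite prod_blocks_rcons; case: (prod_blocks l) => p' q' p q /=.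
case: D => P Q [h1 _ _ _] /and3P[/= P0 PQ _].
by rewrite leq_addl /=; nia.
Qed.

Lemma coprime_cols l : all block l ->
  coprime (colp (prod_blocks l)) (colq (prod_blocks l)).
Proof.
move=> /prod_blocksP[_ _ _]; case: (prod_blocks l) => p' q' p q /= det.
rewrite /coprime -dvdn1; set g := gcdn p q.
have [gp gq] : (g %| p)%N /\ (g %| q)%N by rewrite dvdn_gcdl dvdn_gcdr.
have [d1 d2] : (g %| p * q')%N /\ (g %| p' * q)%N by rewrite dvdn_mulr // dvdn_mull.
by case/orP: det => /eqP E; [rewrite -(dvdn_addr _ d2)|rewrite -(dvdn_addr _ d1)];
  rewrite addn1 -E.
Qed.

Lemma pell_iter B r u v : (iter r (pell_step B) (u, v)).2 =
  (u * (pell B r).1 + v * (pell B r).2)%N.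
Proof.
elim: r u v => [|r IH] u v; first by rewrite /= muln0 muln1.
by rewrite iterSr IH /pell /=; ring.
Qed.

(** Appending the digit A turns the columns p', p into p, A p + p'. A run thus acts on both rows
    through the same two continuants, which is the form that [cover_rel] enumerates. *)
Lemma prod_blocks_digits l A r : let M := prod_blocks l in
  let N := prod_blocks (l ++ nseq r (1%N, A)) in
  colp N = (colp' M * (pell A r).1 + colp M * (pell A r).2)%N /\
  colq N = (colq' M * (pell A r).1 + colq M * (pell A r).2)%N.
Proof.
move=> M N; rewrite -!pell_iter.
suff : (colp' N, colp N) = iter r (pell_step A) (colp' M, colp M) /\
       (colq' N, colq N) = iter r (pell_step A) (colq' M, colq M).
  by case=> <- <-.
rewrite /N; elim: r {N} => [|r [IHp IHq]]; first by rewrite cats0.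
rewrite -addn1 nseqD catA cats1 prod_blocks_rcons addn1 !iterS -IHp -IHq.
case: (prod_blocks _) => p' q' p q; rewrite /mul_block block'_digit /pell_step /=.
by split; congr (_, _); ring.
Qed.

(** * Infinite compositions of unimodular maps *)

Section Tails.
Variable R : realType.
Implicit Types (y z : R) (l : seq (nat * nat)).

Definition mobius (M : columns) y : R :=
  ((colp' M)%:R * y + (colp M)%:R) / ((colq' M)%:R * y + (colq M)%:R).

Definition block_map (D : nat * nat) y : R :=
  ((block' D).1%:R * y + D.1%:R) / ((block' D).2%:R * y + D.2%:R).

Lemma block_den_gt0 D y : block D -> 0 <= y -> 0 < (block' D).2%:R * y + D.2%:R.
Proof.
move=> /and3P[P0 PQ _] y0; rewrite ltr_wpDl ?mulr_ge0 ?ler0n // ltr0n; lia.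
Qed.

Lemma block_map_gt0 D y : block D -> 0 <= y -> 0 < block_map D y.
Proof.
move=> bD y0; rewrite divr_gt0 ?block_den_gt0 //.
by have /and3P[P0 _ _] := bD; rewrite ltr_wpDl ?mulr_ge0 ?ler0n // ltr0n.
Qed.

Lemma block_mapB D y z : block D -> 0 <= y -> 0 <= z ->
  block_map D y - block_map D z =
  (z - y) / (((block' D).2%:R * y + D.2%:R) * ((block' D).2%:R * z + D.2%:R)).
Proof.
move=> bD y0 z0; have [E _ _ _] := block'P _ bD.
have := block_den_gt0 _ _ bD y0; have := block_den_gt0 _ _ bD z0.
have : (D.1%:R * (block' D).2%:R = (block' D).1%:R * D.2%:R + 1 :> R).
  by rewrite -!natrM E -natr1.
rewrite /block_map; move: (D.1%:R) (D.2%:R) ((block' D).1%:R) ((block' D).2%:R).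
move=> P Q P' Q' e /lt0r_neq0 h1 /lt0r_neq0 h2.
have -> : z - y = (P * Q' - P' * Q) * (z - y) by rewrite e addrAC subrr add0r mul1r.
by field; rewrite h1 h2.
Qed.

(** Both denominators are at least Q >= 8, whence 64 = 8 ^ 2. *)
Lemma block_map_contract D y z : block D -> 0 <= y -> 0 <= z ->
  `|block_map D y - block_map D z| <= `|y - z| / 64.
Proof.
move=> bD y0 z0; rewrite block_mapB // normrM distrC ler_wpM2l //.
have := block_den_gt0 _ _ bD y0; have := block_den_gt0 _ _ bD z0 => hz hy.
rewrite gtr0_norm ?invr_gt0 ?mulr_gt0 // lef_pV2 ?posrE ?mulr_gt0 //.
have D8 : 8 <= D.2%:R :> R by have /and3P[? ? _] := bD; rewrite ler_nat; lia.
have mono w : 0 <= w -> 8 <= (block' D).2%:R * w + D.2%:R :> R.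
  by move=> w0; apply: (le_trans D8); rewrite lerDr mulr_ge0 ?ler0n.
by have := ler_pM _ _ (mono _ y0) (mono _ z0); lra.
Qed.

Lemma block_map_le D y : block D -> 0 <= y -> block_map D y <= D.1%:R / D.2%:R.
Proof.
move=> bD y0; have h0 := block_den_gt0 _ 0 bD (lexx 0).
have := block_mapB _ _ _ bD y0 (lexx 0).
rewrite {2}/block_map !mulr0 !add0r; rewrite mulr0 add0r in h0.
move=> /eqP; rewrite subr_eq => /eqP ->; rewrite gerDr.
by rewrite mulr_le0_ge0 ?oppr_le0 // invr_ge0 mulr_ge0 ?ltW // block_den_gt0.
Qed.

Lemma block_map_mobius l D y : block D -> 0 <= y ->
  mobius (prod_blocks (rcons l D)) y = mobius (prod_blocks l) (block_map D y).
Proof.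
move=> bD y0; have d0 := lt0r_neq0 (block_den_gt0 _ _ bD y0).
rewrite prod_blocks_rcons /mobius /block_map /= !natrD !natrM.
move: d0; move: (D.1%:R) (D.2%:R) ((block' D).1%:R) ((block' D).2%:R).
move: (_%:R) (_%:R) (_%:R) (_%:R) => a b c d P Q P' Q' d0.
set N := P' * y + P; set d1 := Q' * y + Q in d0 *.
have E u v : u * (N / d1) + v = (u * N + v * d1) / d1 by field.
rewrite !E invf_div mulrA divfK //; congr (_ / _); rewrite /N /d1; ring.
Qed.

Definition compose_blocks l y : R := foldr block_map y l.

Lemma compose_blocks_ge0 l y : all block l -> 0 <= y -> 0 <= compose_blocks l y.
Proof.
by move=> + y0; elim: l => [//|D l IH] /= /andP[bD /IH h]; apply/ltW/block_map_gt0.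
Qed.

Lemma compose_blocks_le1 l y : all block l -> 0 <= y <= 1 -> compose_blocks l y <= 1.
Proof.
case: l => [_ /andP[//]|D l] /= /andP[bD bl] /andP[y0 _].
apply: le_trans (block_map_le _ _ bD (compose_blocks_ge0 _ _ bl y0)) _.
by have /and3P[P0 PQ _] := bD; rewrite ler_pdivrMr ?mul1r ?ler_nat ?ltr0n; lia.
Qed.

Lemma compose_blocks_mobius l y : all block l -> 0 <= y ->
  mobius (prod_blocks l) y = compose_blocks l y.
Proof.
elim/last_ind: l y => [|l D IH] y; first by rewrite /mobius /= mul0r mul1r add0r addr0 divr1.
rewrite all_rcons => /andP[bD bl] y0; rewrite block_map_mobius // IH ?ltW ?block_map_gt0 //.
by rewrite /compose_blocks foldr_rcons.
Qed.

Lemma compose_blocks_contract l y z : all block l -> 0 <= y -> 0 <= z ->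
  `|compose_blocks l y - compose_blocks l z| <= `|y - z| / 64 ^+ size l.
Proof.
move=> + y0 z0; elim: l => [_|D l IH] /=; first by rewrite divr1.
move=> /andP[bD bl]; apply: (le_trans (block_map_contract _ _ _ bD _ _)).
- exact: compose_blocks_ge0.
- exact: compose_blocks_ge0.
by rewrite exprS invfM mulrCA mulrC ler_wpM2l ?IH.
Qed.

Variable D : nat -> nat * nat.
Hypothesis blockD : forall i, block (D i).

Let approx k n : R := compose_blocks (mkseq (fun i => D (k + i)%N) n) 0.

Let block_mkseq k n : all block (mkseq (fun i => D (k + i)%N) n).
Proof. by apply/allP => _ /mapP[i _ ->]. Qed.

Let approxS k n : approx k n.+1 = block_map (D k) (approx k.+1 n).
Proof.
rewrite /approx /mkseq /= addn0; congr (block_map _ (compose_blocks _ _)).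
by rewrite (iotaDl 1 0) -map_comp; apply: eq_map => i /=; rewrite addnA addn1.
Qed.

Let approx_cauchy k n m : (n <= m)%N -> `|approx k n - approx k m| <= 64 ^- n.
Proof.
move=> /subnKC <-; rewrite /approx /mkseq iotaD map_cat /compose_blocks foldr_cat.
set l := [seq _ | i <- iota 0 n]; set l2 := [seq _ | i <- iota _ _].
have bl : all block l by exact: block_mkseq.
have bl2 : all block l2 by apply/allP => _ /mapP[i _ ->].
have h0 : 0 <= compose_blocks l2 0 by exact: compose_blocks_ge0.
have h1 : compose_blocks l2 0 <= 1 by rewrite compose_blocks_le1 // lexx ler01.
apply: le_trans (compose_blocks_contract _ _ _ bl (lexx 0) h0) _.
by rewrite size_map size_iota sub0r normrN ger0_norm // ler_piMl.
Qed.

Let approx_cvg k : cvgn (approx k).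
Proof.
apply/cauchy_cvgP/cauchy_exP => e e0.
have [N _ HN] := near_infty_natSinv_expn_lt (PosNum e0).
exists (approx k N), N => // m /= Nm; rewrite /ball /=.
apply: le_lt_trans (approx_cauchy _ _ _ Nm) _.
apply: le_lt_trans (HN N (leqnn N)); rewrite div1r lef_pV2 ?posrE ?exprn_gt0 //.
by rewrite lerXn2r ?nnegrE //; lra.
Qed.

Definition tail k : R := limn (approx k).

Lemma tail_ge0 k : 0 <= tail k.
Proof.
by apply: limr_ge (approx_cvg k) _; apply: nearW => n; exact: compose_blocks_ge0.
Qed.

Lemma tailS k : tail k = block_map (D k) (tail k.+1).
Proof.
apply: cvg_lim => //; rewrite -(cvg_shiftS (approx k)).
apply/cvgrPdist_le => e e0.
have /cvgrPdist_le/(_ _ e0) := approx_cvg k.+1.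
apply: filterS => n /= h; rewrite approxS.
apply: le_trans (block_map_contract _ _ _ (blockD k) (tail_ge0 _) _) _.
  exact: compose_blocks_ge0.
by move: h; rewrite -/(tail k.+1); lra.
Qed.

Lemma tail_bounds k : 0 < tail k <= (D k).1%:R / (D k).2%:R.
Proof.
by rewrite tailS block_map_gt0 ?block_map_le ?tail_ge0.
Qed.

Lemma tail_mobius n : tail 0 = mobius (prod_blocks (mkseq D n)) (tail n).
Proof.
elim: n => [|n IH]; first by rewrite /mobius /= mul0r mul1r add0r addr0 divr1.
rewrite mkseqS block_map_mobius ?tail_ge0 // -tailS -IH //.
Qed.

End Tails.

(** * Irrationality exponent of a limit point *)

Lemma finite_int_box (N : nat) : finite_set [set z : int * int | (`|z.1| <= N)%N /\ (`|z.2| <= N)%N].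
Proof.
have fin : finite_set [set z : int | (`|z| <= N)%N].
  apply: (@sub_finite_set _ _ ((Posz @` `I_N.+1) `|` ((fun n => - n%:Z) @` `I_N.+1))).
    move=> z /= zN; case: (lerP 0 z) => z0; [left|right]; exists `|z|%N => //=; lia.
  by rewrite finite_setU; split; exact: finite_image (finite_II _).
by apply: sub_finite_set (finite_setX fin fin).
Qed.

Lemma dist_fractions (R : realType) (p q r t : int) : 0 < q -> 0 < t ->
  p * t != r * q -> (q%:~R * t%:~R)^-1 <= `|p%:~R / q%:~R - r%:~R / t%:~R| :> R.
Proof.
move=> q0 t0 ne.
have q0R : 0 < q%:~R :> R by rewrite ltr0z.
have t0R : 0 < t%:~R :> R by rewrite ltr0z.
have -> : p%:~R / q%:~R - r%:~R / t%:~R = (p * t - r * q)%:~R / (q%:~R * t%:~R) :> R.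
  by rewrite intrB !intrM; field; rewrite !gt_eqF.
rewrite normrM normfV (@gtr0_norm _ (_ * _)) ?mulr_gt0 //.
apply: ler_peMl; first by rewrite invr_ge0 mulr_ge0 ?ltW.
by rewrite -intr_norm ler1z -gtz0_ge1 normr_gt0 subr_eq0.
Qed.

Section Exponent.
Variables (R : realType) (D : nat -> nat * nat).
Hypothesis blockD : forall i, block (D i).
Local Notation x := (tail R D 0).
Local Notation p n := (colp (prod_blocks (mkseq D n))).
Local Notation q n := (colq (prod_blocks (mkseq D n))).

Let all_mkseq n : all block (mkseq D n).
Proof. by apply/allP => _ /mapP[i _ ->]. Qed.

Lemma colq_gt0 n : (0 < q n)%N.
Proof. by have [h _ _ _] := prod_blocksP _ (all_mkseq n); apply: leq_ltn_trans h. Qed.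

Lemma colq_lt n : (n < q n)%N.
Proof.
elim: n => [//|n IH]; apply: leq_trans (_ : q n * 8 <= _)%N; first lia.
rewrite mkseqS; have /andP[h _] := leq_colq _ _ (all_mkseq n) (blockD n).
apply: leq_trans h; rewrite leq_mul2l; have /and3P[? ? _] := blockD n; lia.
Qed.

Lemma colq_homo : {homo (fun n => q n) : m n / (m <= n)%N}.
Proof.
apply: homo_leq => [//|y u v|n]; first exact: leq_trans.
rewrite mkseqS; have /andP[h _] := leq_colq _ _ (all_mkseq n) (blockD n).
by apply: leq_trans h; rewrite leq_pmulr //; have /and3P[? ? _] := blockD n; lia.
Qed.

(** With y the n-th tail and determinant 1 or -1, x - p / q is y / (q (q' y + q)) up to sign, and 0
    < y <= P / Q for the next block (P, Q). *)
Lemma tail_convergent n :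
  0 < `|x - (p n)%:R / (q n)%:R| <= (D n).1%:R / (D n).2%:R / (q n)%:R ^+ 2.
Proof.
rewrite (tail_mobius _ _ blockD n) /mobius.
have /andP[y0 yD] := tail_bounds R _ blockD n.
have [h1 _ _ det] := prod_blocksP _ (all_mkseq n); have := colq_gt0 n.
move: det h1; move: (prod_blocks _) => [p' q' p q] /= det h1 q0.
set y := tail R D n in y0 yD *.
have q0R : 0 < q%:R :> R by rewrite ltr0n.
have d0 : 0 < q'%:R * y + q%:R by rewrite ltr_wpDl // mulr_ge0 // ltW.
have -> : (p'%:R * y + p%:R) / (q'%:R * y + q%:R) - p%:R / q%:R =
    (p' * q)%:R * y / (q%:R * (q'%:R * y + q%:R))
    - (p * q')%:R * y / (q%:R * (q'%:R * y + q%:R)).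
  by rewrite !natrM; field; rewrite !gt_eqF.
have -> : `|(p' * q)%:R * y / (q%:R * (q'%:R * y + q%:R))
    - (p * q')%:R * y / (q%:R * (q'%:R * y + q%:R))| = y / (q%:R * (q'%:R * y + q%:R)).
  have w0 : 0 < y / (q%:R * (q'%:R * y + q%:R)) by rewrite divr_gt0 // mulr_gt0.
  case/orP: det => /eqP ->; rewrite -natr1 -!mulrA mulrDl mul1r.
    by rewrite opprD addNKr normrN gtr0_norm.
  by rewrite addrAC subrr add0r gtr0_norm.
rewrite divr_gt0 ?mulr_gt0 //=; apply: ler_pM => //;
  rewrite ?invr_ge0 ?mulr_ge0 ?(ltW y0) ?(ltW d0) ?(ltW q0R) //.
rewrite lef_pV2 ?posrE ?exprn_gt0 ?mulr_gt0 // expr2 ler_pM2l // lerDr mulr_ge0 //.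
exact: ltW.
Qed.

Lemma tail_lt1 : 0 < x < 1.
Proof.
have /andP[-> xD] := tail_bounds R _ blockD 0; apply: le_lt_trans xD _.
have /and3P[P0 PQ _] := blockD 0.
by rewrite ltr_pdivrMr ?mul1r ?ltr_nat ?ltr0n; lia.
Qed.

Lemma irrationality_exponent_ge (a : R) :
  (forall z B, z < a -> exists2 n, (B <= n)%N &
    (D n).1%:R / (D n).2%:R * (q n)%:R `^ z < (q n)%:R ^+ 2) ->
  (a%:E <= irrationality_exponent x)%E.
Proof.
move=> H; apply/lee_subgt0Pr => e e0; apply: ereal_sup_ubound; exists (a - e) => //.
move=> /= fin.
(* Finitely many pairs have bounded denominators, whereas those of the convergents are unbounded by
   [colq_lt]. *)
have [N HN] : exists N : nat, forall pq : int * int,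
    0 < pq.2 /\ 0 < `|x - pq.1%:~R / pq.2%:~R| < (pq.2%:~R `^ (a - e))^-1 ->
    (`|pq.2| <= N)%N.
  move/finite_fsetP: fin => [X XE].
  exists (\max_(z <- X) `|z.2|)%N => pq Hpq.
  have pX : pq \in X by have : [set` X] pq by rewrite -XE.
  exact: (@leq_bigmax_seq _ _ xpredT (fun z : int * int => `|z.2|%N)).
have [n Bn Hn] := H (a - e) N.+1 ltac:(lra).
have := HN ((p n)%:Z, (q n)%:Z); rewrite /= leqNgt (ltn_trans Bn (colq_lt n)).
have q0 := colq_gt0 n; have q0R : 0 < (q n)%:R :> R by rewrite ltr0n.
have /andP[h1 h2] := tail_convergent n.
move=> /(_ _)/notF; apply; split; first by rewrite ltz_nat.
rewrite !pmulrn in h1 h2 *; rewrite h1 /=; apply: le_lt_trans h2 _.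
by rewrite ltr_pdivrMr ?exprn_gt0 // [ltRHS]mulrC ltr_pdivlMr ?powR_gt0.
Qed.

(** A fraction r / k is compared with the first convergent p1 / q1 such that q1 >= 2 k. The two
    differ, since q1 > k, so |x - r / k| >= 1 / (q1 k) - 1 / q1 ^ 2 >= 1 / (2 q1 k). The previous
    denominator is below 2 k, so q1 <= (2 k) ^ (a - 1 + e) for large k, and an approximation of
    order z = a + 2 e forces k ^ e < 2 ^ (a + e). *)
Lemma irrationality_exponent_le (a : R) : 1 <= a ->
  (forall e, 0 < e -> exists n0, forall n, (n0 <= n)%N ->
    (q n.+1)%:R <= (q n)%:R `^ (a - 1 + e)) ->
  (irrationality_exponent x <= a%:E)%E.
Proof.
move=> a1 H; apply: ge_ereal_sup => _ [z zinf <-].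
rewrite lee_fin leNgt; apply/negP => az; apply: zinf.
set e := (z - a) / 2; have e0 : 0 < e by rewrite /e; lra.
have [n0 Hn0] := H e e0.
have [T HT] : exists T : nat, forall t : nat, t%:R `^ e < 2 `^ (a + e) -> (t <= T)%N.
  exists (Num.truncn ((2 `^ (a + e)) `^ e^-1)) => t ht.
  have : t%:R < (2 `^ (a + e)) `^ e^-1 :> R.
    have -> : t%:R = (t%:R `^ e) `^ e^-1 :> R by rewrite -powRrM mulfV ?gt_eqF // powRr1.
    by rewrite gt0_ltr_powR ?invr_gt0 // nnegrE powR_ge0.
  by move=> /ltW/le_truncn; rewrite natrK.
pose N := maxn T (q n0.+1).
apply: sub_finite_set (finite_int_box (2 * N)) => -[r t] /= [t0 /andP[lt0 lt1]].
have [k tk] : exists k : nat, t = k%:Z by exists `|t|%N; lia.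
subst t; rewrite /= ltz_nat in t0 *; have t0R : 0 < k%:R :> R by rewrite ltr0n.
rewrite -!pmulrn in lt0 lt1.
have kN : (k <= N)%N.
  rewrite leqNgt gtn_max; apply/negP => /andP[Tk qk].
  have ex : exists n, (2 * k <= q n)%N by exists (2 * k)%N; apply/ltnW/colq_lt.
  have [[|m] nP nmin] := ex_minnP ex; first by move: nP; rewrite /=; lia.
  have {}nmin : (q m < 2 * k)%N.
    by rewrite ltnNge; apply/negP => /nmin; rewrite ltnn.
  have mn0 : (n0 <= m)%N.
    rewrite leqNgt; apply/negP => mn0.
    have := colq_homo m.+1 n0.+1 ltac:(lia); move: nP qk; rewrite /=; lia.
  have {}Hn0 := Hn0 _ mn0.
  have := tail_convergent m.+1; have := coprime_cols _ (all_mkseq m.+1).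
  have := colq_gt0 m.+1.
  move: nP Hn0; move: (q m.+1) (p m.+1) => q1 p1 kq1 Hn0 q1_gt0 cop /andP[_ near].
  have q1R : 0 < q1%:R :> R by rewrite ltr0n.
  have ne : p1%:Z * k%:Z != r * q1%:Z.
    apply/eqP => E; have : (q1 %| p1 * k)%N.
      by rewrite -(dvdzE q1 (p1 * k)%N) PoszM E dvdz_mull.
    by rewrite Gauss_dvdr 1?coprime_sym // => /dvdn_leq; lia.
  have far := @dist_fractions R p1 q1 r k q1_gt0 t0 ne; rewrite -!pmulrn in far.
  have D1 : (D m.+1).1%:R / (D m.+1).2%:R <= 1 :> R.
    have /and3P[P0 PQ _] := blockD m.+1.
    by rewrite ler_pdivrMr ?mul1r ?ler_nat ?ltr0n; lia.
  have near2 : `|x - p1%:R / q1%:R| <= (q1%:R * k%:R)^-1 / 2.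
    apply: le_trans near _; rewrite -invfM expr2.
    apply: (@le_trans _ _ (1 / (q1%:R * q1%:R))); first by rewrite ler_pM2r ?invr_gt0 ?mulr_gt0.
    rewrite div1r lef_pV2 ?posrE ?mulr_gt0 // -mulrA ler_pM2l // mulrC.
    by move: kq1; rewrite -(ler_nat R) natrM.
  have far2 : (2 * (q1%:R * k%:R))^-1 <= `|x - r%:~R / k%:R|.
    have := ler_distD x (p1%:R / q1%:R) (r%:~R / k%:R); rewrite (distrC _ x) => tri.
    rewrite invfM; lra.
  have qm : q1%:R <= (2 * k%:R) `^ (a - 1 + e) :> R.
    apply: le_trans Hn0 _; apply: ge0_ler_powR; rewrite ?nnegrE ?mulr_ge0 //.
      by lra.
    by move/ltnW : nmin; rewrite -(ler_nat R) natrM.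
  have := le_lt_trans far2 lt1; rewrite ltf_pV2 ?posrE ?powR_gt0 ?mulr_gt0 // => kz.
  have : k%:R `^ e < 2 `^ (a + e).
    have ka : 0 < k%:R `^ (a + e) :> R by rewrite powR_gt0.
    rewrite -(ltr_pM2r ka) -powRD ?(gt_eqF t0R) ?implybT //.
    have -> : e + (a + e) = z by rewrite /e; field.
    apply: lt_le_trans kz _; rewrite -powRM ?ler0n //.
    have k2 : 0 < 2 * k%:R :> R by rewrite mulr_gt0.
    have -> : a + e = 1 + (a - 1 + e) by ring.
    rewrite powRD ?(gt_eqF k2) ?implybT // powRr1 ?(ltW k2) //.
    by rewrite mulrCA mulrC ler_pM2l.
  by move/HT; rewrite leqNgt Tk.
split; last lia.
(* Bounded denominators leave finitely many numerators: |x - r / k| <= 1 and 0 < x < 1 give |r| <= 2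
   k. *)
have k1 : 1 <= k%:R :> R by rewrite ler1n.
have xr : `|x - r%:~R / k%:R| <= 1.
  apply: ltW; apply: (lt_le_trans lt1); rewrite invf_le1 ?powR_gt0 //.
  apply: (@le_trans _ _ (k%:R `^ 0)); first by rewrite powRr0.
  by apply: ler_powR => //; rewrite /e in e0; lra.
have /andP[x0 x1] := tail_lt1.
have : `|r%:~R / k%:R| <= 2 :> R.
  have := ler_normB x (x - r%:~R / k%:R); rewrite opprB addrC subrK (gtr0_norm x0); lra.
rewrite normrM normfV (@gtr0_norm _ k%:R) // ler_pdivrMr // -intr_norm -natrM pmulrn ler_int.
lia.
Qed.

End Exponent.

(** * Paths avoiding a set of small weight *)

Section Diagonalization.
Variables (R : realType) (T : choiceType) (S : nat -> seq T).
Hypothesis S_gt0 : forall n, (0 < size (S n))%N.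

Fixpoint paths (n : nat) : seq (seq T) :=
  if n is m.+1 then [seq rcons l x | l <- paths m, x <- S m] else [:: [::]].

Lemma size_path n l : l \in paths n -> size l = n.
Proof.
elim: n l => [|n IH] l; first by rewrite inE => /eqP ->.
by move=> /allpairsP[[l' x] /= [/IH <- _ ->]]; rewrite size_rcons.
Qed.

Lemma size_paths n : size (paths n) = (\prod_(i < n) size (S i))%N.
Proof. by elim: n => [|n IH]; rewrite ?big_ord0 // big_ord_recr /= -IH size_allpairs. Qed.

Lemma paths_uniq n : (forall i, uniq (S i)) -> uniq (paths n).
Proof.
move=> uS; elim: n => [//|n IH]; apply: allpairs_uniq => // -[l x] [l' x'] _ _ /=.
by move=> /rcons_inj[-> ->].
Qed.

(* The proportion of the extensions of l by k further terms which are bad. *)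
Fixpoint bad_ratio (bad : pred (seq T)) (k : nat) (l : seq T) : R :=
  if k is k'.+1 then
    (\sum_(x <- S (size l)) bad_ratio bad k' (rcons l x)) / (size (S (size l)))%:R
  else (bad l)%:R.

Lemma bad_ratio_ge0 bad k l : 0 <= bad_ratio bad k l.
Proof.
elim: k l => [|k IH] l /=; first exact: ler0n.
by rewrite divr_ge0 ?ler0n // sumr_ge0.
Qed.

Lemma bad_ratio_count bad n :
  bad_ratio bad n [::] = (count bad (paths n))%:R / (size (paths n))%:R.
Proof.
suff H k m : \sum_(l <- paths m) bad_ratio bad k l =
    (count bad (paths (m + k)))%:R / (\prod_(m <= i < m + k) size (S i))%:R.
  by have := H n 0%N; rewrite big_seq1 add0n big_mkord -size_paths.
elim: k m => [|k IH] m.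
  rewrite addn0 big_geq // divr1 -sum1_count natr_sum [RHS]big_mkcond /=.
  by apply: eq_bigr => l _; case: (bad l).
have -> : \sum_(l <- paths m) bad_ratio bad k.+1 l =
    (\sum_(l <- paths m.+1) bad_ratio bad k l) / (size (S m))%:R.
  rewrite /= big_allpairs_dep mulr_suml big_seq [RHS]big_seq.
  by apply: eq_bigr => l /size_path ->.
rewrite IH addSnnS -mulrA -invfM -natrM mulnC [in RHS]big_ltn //.
by rewrite -addSnnS leq_addr.
Qed.

(** Method of conditional expectations: [Phi l] is the expected number of bad events on a random
    extension of [l]. Its average over the next term is [Phi l] again, so some next term keeps it
    below 1. *)
Lemma path_avoiding (I : choiceType) (W : set I) (lev : I -> nat)
    (bad : I -> pred (seq T)) :
  (\esum_(i in W) ((count (bad i) (paths (lev i)))%:R /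
     (size (paths (lev i)))%:R)%:E < 1%:E :> \bar R)%E ->
  exists D : nat -> T, (forall n, D n \in S n) /\
    forall i, W i -> ~~ bad i (mkseq D (lev i)).
Proof.
(* [take] and the truncated subtraction freeze the weight of event i once the path has passed its
   level. *)
pose w i l := bad_ratio (fun l => bad i (take (lev i) l)) (lev i - size l) l.
have w0 i l : 0 <= w i l by exact: bad_ratio_ge0.
pose Phi l : \bar R := (\esum_(i in W) (w i l)%:E)%E.
have w_avg i l : \sum_(x <- S (size l)) w i (rcons l x) = \sum_(x <- S (size l)) w i l.
  have [lt|ge] := ltnP (size l) (lev i).
    rewrite [RHS]big_const_seq count_predT iter_addr_0 -[RHS]mulr_natr {2}/w -(subnSK lt) /=.
    rewrite divfK ?pnatr_eq0 -?lt0n //.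
    by apply: eq_bigr => x _; rewrite /w size_rcons.
  apply: eq_bigr => x _; rewrite /w size_rcons.
  have -> : (lev i - (size l).+1 = 0)%N by lia.
  have -> : (lev i - size l = 0)%N by lia.
  by rewrite /= -cats1 takel_cat.
have Phi_avg l : (\sum_(x <- S (size l)) Phi (rcons l x) = \sum_(x <- S (size l)) Phi l)%E.
  rewrite /Phi -!esum_sum; try by move=> *; rewrite lee_fin.
  by apply: eq_esum => i _; rewrite !sumEFin w_avg.
have next l : exists x, (Phi l < 1)%E -> x \in S (size l) /\ (Phi (rcons l x) < 1)%E.
  have [x0 x0S] : exists x, x \in S (size l).
    by have := S_gt0 (size l); case: (S _) => // x s; exists x; exact: mem_head.
  have [|/negP Pl] := boolP (Phi l < 1)%E; last by exists x0.
  move=> Pl; apply: contrapT => /forallNP H.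
  have : (\sum_(x <- S (size l)) 1 <= \sum_(x <- S (size l)) Phi l)%E.
    rewrite -Phi_avg big_seq [leRHS]big_seq; apply: lee_sum => x xS.
    by rewrite leNgt; apply/negP => Px; apply: (H x).
  have Phi0 : (0 <= Phi l)%E by apply: esum_ge0 => i _; rewrite lee_fin.
  have := Pl; have /fineK <- : Phi l \is a fin_num.
    by rewrite ge0_fin_numE // (lt_trans Pl) // ltry.
  rewrite !sumEFin lee_fin !big_const_seq !count_predT !iter_addr_0 lte_fin.
  by rewrite lerMn2r eqn0Ngt S_gt0 /= => /lt_geF ->.
move=> Phi_nil.
have {}Phi_nil : (Phi [::] < 1)%E.
  apply: le_lt_trans Phi_nil; apply: le_esum => i _; rewrite lee_fin -bad_ratio_count /w subn0.
  rewrite !bad_ratio_count (@eq_in_count _ _ (bad i)) // => l /size_path e.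
  by rewrite take_oversize ?e.
have [nxt Hnxt] := choice next.
pose pre n := iter n (fun l => rcons l (nxt l)) [::].
pose D n := nxt (pre n).
have preE n : pre n = mkseq D n by elim: n => [//|n IH]; rewrite mkseqS -IH.
have Pre n : (Phi (pre n) < 1)%E.
  by elim: n => [//|n IH]; have [] := Hnxt (pre n) IH.
exists D; split=> [n|i Wi].
  have e : size (pre n) = n by rewrite preE size_mkseq.
  by have [] := Hnxt (pre n) (Pre n); rewrite e.
(* An event that had occurred would contribute weight 1 by itself. *)
have := Pre (lev i); rewrite preE; apply: contraTN => bi; rewrite -leNgt.
have FI : fsets W [set i] by split => [|_ /= -> //]; exact: finite_set1.
apply: esum_ge; exists [set i] => //.
rewrite fsbig_set1 lee_fin /w size_mkseq subnn /= take_oversize ?size_mkseq //.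
by rewrite bi.
Qed.

End Diagonalization.

(** * Lower bound on the dimension *)

(** Denominators in one pool agree up to a factor 4, as [block_map_disjoint] requires; [tau] records
    how small P / Q is, which is extra precision of the convergent before the block. *)
Definition pool_ok (sg tau : nat) (S : seq (nat * nat)) : Prop :=
  uniq S /\ forall D, D \in S ->
    [&& block D, (2 ^ sg <= 4 * D.2)%N, (D.2 <= 2 ^ sg)%N & (D.1 * 2 ^ tau <= D.2)%N].

Lemma coprime_eq_fraction P Q P1 Q1 : coprime P Q -> coprime P1 Q1 ->
  (0 < Q)%N -> (0 < Q1)%N -> (P * Q1 = P1 * Q)%N -> P = P1 /\ Q = Q1.
Proof.
move=> c c1 Q0 Q10 E.
have EQ : Q = Q1.
  apply/eqP; rewrite eqn_dvd; apply/andP; split.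
    by rewrite -(@Gauss_dvdr _ P) 1?coprime_sym // E dvdn_mull.
  by rewrite -(@Gauss_dvdr _ P1) 1?coprime_sym // -E dvdn_mull.
by split=> //; apply/eqP; rewrite -(eqn_pmul2r Q0) {1}EQ E.
Qed.

Section Separation.
Variable R : realType.

Lemma compose_blocks_le8 l : all block l -> compose_blocks R l 0 <= 8^-1.
Proof.
case: l => [|D l] /=; first by rewrite invr_ge0.
move=> /andP[bD bl]; apply: le_trans (block_map_le _ _ _ bD (compose_blocks_ge0 _ _ _ bl (lexx 0))) _.
have /and3P[P0 PQ _] := bD.
rewrite ler_pdivrMr ?ltr0n; last lia.
by rewrite mulrC ler_pdivlMr // mulrC -natrM ler_nat.
Qed.

Lemma block_map_near D (y : R) : block D -> 0 <= y <= 8^-1 ->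
  0 <= D.1%:R / D.2%:R - block_map R D y <= (8 * D.2%:R ^+ 2)^-1.
Proof.
move=> bD /andP[y0 y8]; rewrite subr_ge0 block_map_le //=.
have := block_mapB _ _ _ _ bD (lexx 0) y0.
rewrite {1}/block_map !mulr0 !add0r subr0 => ->.
have D0 : 0 < D.2%:R :> R by have /and3P[? ? _] := bD; rewrite ltr0n; lia.
have d0 : 0 < (block' D).2%:R * y + D.2%:R := block_den_gt0 _ _ _ bD y0.
rewrite (invfM 8); apply: ler_pM => //; first by rewrite invr_ge0 mulr_ge0 // ltW.
rewrite lef_pV2 ?posrE ?mulr_gt0 ?exprn_gt0 ?block_den_gt0 // expr2 ler_pM2l //.
by rewrite lerDr mulr_ge0.
Qed.

(** Both fractions exceed the common value, by at most 1 / (8 Q ^ 2) and 1 / (8 Q1 ^ 2), and each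
    bound is below 1 / (Q Q1), the least distance of different fractions. Equal fractions give equal
    blocks, and the map of a block is injective. *)
Lemma block_map_disjoint D D1 (y y1 : R) : block D -> block D1 ->
  (D.2 <= 4 * D1.2)%N -> (D1.2 <= 4 * D.2)%N ->
  0 <= y <= 8^-1 -> 0 <= y1 <= 8^-1 ->
  block_map R D y = block_map R D1 y1 -> D = D1 /\ y = y1.
Proof.
move=> bD bD1 QQ QQ1 y8 y18 E.
have := block_map_near _ _ bD y8; have := block_map_near _ _ bD1 y18.
rewrite -E; have /and3P[P0 PQ c] := bD; have /and3P[P10 PQ1 c1] := bD1.
have Q0 : (0 < D.2)%N by lia.
have Q10 : (0 < D1.2)%N by lia.
have [EQ|ne] := eqVneq (D.1 * D1.2)%N (D1.1 * D.2)%N.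
  have [e1 e2] := coprime_eq_fraction _ _ _ _ c c1 Q0 Q10 EQ.
  have {}e1 : D = D1 by rewrite (surjective_pairing D) e1 e2 -surjective_pairing.
  move=> _ _; split => //; subst D1; apply/eqP; rewrite eq_sym -subr_eq0.
  have /andP[y0 _] := y8; have /andP[y10 _] := y18.
  have := block_mapB _ _ _ _ bD y0 y10; rewrite -{1}E subrr => /esym/eqP.
  rewrite mulf_eq0 invr_eq0 => /orP[//|].
  by rewrite gt_eqF // mulr_gt0 // block_den_gt0.
have := @dist_fractions R D.1 D.2 D1.1 D1.2 Q0 Q10 ne; rewrite -!pmulrn.
have q0 : 0 < D.2%:R :> R by rewrite ltr0n.
have q10 : 0 < D1.2%:R :> R by rewrite ltr0n.
have qq : D.2%:R <= 4 * D1.2%:R :> R by rewrite -natrM ler_nat.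
have qq1 : D1.2%:R <= 4 * D.2%:R :> R by rewrite -natrM ler_nat.
move: (block_map R D y) (D.1%:R / _) (D1.1%:R / _) => v u u1 far /andP[n1 n2] /andP[n3 n4]; exfalso.
have h1 : (8 * D.2%:R ^+ 2)^-1 < (D.2%:R * D1.2%:R)^-1 :> R.
  by rewrite ltf_pV2 ?posrE ?mulr_gt0 ?exprn_gt0 // expr2 mulrCA ltr_pM2l //; lra.
have h2 : (8 * D1.2%:R ^+ 2)^-1 < (D.2%:R * D1.2%:R)^-1 :> R.
  by rewrite ltf_pV2 ?posrE ?mulr_gt0 ?exprn_gt0 // expr2 mulrA ltr_pM2r //; lra.
suff : `|u - u1| < (D.2%:R * D1.2%:R)^-1 by rewrite ltNge far.
rewrite ltr_norml; lra.
Qed.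

Variables (S : nat -> seq (nat * nat)) (sg tau : nat -> nat).
Hypothesis S_ok : forall i, pool_ok (sg i) (tau i) (S i).

Let sgS n := (\sum_(i < n) sg i)%N.

Lemma mem_pathsP n l : l \in paths _ S n ->
  size l = n /\ forall i, (i < n)%N -> nth (0, 0)%N l i \in S i.
Proof.
elim: n l => [|n IH] l; first by rewrite inE => /eqP ->.
move=> /allpairsP[[l' D] /= [/IH[sl Hl] DS ->]]; rewrite size_rcons sl; split=> // i.
rewrite ltnS leq_eqVlt nth_rcons sl => /orP[/eqP->|lt]; first by rewrite ltnn eqxx.
by rewrite lt Hl.
Qed.

Lemma block_paths n l : l \in paths _ S n -> all block l.
Proof.
move=> /mem_pathsP[sl Hl]; apply/(all_nthP (0, 0)%N) => i; rewrite sl => /Hl.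
by have [_ H] := S_ok i; move=> /H/and4P[].
Qed.

Lemma compose_blocks_inj n : {in paths _ S n &, injective (compose_blocks R ^~ 0)}.
Proof.
suff H k l l' : size l = size l' ->
    (forall i, (i < size l)%N -> nth (0, 0)%N l i \in S (k + i)%N) ->
    (forall i, (i < size l')%N -> nth (0, 0)%N l' i \in S (k + i)%N) ->
    compose_blocks R l 0 = compose_blocks R l' 0 -> l = l'.
  move=> l l' /mem_pathsP[sl Hl] /mem_pathsP[sl' Hl'].
  by apply: (H 0%N); rewrite ?sl ?sl'.
elim: l k l' => [|D l IH] k [|D' l'] //= [sl] Hl Hl'.
have blocks : forall s, (forall i, (i < size s)%N -> nth (0, 0)%N s i \in S (k.+1 + i)%N) -> all block s.
  move=> s Hs; apply/(all_nthP (0, 0)%N) => i /Hs.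
  by have [_ H] := S_ok (k.+1 + i); move=> /H/and4P[].
have {IH} := IH k.+1 l' sl.
have {}Hl2 i : (i < size l)%N -> nth (0, 0)%N l i \in S (k.+1 + i)%N.
  by move=> il; rewrite addSnnS; apply: (Hl i.+1).
have {}Hl2' i : (i < size l')%N -> nth (0, 0)%N l' i \in S (k.+1 + i)%N.
  by move=> il; rewrite addSnnS; apply: (Hl' i.+1).
move=> /(_ Hl2 Hl2') IH.
have [_ Hk] := S_ok k.
have := Hl 0%N isT; have := Hl' 0%N isT; rewrite addn0 /=.
move=> /Hk/and4P[bD' q1' q2' _] /Hk/and4P[bD q1 q2 _] E.
have bl := blocks l Hl2; have bl' := blocks l' Hl2'.
have [| | | |-> /IH -> //] := block_map_disjoint _ _ _ _ bD bD' _ _ _ _ E.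
- exact: leq_trans q2 q1'.
- exact: leq_trans q2' q1.
- by rewrite compose_blocks_ge0 ?compose_blocks_le8.
- by rewrite compose_blocks_ge0 ?compose_blocks_le8.
Qed.

Lemma colq_paths n l : l \in paths _ S n ->
  (colq (prod_blocks l) <= 2 ^ (sgS n + n))%N /\
  (2 ^ sgS n <= 4 ^ n * colq (prod_blocks l))%N.
Proof.
rewrite /sgS; elim: n l => [|n IH] l; first by rewrite inE => /eqP -> /=; rewrite big_ord0.
move=> /allpairsP[[l' D] /= [l'S DS ->]].
have [_ H] := S_ok n; have /and4P[bD q1 q2 _] := H _ DS.
have /andP[h1 h2] := leq_colq _ _ (block_paths _ _ l'S) bD.
have [I1 I2] := IH _ l'S; rewrite big_ord_recr /=; split.
  apply: (leq_trans h2).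
  have -> (A : nat) : (2 ^ (A + sg n + n.+1) = 2 * (2 ^ (A + n) * 2 ^ sg n))%N.
    by rewrite -expnD -expnS; congr expn; lia.
  by rewrite leq_mul2l leq_mul.
rewrite expnD; apply: (leq_trans (leq_mul I2 q1)).
have -> (A B : nat) : (4 ^ n * A * (4 * B) = 4 ^ n.+1 * (A * B))%N by rewrite expnS; ring.
by rewrite leq_mul2l h1 orbT.
Qed.

Lemma count_paths_near n (c d : R) : 0 <= d ->
  (count (fun l => `|compose_blocks R l 0 - c| <= d) (paths _ S n))%:R
    <= 2 * d * (2 ^ (sgS n + n))%:R ^+ 2 + 1.
Proof.
move=> d0; set U : R := _ ^+ 2.
have U0 : 0 < U by rewrite exprn_gt0 // ltr0n expn_gt0.
(* [f] is the index of the cell of length 1 / U that contains the value of the path; denominators at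
   most the square root of U put different paths into different cells. *)
pose f l := Num.truncn ((compose_blocks R l 0 - (c - d)) * U).
pose near := [seq l <- paths _ S n | `|compose_blocks R l 0 - c| <= d].
have f0 l : l \in near -> 0 <= (compose_blocks R l 0 - (c - d)) * U <= 2 * d * U.
  rewrite mem_filter => /andP[+ _]; rewrite ler_norml => /andP[h1 h2].
  apply/andP; split; first by apply: mulr_ge0; [lra|exact: ltW].
  by rewrite ler_pM2r //; lra.
have f_inj : {in near &, injective f}.
  move=> l l' lN lN' /eqP E; have [lS lS'] : l \in paths _ S n /\ l' \in paths _ S n.
    by move: lN lN'; rewrite !mem_filter => /andP[_ ->] /andP[_ ->].
  apply: (compose_blocks_inj n) => //; apply/eqP; apply: contraTT E => ne.
  have far : 1 <= `|compose_blocks R l 0 - compose_blocks R l' 0| * U.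
    have [bl bl'] := (block_paths _ _ lS, block_paths _ _ lS').
    move: ne; rewrite -!compose_blocks_mobius // /mobius !mulr0 !add0r.
    have [u1 _] := colq_paths _ _ lS; have [u2 _] := colq_paths _ _ lS'.
    have [q1 _ _ _] := prod_blocksP _ bl; have [q2 _ _ _] := prod_blocksP _ bl'.
    move: u1 u2 q1 q2; move: (prod_blocks l) (prod_blocks l') => [p1' q1' p1 q1] [p2' q2' p2 q2] /=.
    move=> u1 u2 q1_gt0 q2_gt0 ne.
    have {}q1_gt0 : (0 < q1)%N by lia.
    have {}q2_gt0 : (0 < q2)%N by lia.
    have q1R : 0 < q1%:R :> R by rewrite ltr0n.
    have q2R : 0 < q2%:R :> R by rewrite ltr0n.
    have {}ne : p1%:Z * q2%:Z != p2%:Z * q1%:Z.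
      apply: contra ne => /eqP e; rewrite eqr_div ?lt0r_neq0 //; apply/eqP.
      by rewrite -!natrM; congr (_%:R); lia.
    have := @dist_fractions R p1 q1 p2 q2 q1_gt0 q2_gt0 ne; rewrite -!pmulrn => far.
    rewrite -(ler_pM2r U0) in far; apply: le_trans far.
    rewrite mulrC ler_pdivlMr ?mulr_gt0 // mul1r /U expr2.
    by apply: ler_pM => //; rewrite ler_nat.
  rewrite -(@gtr0_norm _ U) // -normrM in far.
  apply/eqP => ff; move: far; apply/negP; rewrite -ltNge.
  have /truncn_itv := proj1 (andP (f0 _ lN)).
  have /truncn_itv := proj1 (andP (f0 _ lN')).
  rewrite -/(f l) -/(f l') ff => /andP[t1 t2] /andP[t3 t4].
  rewrite -natr1 in t2 t4; rewrite ltr_norml; apply/andP; split; nra.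
have uf : uniq (map f near).
  by rewrite map_inj_in_uniq // filter_uniq // paths_uniq // => i; have [] := S_ok i.
have := @uniq_leq_size _ _ (iota 0 (Num.truncn (2 * d * U)).+1) uf.
rewrite size_map size_filter size_iota => H.
apply: (@le_trans _ _ ((Num.truncn (2 * d * U)).+1)%:R).
  rewrite ler_nat; apply: H => _ /mapP[l lN ->]; rewrite mem_iota add0n /= ltnS.
  by have /andP[h1 h2] := f0 _ lN; apply: le_truncn.
by rewrite -natr1 lerD2r; have /truncn_itv/andP[] : 0 <= 2 * d * U by rewrite !mulr_ge0 // ltW.
Qed.

End Separation.

(** * Binary prefixes and dyadic points *)

Section Prefixes.
Variable R : realType.

Lemma truncn_div (y : R) d : 0 <= y -> (0 < d)%N ->
  (Num.truncn y %/ d)%N = Num.truncn (y / d%:R).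
Proof.
move=> y0 d0; apply/esym/truncn_def; have /truncn_itv/andP[h1 h2] := y0.
have dR : 0 < d%:R :> R by rewrite ltr0n.
rewrite ler_pdivlMr // ltr_pdivrMr // -!natrM; apply/andP; split.
  by apply: le_trans h1; rewrite ler_nat leq_divM.
by apply: lt_le_trans h2 _; rewrite ler_nat ltn_ceil.
Qed.

Lemma binary_prefix_word_of (x : R) l : 0 <= x ->
  binary_prefix x l = word_of l (Num.truncn (2 ^+ l * x)).
Proof.
move=> x0; apply/eq_in_map => i; rewrite mem_iota add0n => /= il.
have y0 k : 0 <= 2 ^+ k * x by rewrite mulr_ge0 // exprn_ge0.
rewrite /binary_digit truncn_div ?expn_gt0 // natrX; congr (odd _).
have -> : 2 ^+ l * x / 2 ^+ (l - i.+1) = 2 ^+ i.+1 * x.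
  have -> : 2 ^+ l = 2 ^+ i.+1 * 2 ^+ (l - i.+1) :> R by rewrite -exprD subnKC.
  by rewrite [_ * _ * x]mulrAC mulfK // expf_neq0.
by rewrite truncn_floor y0.
Qed.

Lemma size_binary_prefix (x : R) l : size (binary_prefix x l) = l.
Proof. exact: size_mkseq. Qed.

(** A word of length l that writes v in binary has code 2 ^ l - 1 + v, so this is v / 2 ^ l, the
    left end of its dyadic interval. *)
Definition word_point (w : seq bool) : R :=
  ((word_code w).+1 - 2 ^ size w)%N%:R / 2 ^+ size w.

Lemma word_point_near (x : R) l : 0 <= x < 1 ->
  `|x - word_point (binary_prefix x l)| <= 2 ^- l.
Proof.
move=> /andP[x0 x1]; rewrite /word_point size_binary_prefix binary_prefix_word_of //.
have y0 : 0 <= 2 ^+ l * x by rewrite mulr_ge0 // exprn_ge0.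
have l0 : 0 < 2 ^+ l :> R by rewrite exprn_gt0.
have /truncn_itv/andP[h1 h2] := y0.
rewrite word_code_word_of; last first.
  by rewrite -(ltr_nat R) natrX (le_lt_trans h1) // gtr_pMr.
have -> : ((2 ^ l - 1 + Num.truncn (2 ^+ l * x)).+1 - 2 ^ l)%N = Num.truncn (2 ^+ l * x).
  by have := expn_gt0 2 l; lia.
have {}h2 : 2 ^+ l * x < (Num.truncn (2 ^+ l * x))%:R + 1 by rewrite natr1.
move: h1 h2; move: ((Num.truncn _)%:R) => v h1 h2.
have -> : x - v / 2 ^+ l = (2 ^+ l * x - v) / 2 ^+ l by field; rewrite gt_eqF.
rewrite normrM normfV (gtr0_norm l0) ler_pdivrMr // mulVf ?gt_eqF //.
rewrite ler_norml; apply/andP; split; lra.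
Qed.

End Prefixes.

(** * Mass distribution estimate *)

Section MassDistribution.
Variables (R : realType) (S : nat -> seq (nat * nat)) (sg tau h : nat -> nat).
Hypothesis S_ok : forall i, pool_ok (sg i) (tau i) (S i).
Hypothesis size_S : forall i, size (S i) = (2 ^ h i)%N.

Local Notation sgS n := (\sum_(i < n) sg i)%N.
Local Notation hS n := (\sum_(i < n) h i)%N.

(* Minus the binary logarithm of a bound on the distance of a point to its
   n-th convergent. *)
Definition precision n : R := 2 * (sgS n)%:R + (tau n)%:R - 4 * n%:R.

Lemma size_paths_exp n : size (paths _ S n) = (2 ^ hS n)%N.
Proof.
rewrite size_paths (eq_bigr (fun i : 'I_n => 2 ^ h i)%N) //.
by elim: n => [|n IH]; rewrite ?big_ord0 // !big_ord_recr /= IH expnD.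
Qed.

Lemma tail_precision (D : nat -> nat * nat) n l : (forall n, D n \in S n) -> l%:R <= precision n ->
  `|tail R D 0 - compose_blocks R (mkseq D n) 0| <= 2 ^- l.
Proof.
move=> DS ln.
have bD i : block (D i) by have [_ H] := S_ok i; have /and4P[] := H _ (DS i).
have mD : mkseq D n \in paths _ S n.
  elim: n {ln} => [|n IH]; first by rewrite mem_head.
  rewrite mkseqS; apply/allpairsP; exists (mkseq D n, D n); split => //=.
have /andP[_] := tail_convergent R _ bD n.
have bm : all block (mkseq D n) by exact: block_paths S_ok _ _ mD.
rewrite -(compose_blocks_mobius R (mkseq D n) 0) //.
rewrite /mobius !mulr0 !add0r.
have [_ H] := S_ok n; have /and4P[_ _ _ ht] := H _ (DS n).
have [_ hq] := colq_paths _ _ _ S_ok _ _ mD.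
have q0 := colq_gt0 _ bD n.
move=> near; apply: le_trans near _.
move: hq q0; move: (colq _) => q hq q0.
have q0R : 0 < q%:R :> R by rewrite ltr0n.
have t2 : (D n).1%:R / (D n).2%:R <= 2 ^- tau n :> R.
  have D20 : 0 < (D n).2%:R :> R by rewrite ltr0n; have /and3P[? ? _] := bD n; lia.
  rewrite ler_pdivrMr //.
  by rewrite mulrC ler_pdivlMr ?exprn_gt0 // -natrX -natrM ler_nat.
(* The loss of 4 n bits in [precision] comes from q >= 2 ^ sgS / 4 ^ n. *)
have q2 : (q%:R ^+ 2)^-1 <= 2 ^+ (4 * n) / 2 ^+ (2 * sgS n) :> R.
  rewrite ler_pdivlMr ?exprn_gt0 // mulrC ler_pdivrMr ?exprn_gt0 //.
  have : ((2 ^ sgS n) ^ 2 <= (4 ^ n * q) ^ 2)%N by rewrite leq_exp2r.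
  rewrite expnMn -!expnM -!natrX -natrM ler_nat mulnC.
  by have -> : (4 ^ (n * 2) = 2 ^ (4 * n))%N by rewrite -(expnM 2 2); congr expn; lia.
apply: le_trans (ler_pM _ _ t2 q2) _.
- by rewrite divr_ge0 ?ler0n.
- by rewrite invr_ge0 exprn_ge0 // ltW.
have ln' : (l + 4 * n <= 2 * sgS n + tau n)%N.
  by rewrite -(ler_nat R) (natrD _ l) (natrD _ _ (tau n)) !natrM; move: ln; rewrite /precision; lra.
rewrite mulrA ler_pdivrMr ?exprn_gt0 // mulrC ler_pdivrMr ?exprn_gt0 //.
rewrite -mulrA [leRHS]mulrC ler_pdivlMr ?exprn_gt0 // -!exprD.
by apply: ler_weXn2l; [lra|lia].
Qed.

(** The quotient is the bound of [count_paths_near] for radius 2 / 2 ^ l, divided by the number of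
    paths. At the least suitable level n, the first hypothesis bounds the summand 1; the second one,
    taken at n - 1 where the precision is below l, bounds the separation term. *)
Lemma mass_bound (s : R) : 0 <= s <= 1 ->
  (exists n1, forall n, (n1 <= n)%N -> s * precision n <= (hS n)%:R) ->
  (exists n1, forall n, (n1 <= n)%N ->
    2 * (sgS n.+1)%:R + 2 * n.+1%:R <= (hS n.+1)%:R + (1 - s) * precision n) ->
  (forall n1 (l : nat), exists2 n, (n1 <= n)%N & l%:R <= precision n) ->
  exists2 K : R, 0 < K & forall l : nat, exists2 n, l%:R <= precision n &
    (2 * (2 / 2 ^+ l) * (2 ^ (sgS n + n))%:R ^+ 2 + 1) / (2 ^ hS n)%:R
      <= K * 2 `^ (- (l%:R * s)).
Proof.
move=> /andP[s0 s1] [n1 H1] [n2 H2] unb; set N := maxn n1 n2.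
set U : nat -> R := fun n => (2 ^ (sgS n + n))%:R ^+ 2.
have U0 n : 0 < U n by rewrite exprn_gt0 // ltr0n expn_gt0.
(* Words served by the starting level [N] have no earlier level to compare with, but there l <=
   precision N, so a constant suffices. *)
pose K1 := (4 * U N + 1) * 2 `^ (precision N * s).
have K10 : 0 < K1 by rewrite mulr_gt0 ?powR_gt0 // addr_gt0 // mulr_gt0.
exists (K1 + 5) => [|l]; first by rewrite addr_gt0.
have ex : exists n, (N <= n)%N && (l%:R <= precision n).
  by have [n] := unb N l; exists n; apply/andP.
have [n /andP[Nn ln] nmin] := ex_minnP ex; exists n => //.
have pw0 : 0 < 2 `^ (- (l%:R * s)) :> R by rewrite powR_gt0.
have l0 : 0 < 2 ^+ l :> R by rewrite exprn_gt0.
have h0 m : 0 < (2 ^ hS m)%:R :> R by rewrite ltr0n expn_gt0.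
rewrite -/(U n); case: (eqVneq n N) => [nN|nN].
  subst n; apply: (@le_trans _ _ (4 * U N + 1)).
    rewrite ler_pdivrMr //; apply: (@le_trans _ _ (4 * U N + 1)).
      rewrite lerD2r ler_pM2r // mulrA ler_pdivrMr // -natrM ler_peMr //.
      by rewrite exprn_ege1 // ler1n.
    rewrite ler_peMr ?ler1n ?expn_gt0 //.
    by rewrite ltW // addr_gt0 // mulr_gt0.
  apply: (@le_trans _ _ (K1 * 2 `^ (- (l%:R * s)))); last first.
    by rewrite ler_pM2r // lerDl.
  rewrite /K1 -mulrA ler_peMr //; first by rewrite ltW // addr_gt0 // mulr_gt0.
  rewrite -powRD ?pnatr_eq0 ?implybT // -[leLHS](powRr0 2); apply: ler_powR; first by lra.
  by rewrite -mulrBl mulr_ge0 // subr_ge0.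
have [m nE] : exists m, n = m.+1 by exists n.-1; rewrite prednK //; lia.
have Nm : (N <= m)%N by lia.
have lm : precision m < l%:R.
  by rewrite ltNge; apply/negP => hh; have := nmin m; rewrite Nm hh => /(_ isT); lia.
apply: (@le_trans _ _ (5 * 2 `^ (- (l%:R * s)))); last by rewrite ler_pM2r // lerDr ltW.
have E1 : 2 * (2 / 2 ^+ l) * U n / (2 ^ hS n)%:R <= 4 * 2 `^ (- (l%:R * s)).
  have -> : 2 * (2 / 2 ^+ l) * U n / (2 ^ hS n)%:R =
      4 * 2 `^ (- l%:R + 2 * (sgS n)%:R + 2 * n%:R - (hS n)%:R).
    have p2 (x y : R) : 2 `^ (x + y) = 2 `^ x * 2 `^ y by rewrite powRD // pnatr_eq0 implybT.
    rewrite !p2 !powRN -!natrM !powR_mulrn // /U !natrX.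
    by rewrite !(mulnC 2) !exprM exprD exprMn; ring.
  rewrite ler_pM2l //; apply: ler_powR; first by lra.
  have := H2 m ltac:(lia); rewrite -nE.
  have : (1 - s) * precision m <= (1 - s) * l%:R by rewrite ler_wpM2l ?subr_ge0 // ltW.
  by rewrite mulrBl mul1r [s * _]mulrC; lra.
have E2 : 1 / (2 ^ hS n)%:R <= 2 `^ (- (l%:R * s)).
  rewrite div1r natrX -powR_mulrn // -powRN; apply: ler_powR; first by lra.
  rewrite lerN2 mulrC; apply: le_trans (H1 n ltac:(lia)).
  by rewrite ler_wpM2l.
by rewrite mulrDl; lra.
Qed.

End MassDistribution.

(** * A path outside all null covers *)

Section LowerBound.
Variables (R : realType) (S : nat -> seq (nat * nat)) (sg tau h : nat -> nat).
Hypothesis S_ok : forall i, pool_ok (sg i) (tau i) (S i).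
Hypothesis size_S : forall i, size (S i) = (2 ^ h i)%N.

Local Notation sgS n := (\sum_(i < n) sg i)%N.
Local Notation hS n := (\sum_(i < n) h i)%N.
Local Notation precision := (precision R sg tau).

Lemma esum_dyadic (B : nat -> \bar R) : (forall t, (0 <= B t <= (2 ^- t.+2)%:E)%E) ->
  (\esum_(t in [set: nat]) B t < 1)%E.
Proof.
move=> HB; apply: (@le_lt_trans _ _ (2^-1)%:E); last by rewrite lte_fin invf_lt1; lra.
apply: le_trans (_ : \esum_(t in [set: nat]) (2 ^- t.+2)%:E <= _)%E.
  by apply: le_esum => t _; have /andP[] := HB t.
apply: esum_le_seq => X uX _.
have XM : {subset X <= iota 0 (\max_(t <- X) t).+1}.
  by move=> t tX; rewrite mem_iota add0n ltnS /= (@leq_bigmax_seq _ _ xpredT id).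
apply: le_trans (ler_sum_subseq _ _ _ _ _ _ uX XM) _.
  by move=> t; rewrite invr_ge0 exprn_ge0.
move: (_.+1) => M; suff -> : \sum_(t <- iota 0 M) 2 ^- t.+2 = (1 - 2 ^- M) / 2 :> R.
  by rewrite ler_pdivrMr // mulVf // gerBl invr_ge0 exprn_ge0.
elim: M => [|M IH]; first by rewrite big_nil expr0 invr1 subrr mul0r.
rewrite -addn1 iotaD big_cat IH big_seq1 /= add0n addn1 !exprS !invfM.
by move: (2 ^- M) => z; field.
Qed.

Lemma sum_le_esum (T : choiceType) (C : set T) (f : T -> R) X : uniq X ->
  (forall x, x \in X -> C x) -> ((\sum_(x <- X) f x)%:E <= \esum_(x in C) (f x)%:E)%E.
Proof.
move=> uX XC; apply: esum_ge; exists [set` X]; first by split.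
by rewrite -fsbig_seq // sumEFin.
Qed.

(** An event is a word in a cover; its first index t codes an enumerable set and an exponent [st j].
    The exponents increase to b, and countably many suffice because raising the exponent only lowers
    the weight of a cover. *)
Lemma exists_path_dim_ge (b : R) : b <= 1 ->
  (forall s, 0 <= s < b ->
    exists n1, forall n, (n1 <= n)%N -> s * precision n <= (hS n)%:R) ->
  (forall s, 0 <= s < b -> exists n1, forall n, (n1 <= n)%N ->
    2 * (sgS n.+1)%:R + 2 * n.+1%:R <= (hS n.+1)%:R + (1 - s) * precision n) ->
  (forall n1 (l : nat), exists2 n, (n1 <= n)%N & l%:R <= precision n) ->
  exists D : nat -> nat * nat, (forall n, D n \in S n) /\
    forall s, 0 <= s -> effective_hausdorff_null s [set tail R D 0] -> b <= s.
Proof.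
move=> b1 L1 L2 unb.
have S_gt0 n : (0 < size (S n))%N by rewrite size_S expn_gt0.
have [b0|b0] := leP b 0.
  have [|D [DS _]] := @path_avoiding R _ S S_gt0 nat set0 id (fun _ _ => true).
    by rewrite esum_set0 lte_fin.
  by exists D; split=> // s s0 _; apply: le_trans s0.
pose st (j : nat) : R := b * (1 - j.+1%:R^-1).
have st_bounds j : 0 <= st j < b.
  rewrite /st mulr_ge0 ?subr_ge0 ?invf_le1 ?ler1n ?ltW //=.
  by rewrite gtr_pMr // gtrBl invr_gt0.
have [E HE] := ce_countable.
pose idx (t : nat) : nat * nat := odflt (0, 0)%N (choice.unpickle t).
have /choice[K HK] : forall t, exists K : R, 0 < K /\ forall l : nat,
    exists n, l%:R <= precision n /\
      (2 * (2 / 2 ^+ l) * (2 ^ (sgS n + n))%:R ^+ 2 + 1) / (2 ^ hS n)%:R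
        <= K * 2 `^ (- (l%:R * st (idx t).2)).
  move=> t; have sb := st_bounds (idx t).2.
  have s01 : 0 <= st (idx t).2 <= 1 by have /andP[-> sb'] := sb; rewrite (le_trans (ltW sb')).
  have [K K0 HK] := mass_bound R sg tau h _ s01 (L1 _ sb) (L2 _ sb) unb.
  by exists K; split=> // l; have [n] := HK l; exists n.
(* The cover is taken so far out in the null sequence that its weight, even after the constant
   [K t], is at most 2 ^ - (t + 2); the sum over t then stays below 1. *)
have /choice[m Hm] : forall t, exists m : nat, K t * 2 ^- m <= 2 ^- t.+2.
  move=> t; have [K0 _] := HK t; exists (t.+2 + (Num.truncn (K t)).+1)%N.
  rewrite exprD invfM mulrCA ger_pMr ?invr_gt0 ?exprn_gt0 //.
  rewrite ler_pdivrMr ?exprn_gt0 // mul1r.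
  have /truncn_itv/andP[_ h1] := ltW K0.
  by apply: (le_trans (ltW h1)); rewrite -natrX ler_nat ltnW // ltn_expl.
have /choice[lv Hlv] : forall z : nat * nat, exists n, z.2%:R <= precision n /\
   (2 * (2 / 2 ^+ z.2) * (2 ^ (sgS n + n))%:R ^+ 2 + 1) / (2 ^ hS n)%:R
        <= K z.1 * 2 `^ (- (z.2%:R * st (idx z.1).2)).
  by move=> [t l]; have [_] := HK t; apply.
pose wt (t : nat) (w : seq bool) : R := 2 `^ (- (size w)%:R * st (idx t).2).
(* An arbitrary enumerable set need not be a null sequence: a section that is too heavy is replaced
   by the empty set. *)
pose J (t : nat) : set (seq bool) := [set w | E (idx t).1 (m t, w) /\
  (\esum_(w in [set w | E (idx t).1 (m t, w)]) (wt t w)%:E < (2 ^- m t)%:E)%E].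
pose W : set (nat * seq bool) := [set: nat] `*`` J.
pose lev (z : nat * seq bool) := lv (z.1, size z.2).
(* One 2 ^ - l is for the distance from x to the dyadic point, the other for that from x to the
   convergent. *)
pose bad (z : nat * seq bool) : pred (seq (nat * nat)) := fun l =>
  `|compose_blocks R l 0 - word_point R z.2| <= 2 / 2 ^+ size z.2.
have [|D [DS Dbad]] := path_avoiding R _ S S_gt0 _ W lev bad.
  rewrite -(@esum_esum _ _ _ setT J (fun t w =>
    ((count (bad (t, w)) (paths _ S (lev (t, w))))%:R /
      (size (paths _ S (lev (t, w))))%:R)%:E)); last by move=> t w; rewrite lee_fin.
  apply: esum_dyadic => t; rewrite esum_ge0 /=; last by move=> w _; rewrite lee_fin.
  apply: esum_le_seq => X uX XJ; case: X uX XJ => [|w0 X] uX XJ.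
    by rewrite big_nil invr_ge0 exprn_ge0.
  have [K0 _] := HK t.
  apply: le_trans (Hm t); apply: (@le_trans _ _ (K t * \sum_(w <- w0 :: X) wt t w)).
    rewrite mulr_sumr; apply: ler_sum => w _.
    rewrite /lev /= (size_paths_exp _ _ size_S); have [_] := Hlv (t, size w); rewrite /= -mulNr.
    apply: le_trans; rewrite ler_pM2r ?invr_gt0 ?ltr0n ?expn_gt0 //.
    apply: (count_paths_near R S sg tau S_ok).
    by rewrite divr_ge0 // exprn_ge0.
  rewrite ler_pM2l // ltW // -lte_fin.
  have [_ Jsum] := XJ w0 (mem_head _ _); apply: le_lt_trans Jsum.
  by apply: sum_le_esum => // w /XJ[].
exists D; split => // s s0 [C Cce Cnull]; rewrite leNgt; apply/negP => sb.
have [i CE] := HE C Cce.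
have [j sj] : exists j, s <= st j.
  exists (Num.truncn ((1 - s / b)^-1)); rewrite /st.
  have e0 : 0 < 1 - s / b by rewrite subr_gt0 ltr_pdivrMr // mul1r.
  have /truncn_itv/andP[_ h1] : 0 <= (1 - s / b)^-1 by rewrite invr_ge0 ltW.
  rewrite mulrC -ler_pdivrMr // lerBrDl -lerBrDr -[leRHS]invrK lef_pV2 ?posrE ?invr_gt0 //.
  exact: ltW.
pose t := choice.pickle (i, j).
have it : idx t = (i, j) by rewrite /idx choice.pickleK.
have [Ccov Csum] := Cnull (m t).
have [l Cl] := Ccov (tail R D 0) erefl.
have Jw : J t (binary_prefix (tail R D 0) l).
  rewrite /J /= it -CE; split => //; apply: le_lt_trans Csum.
  apply: le_esum => w _; rewrite lee_fin /wt it; apply: ler_powR; first by lra.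
  by rewrite !mulNr lerN2 ler_wpM2l.
have := Dbad (t, binary_prefix (tail R D 0) l) (conj I Jw).
rewrite /bad /lev /= size_binary_prefix; set n := lv _ => /negP; apply.
have [hn _] := Hlv (t, l); rewrite -/n /= in hn.
have bD k : block (D k) by have [_ H] := S_ok k; have /and4P[] := H _ (DS k).
have near1 := tail_precision R S sg tau S_ok D n l DS hn.
have /andP[x0 x1] := tail_lt1 R D bD.
have near2 : `|tail R D 0 - word_point R (binary_prefix (tail R D 0) l)| <= 2 ^- l.
  by apply: word_point_near; rewrite ltW.
apply: le_trans (ler_distD (tail R D 0) _ _) _.
by rewrite (distrC (compose_blocks _ _ _)) mulr_natl mulr2n lerD.
Qed.

End LowerBound.

(** * Upper bound on the dimension *)

Section UpperBound.
Variables (R : realType) (S : nat -> seq (nat * nat)) (sg tau : nat -> nat).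
Hypothesis S_ok : forall i, pool_ok (sg i) (tau i) (S i).
Variable D : nat -> nat * nat.
Hypothesis DS : forall n, D n \in S n.

Local Notation sgS n := (\sum_(i < n) sg i)%N.
Local Notation x := (tail R D 0).

(** The columns at n0 have entries at most 2 ^ (kap j) and, together with c and r, determine the
    convergent at n0 + r, which is precise to lam j bits. Hence the prefix of x of length lam j is
    in the cover. *)
Lemma null_of_digit_runs (s : R) (kap lam : nat) :
  (2 * kap + 3)%N%:R <= s * lam%:R ->
  (forall N, exists j n0 r c, [/\ (N <= j)%N,
     forall i, (i < r)%N -> D (n0 + i)%N = (1%N, (2 ^ c)%N),
     (sgS n0 + n0 <= kap * j)%N,
     (c <= kap * j)%N /\ (r <= kap * j * (kap * j))%N &
     (lam * j)%N%:R <= precision R sg tau (n0 + r)]) ->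
  effective_hausdorff_null s [set x].
Proof.
move=> sl runs; have [j1 Hj1] := cover_sum R s kap lam sl.
exists (ce_cover kap lam j1); first exact: ce_cover_enumerable.
move=> n; split; last exact: Hj1.
have bD i : block (D i) by have [_ H] := S_ok i; have /and4P[] := H _ (DS i).
have /andP[x0 x1] := tail_lt1 R D bD.
move=> _ ->; have [j [n0 [r [c [jn Dc q0j [cj rj] prec]]]]] := runs (n + j1)%N.
set l := (lam * j)%N in prec; exists l.
have near := tail_precision R S sg tau S_ok D _ _ DS prec.
have mD k : mkseq D k \in paths _ S k.
  elim: k => [|k IH]; first by rewrite mem_head.
  by rewrite mkseqS; apply/allpairsP; exists (mkseq D k, D k); split => //=.
have am k : all block (mkseq D k) by exact: block_paths S_ok _ _ (mD k).
have mE : mkseq D (n0 + r) = mkseq D n0 ++ nseq r (1%N, (2 ^ c)%N).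
  rewrite /mkseq iotaD map_cat add0n; congr (_ ++ _).
  apply: (@eq_from_nth _ (0, 0)%N); rewrite ?size_nseq ?size_map ?size_iota // => i ir.
  by rewrite (nth_map 0%N) ?size_iota // nth_iota // nth_nseq ir Dc.
have [h1 h2 _ det] := prod_blocksP _ (am n0).
have [pE qE] := prod_blocks_digits (mkseq D n0) (2 ^ c)%N r.
have [colq_le _] := colq_paths _ _ _ S_ok _ _ (mD n0).
have Nq := colq_gt0 D bD (n0 + r).
rewrite -compose_blocks_mobius // /mobius !mulr0 !add0r in near.
move: near Nq; rewrite mE pE qE; move: h1 h2 det colq_le {pE qE}.
case: (prod_blocks (mkseq D n0)) => P' Q' P Q /= h1 h2 det colq_le near Nq.
set p := (P' * _ + P * _)%N in near; set q := (Q' * _ + Q * _)%N in near Nq.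
have l0 : 0 < 2 ^+ l :> R by rewrite exprn_gt0.
have y0 : 0 <= 2 ^+ l * x by rewrite mulr_ge0 // ltW.
have /truncn_itv/andP[v1 v2] := y0.
exists (j - (n + j1))%N, P', P, Q', Q, c, r, (Num.truncn (2 ^+ l * x)) => /=.
have -> : (n + (j - (n + j1)) + j1 = j)%N by lia.
split; last by rewrite binary_prefix_word_of // ltW.
have Qj : (2 ^ (sgS n0 + n0) <= 2 ^ (kap * j))%N by rewrite leq_exp2l.
have Q2 := leq_trans colq_le Qj.
apply/and4P; split => //.
- by rewrite Q2 h1 (leq_trans h2 Q2).
- rewrite cj rj /=; rewrite -(ltr_nat R) natrX; apply: le_lt_trans v1 _.
  by rewrite gtr_pMr.
have qR : 0 < q%:R :> R by rewrite ltr0n.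
(* After scaling, the convergent causes an error of one unit and the truncation of 2 ^ l x another;
   this is the slack 2 in [cover_rel]. *)
have near2 : `|2 ^+ l * x * q%:R - 2 ^+ l * p%:R| <= q%:R.
  have -> : 2 ^+ l * x * q%:R - 2 ^+ l * p%:R = (x - p%:R / q%:R) * (2 ^+ l * q%:R).
    by field; rewrite gt_eqF.
  rewrite normrM (@gtr0_norm _ (_ * _)) ?mulr_gt0 // mulrA ler_piMl ?(ltW qR) //.
  by rewrite -ler_pdivlMr // div1r.
move: near2; rewrite ler_norml => /andP[n1 n2].
rewrite -/p -/q -/l; clearbody p q l.
rewrite -!(ler_nat R) !natrD !natrM natrX.
have {}v2 : 2 ^+ l * x < (Num.truncn (2 ^+ l * x))%:R + 1 by rewrite natr1.
move: v1 v2; set v := (Num.truncn _)%:R => v1 v2.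
have v1q : v * q%:R <= 2 ^+ l * x * q%:R by rewrite ler_pM2r.
have v2q : 2 ^+ l * x * q%:R <= (v + 1) * q%:R by rewrite ler_pM2r // ltW.
by rewrite mulrDl mul1r in v2q; apply/andP; split; lra.
Qed.

End UpperBound.

(** * The sequence of levels *)

Inductive level := Free of nat | Digit of nat | Gap of nat.

(** [scale], [depth] and [choices] are binary logarithms: of a bound on the denominators, of a lower
    bound on Q / P, and of the size of the pool. *)
Definition scale (v : level) : nat := match v with Free w | Digit w | Gap w => w end.
Definition depth (v : level) : nat := if v is Gap w then w.-1 else 0.
(** 2 w - 8 = 2 (w - 3) - 2 is the logarithm of the bound of [leq_size_free_pool] at K = 2 ^ (w -
    3); the pool is cut down to exactly this size. *)
Definition choices (v : level) : nat :=
  match v with Free w => 2 * w - 8 | Digit _ => 0 | Gap w => w.-1 end%N.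
Definition pool (v : level) : seq (nat * nat) :=
  match v with
  | Free w => take (2 ^ (2 * w - 8))%N (free_pool (2 ^ w)%N)
  | Digit w => [:: (1, 2 ^ w)%N]
  | Gap w => [seq (1, A)%N | A <- iota (2 ^ w.-1)%N (2 ^ w.-1)%N]
  end.

Lemma pool_okP v : (4 <= scale v)%N -> pool_ok (scale v) (depth v) (pool v).
Proof.
case: v => w /= w4.
- split; first by rewrite take_uniq // free_pool_uniq.
  move=> D /mem_take; rewrite mem_free_pool => /and5P[P0 PQ QN NQ c].
  by rewrite /block P0 PQ c QN NQ expn0 muln1 /=; lia.
- split=> // D; rewrite inE => /eqP -> /=.
  have : (2 ^ 4 <= 2 ^ w)%N by rewrite leq_exp2l.
  by rewrite /block /= coprime1n expn0 muln1 leqnn; lia.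
split; first by rewrite map_inj_uniq ?iota_uniq // => x y [].
move=> D /mapP[A]; rewrite mem_iota => /andP[A1 A2] -> /=.
have e : (2 ^ w = 2 * 2 ^ w.-1)%N by rewrite -expnS prednK //; lia.
have : (2 ^ 3 <= 2 ^ w.-1)%N by rewrite leq_exp2l //; lia.
by rewrite /block /= coprime1n mul1n A1 e; lia.
Qed.

Lemma size_pool v : (4 <= scale v)%N -> size (pool v) = (2 ^ choices v)%N.
Proof.
case: v => w /= w4 //; last by rewrite size_map size_iota.
rewrite size_takel // -(@leq_pmul2l 4) //.
have e : (2 ^ w = 8 * 2 ^ (w - 3))%N by rewrite -(expnD 2 3); congr expn; lia.
rewrite e; apply: leq_trans (leq_size_free_pool _ _); last by rewrite -(expn0 2) ltn_exp2l //; lia.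
by rewrite -expnM -(expnD 2 2) leq_exp2l //; lia.
Qed.

(** * Parameters and invariants of one stage *)

Section Stages.
Variables (R : realType) (a b : R).
Hypothesis a2 : 2 <= a.
Hypothesis b0 : 0 <= b.
Hypothesis ab2 : a * b <= 2.

Definition scale_sum (l : seq level) : nat := sumn (map scale l).
Definition choices_sum (l : seq level) : nat := sumn (map choices l).

(** A free level loses 8 of its 2 w bits, a proportion 4 / w = 1 / (4 (k + 2)) that tends to 0.
    Growing w also makes the number of levels negligible against their total scale. *)
Definition stage_scale (k : nat) : nat := (16 * k.+2)%N.
(** A multiple by 4 (k + 2) of the scale and length of the whole past, which thereby becomes
    negligible. *)
Definition stage_free (k : nat) (l : seq level) : nat :=
  (4 * k.+2 * (scale_sum l + size l + 1))%N.
Definition stage_mid k l : nat := (scale_sum l + stage_free k l * stage_scale k)%N.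
(* Tends to 2 / (a b), which is infinite when b = 0. *)
Definition stage_ratio k : R := if a * b * k.+1%:R <= 2 then k.+1%:R else 2 / (a * b).
Definition stage_digits k l : nat :=
  Num.truncn ((stage_ratio k - 1) * (stage_mid k l)%:R / (stage_scale k)%:R).
Definition stage_end k l : nat := (stage_mid k l + stage_digits k l * stage_scale k)%N.
(** The summand [stage_scale k], negligible against m', keeps the scale at least 4 even for a = 2
    and lets g - 1 reach (a - 2) m' despite the rounding. *)
Definition stage_gap k l : nat :=
  (stage_scale k + Num.truncn ((a - 2) * (stage_end k l)%:R))%N.
Definition stage k l : seq level :=
  nseq (stage_free k l) (Free (stage_scale k)) ++
  nseq (stage_digits k l) (Digit (stage_scale k)) ++ [:: Gap (stage_gap k l)].

Fixpoint history k : seq level :=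
  if k is k'.+1 then history k' ++ stage k' (history k') else [::].

Lemma stage_ratioP k : [/\ 1 <= stage_ratio k, stage_ratio k <= k.+1%:R & a * b * stage_ratio k <= 2].
Proof.
rewrite /stage_ratio; case: (leP (a * b * k.+1%:R) 2) => h; first by split; rewrite ?ler1n.
have ab0 : 0 < a * b.
  rewrite lt_neqAle mulr_ge0 ?andbT ?(le_trans _ a2) //.
  by apply: contraTneq h => <-; rewrite mul0r -leNgt.
split; first by rewrite ler_pdivlMr // mul1r.
  by rewrite ler_pdivrMr // mulrC ltW.
by rewrite mulrCA mulfV ?mulr1 // gt_eqF.
Qed.

Section Stage.
Variables (k : nat) (l : seq level).
Local Notation K := (k.+1%:R : R).
Local Notation S0 := (scale_sum l).
Local Notation n0 := (size l).
Local Notation H0 := (choices_sum l).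
Local Notation w := (stage_scale k).
Local Notation f := (stage_free k l).
Local Notation m := (stage_mid k l).
Local Notation r := (stage_digits k l).
Local Notation m' := (stage_end k l).
Local Notation g := (stage_gap k l).

Lemma stage_digits_bounds :
  (r%:R * w%:R <= (stage_ratio k - 1) * m%:R :> R) /\
  ((stage_ratio k - 1) * m%:R < r%:R * w%:R + w%:R :> R).
Proof.
have [r1 _ _] := stage_ratioP k.
have w0 : 0 < w%:R :> R by rewrite ltr0n.
have : 0 <= (stage_ratio k - 1) * m%:R / w%:R :> R.
  by rewrite divr_ge0 ?mulr_ge0 ?subr_ge0 // ler0n.
move=> /truncn_itv/andP[]; rewrite -/r.
rewrite ler_pdivlMr // ltr_pdivrMr // => h1 h2; split => //.
by apply: lt_le_trans h2 _; rewrite -natr1 mulrDl mul1r.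
Qed.

Lemma stage_gap_bounds :
  (w%:R + (a - 2) * m'%:R - 1 < g%:R :> R) /\ (g%:R <= w%:R + (a - 2) * m'%:R :> R).
Proof.
have : 0 <= (a - 2) * m'%:R :> R by rewrite mulr_ge0 ?subr_ge0 // ler0n.
move=> /truncn_itv/andP[h1 h2]; rewrite /stage_gap natrD.
have {}h2 : (a - 2) * m'%:R < (Num.truncn ((a - 2) * m'%:R))%:R + 1 by rewrite natr1.
by split; lra.
Qed.

Lemma stage_nth j : (j < size (stage k l))%N ->
  let v := nth (Digit 4) (stage k l) j in
  let t := scale_sum (take j (stage k l)) in
  let c := choices_sum (take j (stage k l)) in
  [\/ [/\ (j < f)%N, v = Free w, t = (j * w)%N & c = (j * (2 * w - 8))%N],
      exists2 i, (i < r)%N & [/\ j = (f + i)%N, v = Digit w,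
        t = (f * w + i * w)%N & c = (f * (2 * w - 8))%N] |
      [/\ j = (f + r)%N, v = Gap g, t = (f * w + r * w)%N & c = (f * (2 * w - 8))%N]].
Proof.
have sumE n x : scale_sum (nseq n x) = (n * scale x)%N.
  by rewrite /scale_sum map_nseq sumn_nseq mulnC.
have sumH n x : choices_sum (nseq n x) = (n * choices x)%N.
  by rewrite /choices_sum map_nseq sumn_nseq mulnC.
have sumD x y : scale_sum (x ++ y) = (scale_sum x + scale_sum y)%N.
  by rewrite /scale_sum map_cat sumn_cat.
have sumDH x y : choices_sum (x ++ y) = (choices_sum x + choices_sum y)%N.
  by rewrite /choices_sum map_cat sumn_cat.
rewrite /stage !size_cat !size_nseq /= => jlt.
rewrite nth_cat take_cat size_nseq; case: ltnP => jf.
  by constructor 1; rewrite take_nseq ?(ltnW jf) // nth_nseq jf sumE sumH.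
rewrite nth_cat take_cat size_nseq !sumD !sumDH !sumE !sumH.
case: ltnP => jr.
  constructor 2; exists (j - f)%N => //.
  by rewrite take_nseq ?(ltnW jr) // nth_nseq jr sumE sumH /= muln0 addn0 subnKC.
have e : (j - f - r = 0)%N by lia.
constructor 3; rewrite e take0 cats0 sumE sumH /= muln0 addn0; split => //; lia.
Qed.

Lemma stage_sums :
  [/\ scale_sum (stage k l) = (f * w + r * w + g)%N,
      choices_sum (stage k l) = (f * (2 * w - 8) + g.-1)%N &
      size (stage k l) = (f + r + 1)%N].
Proof.
rewrite /scale_sum /choices_sum /stage !map_cat !sumn_cat !map_nseq !sumn_nseq /=.
by rewrite !size_cat !size_nseq /= !addn0 mul0n add0n; split; ring.
Qed.

(** One parameter u = 1 / (4 (k + 2)) controls all relative errors: bits lost at free levels, the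
    past against the free levels, and w against m. The invariants tolerate a loss of 4 u = 1 / (k +
    2). *)
Lemma stage_small : exists u : R,
  [/\ 0 < u <= 8^-1, u * 4 = k.+2%:R^-1 /\ u * 4 <= K^-1, u * w%:R = 4 &
    S0%:R + 1 <= u * f%:R :> R /\ (w%:R : R) <= u * m%:R].
Proof.
set u : R := (4 * k.+2%:R)^-1; exists u.
have k0 : 0 < k.+2%:R :> R by rewrite ltr0n.
have ku : u * k.+2%:R = 4^-1 by rewrite /u; field; rewrite gt_eqF.
have k2 : 2 <= k.+2%:R :> R by rewrite ler_nat.
have u0 : 0 < u by rewrite invr_gt0 mulr_gt0.
have u4 : u * 4 = k.+2%:R^-1 by rewrite /u invfM mulrAC mulVf // mul1r.
have uf : S0%:R + 1 <= u * f%:R :> R.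
  rewrite /stage_free !natrM !natrD mulrA (mulrCA u) ku mulfV // mul1r.
  by rewrite lerD2r lerDl.
split.
- by rewrite u0 /u lef_pV2 ?posrE ?mulr_gt0 //; lra.
- by rewrite u4 lef_pV2 ?posrE ?ltr0n // ler_nat.
- by rewrite /stage_scale natrM mulrCA ku; field.
split=> //; rewrite /stage_mid natrD natrM mulrDr (mulrA u).
have : 1 <= u * f%:R :> R by apply: le_trans uf; rewrite lerDr.
rewrite -(ler_pM2r (_ : 0 < w%:R)) ?ltr0n // mul1r => h; apply: (le_trans h).
by rewrite lerDr mulr_ge0 // ltW.
Qed.

Hypothesis inv1 : (k.+1 * n0 <= S0)%N.
Hypothesis inv2 : (1 - K^-1) * b * (2 * S0%:R) <= H0%:R.

Let b1 : b <= 1.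
Proof.
have h : 2 * b <= a * b by rewrite ler_wpM2r.
by have := le_trans h ab2; rewrite ger_pMr.
Qed.

(** The stopping rule of the digit run: the 2 m bits chosen so far must pay for b times the
    precision a m' reached at the gap. *)
Let end_le : a * b * m'%:R <= 2 * m%:R :> R.
Proof.
have [h1 _] := stage_digits_bounds; have [_ _ r2] := stage_ratioP k.
have h3 : m'%:R <= stage_ratio k * m%:R :> R by rewrite /stage_end natrD natrM; lra.
apply: (@le_trans _ _ (a * b * (stage_ratio k * m%:R))).
  by rewrite ler_wpM2l // mulr_ge0 // (le_trans _ a2).
by rewrite mulrA ler_wpM2r.
Qed.

(* The free levels make up almost all of the scale accumulated so far. *)
Let choices_free u : 0 < u <= 8^-1 -> u * w%:R = 4 -> S0%:R + 1 <= u * f%:R ->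
  (forall j, (j * (2 * w - 8))%:R = 2 * (1 - u) * (j%:R * w%:R) :> R) /\
  (1 - 2 * u) * (a * b * m'%:R) <= (f * (2 * w - 8))%:R.
Proof.
move=> /andP[u0 u8] uw uf.
have E j : (j * (2 * w - 8))%:R = 2 * (1 - u) * (j%:R * w%:R) :> R.
  have w8 : (8 <= 2 * w)%N by rewrite /stage_scale; lia.
  rewrite natrM (natrB _ w8) natrM.
  have -> : 8%:R = 2 * (u * w%:R) :> R by rewrite uw; ring.
  by ring.
split=> //; rewrite E.
have w1 : 1 <= w%:R :> R by rewrite ler1n.
have mE : m%:R = S0%:R + f%:R * w%:R :> R by rewrite /stage_mid natrD natrM.
have f0 : 0 <= u * f%:R by rewrite mulr_ge0 // ltW.
have fw : S0%:R <= u * (f%:R * w%:R) :> R.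
  by rewrite mulrA; apply: le_trans (_ : u * f%:R <= _); [lra|rewrite ler_peMr].
have F0 : 0 <= f%:R * w%:R :> R by rewrite mulr_ge0.
have u2 : 0 <= 1 - 2 * u by lra.
apply: le_trans (ler_wpM2l u2 end_le) _.
rewrite mE; set F := f%:R * w%:R in fw F0 *.
have h1 : (1 - 2 * u) * (S0%:R + F) <= (1 - 2 * u) * ((1 + u) * F).
  by apply: ler_wpM2l => //; lra.
have h2 : 0 <= u * u * F by rewrite !mulr_ge0 // ltW.
lra.
Qed.

Let scale_bounds : [/\ (k.+1 <= w)%N, (32 <= w)%N, (n0 <= f)%N & (w <= g)%N].
Proof.
split; last exact: leq_addr.
- by rewrite /stage_scale; lia.
- by rewrite /stage_scale; lia.
by rewrite /stage_free; nia.
Qed.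

(** 2 t plus the depth is the precision up to the term 4 n. A free level chooses almost as many bits
    as it adds precision, and b <= 1. Along the run 2 t <= a m', at the gap 2 m' + g - 1 is close to
    a m', and a b m' <= 2 m covers both cases. *)
Lemma stage_facts j : (j < size (stage k l))%N ->
  let v := nth (Digit 4) (stage k l) j in
  let t := (S0 + scale_sum (take j (stage k l)))%N in
  let c := (H0 + choices_sum (take j (stage k l)))%N in
  [/\ (k.+1 * (n0 + j) <= t)%N,
      (1 - K^-1) * b * (2 * t%:R + (depth v)%:R) <= c%:R &
      (scale v = w /\ depth v = 0%N) \/
      [/\ j = (f + r)%N, v = Gap g, t = m' & (a - 2) * m'%:R <= (g.-1)%:R]].
Proof.
move=> jlt v t c; have [u [u8' [uK' uK] uw [uf wm]]] := stage_small.
have [chE Hc] := choices_free u u8' uw uf; have /andP[u0 u8] := u8'.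
have Kpos : 0 < K^-1 by rewrite invr_gt0 ltr0n.
have K1 : K^-1 <= 1 by rewrite invf_le1 ?ltr0n // ler1n.
move: (inv2) uK Kpos K1; set Ki := K^-1; clearbody Ki => iv2 uK Kpos K1.
have [kw w16 f_n0 wg] := scale_bounds.
have key1 x : (k.+1 * (n0 + x) <= S0 + x * w)%N.
  by rewrite mulnDr leq_add // mulnC leq_mul2l kw orbT.
have cD x : (H0 + x)%:R = H0%:R + x%:R :> R by rewrite natrD.
have [g1 g2] := stage_gap_bounds.
have gE : (g.-1)%:R = g%:R - 1 :> R by rewrite -subn1 natrB // (leq_trans _ wg) // (leq_trans _ w16).
have m'm : m%:R <= m'%:R :> R by rewrite ler_nat /stage_end leq_addr.
case: (stage_nth j jlt) => [[jf vE tE cE]|[i ir [jE vE tE cE]]|[jE vE tE cE]];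
  rewrite /t /c /v tE cE vE {v t c vE tE cE jlt}.
- split; [exact: key1| |by left].
  rewrite /= addr0 cD chE natrD natrM.
  have jw : 0 <= j%:R * w%:R :> R by rewrite mulr_ge0.
  have h1 : (1 - Ki) * b <= 1 - u.
    by apply: (@le_trans _ _ (1 - Ki)); [rewrite ler_piMr // subr_ge0|lra].
  have h2 := ler_wpM2r jw h1.
  move: iv2 h2; set J := j%:R * w%:R; set k1 := (1 - Ki) * b.
  lra.
- split; [by rewrite jE -mulnDl; exact: key1| |by left].
  rewrite /= addr0 cD.
  have tm' : (S0 + (f * w + i * w))%:R <= m'%:R :> R.
    by rewrite ler_nat /stage_end /stage_mid addnA leq_add2l leq_mul2r (ltnW ir) orbT.
  apply: le_trans (le_trans _ Hc) _; last by rewrite lerDr.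
  have -> : (1 - 2 * u) * (a * b * m'%:R) = (1 - 2 * u) * b * (a * m'%:R) by ring.
  apply: ler_pM; rewrite ?mulr_ge0 ?subr_ge0 //; last by apply: ler_pM.
  by rewrite ler_wpM2r //; lra.
split; [by rewrite jE -mulnDl; exact: key1| |right].
  rewrite /= cD gE; apply: le_trans (le_trans _ Hc) _; last by rewrite lerDr.
  have -> : (S0 + (f * w + r * w) = m')%N by rewrite /stage_end /stage_mid addnA.
  have -> : (1 - 2 * u) * (a * b * m'%:R) = (1 - 2 * u) * a * m'%:R * b by ring.
  rewrite mulrAC ler_wpM2r //.
  have wm' : w%:R <= u * m'%:R by apply: le_trans wm _; rewrite ler_pM2l.
  apply: (@le_trans _ _ ((1 - 4 * u) * ((a + u) * m'%:R))).
    apply: ler_pM; rewrite ?subr_ge0 //; [|by lra|].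
      by rewrite addr_ge0 ?mulr_ge0 // subr_ge0 ler1n (leq_trans _ wg) // (leq_trans _ w16).
    by rewrite mulrDl; move: g2; rewrite mulrBl => g2; lra.
  rewrite mulrA ler_wpM2r //.
  have ua : u * 2 <= u * a by rewrite ler_pM2l.
  have uu : 0 <= u * u by rewrite mulr_ge0 // ltW.
  lra.
split => //; first by rewrite /stage_end /stage_mid addnA.
rewrite gE; have : (32 : R) <= w%:R by rewrite ler_nat.
lra.
Qed.

Let scale_growth : [/\ (k.+2 * (n0 + f) <= f * w)%N, (k.+2 * r <= r * w)%N,
  (k.+2 <= g)%N & (k.+2 * stage_scale k.+1 <= f * w)%N].
Proof.
have [_ _ fn wg] := scale_bounds.
have f8 : (4 * k.+2 <= f)%N by rewrite /stage_free leq_pmulr // addn1.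
have kw : (k.+2 * 2 <= w)%N by rewrite /stage_scale; lia.
split.
- rewrite mulnC; apply: (@leq_trans (2 * f * k.+2)).
    by rewrite leq_mul2r; apply/orP; right; lia.
  by rewrite mulnAC mulnC leq_mul2l mulnC kw orbT.
- by rewrite mulnC leq_mul2l; apply/orP; right; lia.
- by apply: leq_trans wg; lia.
apply: (@leq_trans (4 * k.+2 * w)); last by rewrite leq_mul2r f8 orbT.
by rewrite -mulnA mulnCA leq_mul2l /stage_scale; apply/orP; right; lia.
Qed.

(** In 2 (m' + g) the scale g of the gap counts twice: one copy completes 2 m' to about a m', which
    the free levels pay for, and the choice of the large digit pays for the other. *)
Lemma stage_invariant : let l1 := l ++ stage k l in
  [/\ (k.+2 * size l1 <= scale_sum l1)%N,
      (1 - k.+2%:R^-1) * b * (2 * (scale_sum l1)%:R) <= (choices_sum l1)%:R &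
      (k.+2 * stage_scale k.+1 <= scale_sum l1)%N].
Proof.
have [tE cE szE] := stage_sums.
have [u [u8' [uK' uK] uw [uf wm]]] := stage_small.
have [_ Hc] := choices_free u u8' uw uf; have /andP[u0 u8] := u8'.
have [g1 g2] := stage_gap_bounds.
have [_ w16 _ wg] := scale_bounds; have [fw rw kg kf] := scale_growth.
have gE : (g.-1)%:R = g%:R - 1 :> R by rewrite -subn1 natrB // (leq_trans _ wg) // (leq_trans _ w16).
have m'm : m%:R <= m'%:R :> R by rewrite ler_nat /stage_end leq_addr.
have wm' : w%:R <= u * m'%:R by apply: le_trans wm _; rewrite ler_pM2l.
have sE : scale_sum (l ++ stage k l) = (m' + g)%N.
  transitivity (S0 + scale_sum (stage k l))%N; first by rewrite /scale_sum map_cat sumn_cat.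
  by rewrite tE /stage_end /stage_mid !addnA.
have hE : choices_sum (l ++ stage k l) = (H0 + (f * (2 * w - 8) + g.-1))%N.
  by rewrite -cE /choices_sum map_cat sumn_cat.
move=> l1; rewrite /l1 sE hE; split.
- rewrite size_cat szE /stage_end /stage_mid.
  have -> : (n0 + (f + r + 1) = (n0 + f) + (r + 1))%N by rewrite !addnA.
  rewrite !(mulnDr k.+2 (n0 + f)) (mulnDr _ r) muln1 -(addnA _ (r * w)) -(addnA S0).
  apply: leq_trans (leq_addl _ _); apply: leq_add => //; exact: leq_add.
- rewrite natrD (natrD _ H0) natrD gE -uK'.
  rewrite -[leLHS]add0r; apply: lerD => //.
  have h1 : (1 - u * 4) * b * (a * m'%:R + w%:R) <= (1 - 2 * u) * (a * b * m'%:R).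
    have -> : (1 - 2 * u) * (a * b * m'%:R) = (1 - 2 * u) * a * m'%:R * b by ring.
    rewrite mulrAC ler_wpM2r //.
    apply: (@le_trans _ _ ((1 - u * 4) * ((a + u) * m'%:R))).
      by rewrite ler_wpM2l ?mulrDl //; lra.
    rewrite mulrA ler_wpM2r //.
    have ua : u * 2 <= u * a by rewrite ler_pM2l.
    have uu : 0 <= u * u by rewrite mulr_ge0 // ltW.
    lra.
  have h2 : (1 - u * 4) * b * g%:R <= g%:R - 1.
    have ug : 4 <= u * g%:R by rewrite -uw ler_pM2l // ler_nat.
    apply: (@le_trans _ _ ((1 - u * 4) * g%:R)); last by lra.
    by rewrite ler_wpM2r // ler_piMr //; lra.
  have h3 : (1 - u * 4) * b * (2 * (m'%:R + g%:R)) <= (1 - u * 4) * b * (a * m'%:R + w%:R + g%:R).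
    rewrite ler_wpM2l ?mulr_ge0 //; first by lra.
    lra.
  apply: (le_trans h3); rewrite mulrDr; apply: lerD => //; exact: le_trans Hc.
apply: leq_trans kf _; rewrite /stage_end /stage_mid -!addnA.
by apply: leq_trans (leq_addr _ _) (leq_addl _ _).
Qed.

End Stage.
End Stages.

(** * Concatenation of the stages *)

Section LevelSequence.
Variables (R : realType) (a b : R).
Hypothesis a2 : 2 <= a.
Hypothesis b0 : 0 <= b.
Hypothesis ab2 : a * b <= 2.

Local Notation hist := (history R a b).
Local Notation start k := (size (hist k)).

(** By [leq_history] position i lies inside history i + 1, so the default is never reached; later
    histories extend this one. *)
Definition level_seq (i : nat) : level := nth (Digit 4) (hist i.+1) i.

Local Notation lev := level_seq.
Local Notation sgS n := (\sum_(i < n) scale (lev i))%N.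
Local Notation hS n := (\sum_(i < n) choices (lev i))%N.

Lemma size_history k : start k.+1 = (start k + size (stage R a b k (hist k)))%N.
Proof. by rewrite /= size_cat. Qed.

Lemma size_history_lt k : (start k < start k.+1)%N.
Proof.
rewrite size_history; have [_ _ ->] := stage_sums R a b k (hist k).
by rewrite -[ltnLHS]addn0 ltn_add2l addn1.
Qed.

Lemma leq_history k : (k <= start k)%N.
Proof. by elim: k => // k IH; apply: leq_ltn_trans IH (size_history_lt k). Qed.

Lemma history_homo : {homo (fun k => start k) : x y / (x <= y)%N}.
Proof. by apply: homo_leq => [//|y x z|k]; [exact: leq_trans|exact/ltnW/size_history_lt]. Qed.

Lemma history_prefix k k' : (k <= k')%N -> take (start k) (hist k') = hist k.
Proof.
elim: k' => [|k' IH]; first by rewrite leqn0 => /eqP ->.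
rewrite leq_eqVlt => /orP[/eqP ->|lt]; first by rewrite take_size.
by rewrite /= takel_cat ?IH //; exact: history_homo.
Qed.

Lemma levE k i : (i < start k)%N -> lev i = nth (Digit 4) (hist k) i.
Proof.
move=> ik; rewrite /lev; have i1 : (i < start i.+1)%N by exact: leq_history.
have [le|/ltnW le] := leqP k i.+1.
  by rewrite -(history_prefix _ _ le) nth_take.
by rewrite -(history_prefix _ _ le) nth_take.
Qed.

Lemma sum_lev (F : level -> nat) k n : (n <= start k)%N ->
  (\sum_(i < n) F (lev i))%N = sumn (map F (take n (hist k))).
Proof.
move=> nk; rewrite sumnE big_map (big_nth (Digit 4)) size_takel // big_mkord.
by apply: eq_bigr => i _; rewrite nth_take // (levE k) // (leq_trans _ nk).
Qed.

Lemma sum_lev_stage (F : level -> nat) k j : (j <= size (stage R a b k (hist k)))%N ->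
  (\sum_(i < start k + j) F (lev i))%N =
  (sumn (map F (hist k)) + sumn (map F (take j (stage R a b k (hist k)))))%N.
Proof.
move=> jk; rewrite (sum_lev _ k.+1) ?size_history ?leq_add2l //.
by rewrite /= take_cat ltnNge leq_addr /= addKn map_cat sumn_cat.
Qed.

Lemma lev_stage k j : (j < size (stage R a b k (hist k)))%N ->
  lev (start k + j) = nth (Digit 4) (stage R a b k (hist k)) j.
Proof.
move=> jk; rewrite (levE k.+1) ?size_history ?ltn_add2l //.
by rewrite /= nth_cat ltnNge leq_addr /= addKn.
Qed.

Lemma history_invariant k :
  [/\ (k.+1 * start k <= scale_sum (hist k))%N,
      (1 - k.+1%:R^-1) * b * (2 * (scale_sum (hist k))%:R) <= (choices_sum (hist k))%:R &
      (0 < k)%N -> (k.+1 * stage_scale k <= scale_sum (hist k))%N].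
Proof.
elim: k => [|k [h1 h2 h3]]; first by rewrite /= invr1 subrr !mul0r.
by have [e1 e2 e3] := stage_invariant _ _ _ a2 b0 ab2 _ _ h1 h2.
Qed.

Local Notation wk k := (stage_scale k).
Local Notation fk k := (stage_free k (hist k)).
Local Notation mk k := (stage_mid k (hist k)).
Local Notation rk k := (stage_digits R a b k (hist k)).
Local Notation m'k k := (stage_end R a b k (hist k)).
Local Notation gk k := (stage_gap R a b k (hist k)).

Lemma level_facts k n : (start k <= n < start k.+1)%N ->
  [/\ (k.+1 * n <= sgS n)%N,
      (1 - k.+1%:R^-1) * b * (2 * (sgS n)%:R + (depth (lev n))%:R) <= (hS n)%:R,
      (0 < k)%N -> (k.+1 * wk k <= sgS n)%N &
      (scale (lev n) = wk k /\ depth (lev n) = 0%N) \/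
      [/\ n = (start k + fk k + rk k)%N, lev n = Gap (gk k), sgS n = m'k k &
        (a - 2) * (m'k k)%:R <= ((gk k).-1)%:R]].
Proof.
move=> /andP[kn nk]; have [h1 h2 h3] := history_invariant k.
have jlt : (n - start k < size (stage R a b k (hist k)))%N.
  by rewrite ltn_subLR // -size_history.
have nE := subnKC kn.
move: jlt nE; set j := (n - start k)%N => jlt nE; rewrite -nE.
have [e1 e2 e3] := stage_facts _ _ _ a2 b0 ab2 _ _ h1 h2 j jlt.
rewrite !(sum_lev_stage _ _ _ (ltnW jlt)) (lev_stage _ _ jlt); split=> //.
  by move=> k0; apply: leq_trans (h3 k0) _; exact: leq_addr.
case: e3 => [|[jE vE tE gE]]; [by left|right].
by split => //; rewrite jE addnA.
Qed.

Lemma gap_facts k : let n := (start k + fk k + rk k)%N in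
  [/\ (start k <= n < start k.+1)%N, lev n = Gap (gk k), sgS n = m'k k &
      sgS (start k + fk k)%N = mk k] /\
  forall i, (i < rk k)%N -> lev (start k + fk k + i)%N = Digit (wk k).
Proof.
have [_ _ szE] := stage_sums R a b k (hist k).
have range i : (i <= rk k)%N -> (fk k + i < size (stage R a b k (hist k)))%N.
  by move=> ir; rewrite szE addn1 ltnS leq_add2l.
have noA i : ~ (fk k + i < fk k)%N by rewrite ltnNge leq_addr.
have noB i : (i < rk k)%N -> (fk k + rk k)%N <> (fk k + i)%N.
  by move=> ir /addnI e; rewrite e ltnn in ir.
move=> n; split; last first.
  move=> i ir; rewrite -addnA lev_stage; last exact/range/ltnW.
  have [[/noA//]|[i' _ [_ //]]|[/addnI e]] := stage_nth _ _ _ a2 b0 ab2 k (hist k) _ (range _ (ltnW ir)).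
  by rewrite e ltnn in ir.
have [[/noA//]|[i' i'r [/noB //]]|[_ vE tE _]] := stage_nth _ _ _ a2 b0 ab2 k (hist k) _ (range _ (leqnn _)).
split.
- rewrite /n size_history -(addnA (start k)) leq_addr ltn_add2l; exact: range.
- by rewrite /n -addnA lev_stage // range.
- by rewrite /n -addnA sum_lev_stage ?(ltnW (range _ _)) // -!/(scale_sum _) tE /stage_end /stage_mid addnA.
have r0 := range 0%N (leq0n _); rewrite addn0 in r0.
rewrite (sum_lev_stage _ _ _ (ltnW r0)).
have [[]|[i' i'r [jE _ tE' _]]|[jE _ tE' _]] := stage_nth _ _ _ a2 b0 ab2 k (hist k) _ r0.
- by rewrite ltnn.
- move: jE; rewrite -[LHS]addn0 => /addnI e; move: tE'; rewrite -e mul0n addn0 => tE'.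
  by rewrite -!/(scale_sum _) tE'.
- move: jE; rewrite -[LHS]addn0 => /addnI e; move: tE'; rewrite -e mul0n addn0 => tE'.
  by rewrite -!/(scale_sum _) tE'.
Qed.

Lemma stage_of k0 n : (start k0 <= n)%N ->
  exists2 k, (k0 <= k)%N & (start k <= n < start k.+1)%N.
Proof.
move=> kn; have ex : exists k, (n < start k.+1)%N by exists n; exact: leq_history.
have [k nk kmin] := ex_minnP ex; exists k.
  rewrite leqNgt; apply/negP => kk0; have := history_homo _ _ kk0.
  by move=> h; have := leq_trans nk (leq_trans h kn); rewrite ltnn.
rewrite nk andbT; case: k nk kmin => [|k] nk kmin; first by [].
by rewrite leqNgt; apply/negP => /kmin; rewrite ltnn.
Qed.

Lemma scale_lev n : (4 <= scale (lev n))%N.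
Proof.
have [k _ kn] := stage_of 0 n isT.
have w4 : (4 <= wk k)%N by rewrite /stage_scale mulnS ltn_addr.
have [_ _ _ [[-> _]|[_ -> _ _]]] := level_facts _ _ kn => //=.
by rewrite /stage_gap ltn_addr.
Qed.

End LevelSequence.

(** * Asymptotic estimates along the level sequence *)

Section Asymptotics.
Variables (R : realType) (a b : R).
Hypothesis a2 : 2 <= a.
Hypothesis b0 : 0 <= b.
Hypothesis ab2 : a * b <= 2.

Local Notation lev := (level_seq R a b).
Local Notation hist := (history R a b).
Local Notation start k := (size (hist k)).
Local Notation sgS n := ((\sum_(i < n) scale (lev i))%N).
Local Notation hS n := ((\sum_(i < n) choices (lev i))%N).
Local Notation precision := (precision R (fun i => scale (lev i)) (fun i => depth (lev i))).

Lemma exists_invr_le (e : R) : 0 < e -> exists k0, forall k, (k0 <= k)%N -> k.+1%:R^-1 <= e.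
Proof.
move=> e0; exists (Num.truncn e^-1) => k k0.
have /truncn_itv/andP[_ h] : 0 <= e^-1 by rewrite invr_ge0 ltW.
rewrite -[leRHS]invrK lef_pV2 ?posrE ?invr_gt0 ?ltr0n //.
by apply: (le_trans (ltW h)); rewrite ler_nat ltnS.
Qed.

Lemma stage_estimates k n : (0 < k)%N -> (start k <= n < start k.+1)%N ->
  let S : R := (sgS n)%:R in let d : R := (depth (lev n))%:R in let Ki : R := k.+1%:R^-1 in
  [/\ n%:R <= Ki * S, 1 <= Ki * S, (1 - Ki) * b * (2 * S + d) <= (hS n)%:R &
     (d = 0 /\ (scale (lev n))%:R <= Ki * S) \/
     [/\ (scale (lev n))%:R = d + 1, (choices (lev n))%:R = d, (a - 2) * S <= d, 1 <= d &
         (scale (lev n))%:R <= (a - 2) * S + Ki * S]].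
Proof.
move=> k0 kn S d Ki.
have [h1 h2 h3 h4] := level_facts _ _ _ a2 b0 ab2 _ _ kn; have {}h3 := h3 k0.
have K0 : 0 < k.+1%:R :> R by rewrite ltr0n.
have KS x : (k.+1 * x <= sgS n)%N -> x%:R <= Ki * S.
  by move=> h; rewrite mulrC ler_pdivlMr // -natrM ler_nat mulnC.
have wS := KS _ h3.
split => //; first exact: KS.
  by apply: le_trans wS; rewrite ler1n.
case: h4 => [[h5 h6]|[nE vE tE dE]]; [left|right].
  by rewrite /d h6 h5.
have [g1 g2] := stage_gap_bounds R a b a2 k (hist k).
have w16 : (2 <= stage_scale k)%N by rewrite /stage_scale mulnS ltn_addr.
have g16 : (2 <= stage_gap R a b k (hist k))%N by apply: leq_trans w16 _; exact: leq_addr.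
have gE : (stage_gap R a b k (hist k)) = (stage_gap R a b k (hist k)).-1.+1.
  by rewrite prednK // (leq_trans _ g16).
rewrite /d /S tE vE /=; split => //.
- by rewrite {1}gE natr1.
- by rewrite ler1n -ltnS -gE.
by apply: (le_trans g2); rewrite addrC lerD2l -tE.
Qed.

Lemma eventually_estimates (e : R) : 0 < e -> exists n1, forall n, (n1 <= n)%N ->
  exists2 Ki, 0 < Ki <= e &
  let S : R := (sgS n)%:R in let d : R := (depth (lev n))%:R in
  [/\ n%:R <= Ki * S, 1 <= Ki * S, (1 - Ki) * b * (2 * S + d) <= (hS n)%:R &
     (d = 0 /\ (scale (lev n))%:R <= Ki * S) \/
     [/\ (scale (lev n))%:R = d + 1, (choices (lev n))%:R = d, (a - 2) * S <= d, 1 <= d &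
         (scale (lev n))%:R <= (a - 2) * S + Ki * S]].
Proof.
move=> e0; have [k0 Hk0] := exists_invr_le e e0.
exists (start k0.+1) => n /(stage_of R a b)[k kk kn].
exists k.+1%:R^-1; first by rewrite invr_gt0 ltr0n Hk0 // ltnW.
by apply: stage_estimates => //; exact: leq_trans kk.
Qed.

Let b1 : b <= 1.
Proof.
have h : 2 * b <= a * b by rewrite ler_wpM2r.
by have := le_trans h ab2; rewrite ger_pMr.
Qed.

Lemma precisionE n : precision n =
  2 * (sgS n)%:R + (depth (lev n))%:R - 4 * n%:R :> R.
Proof. by []. Qed.

Lemma choices_precision (s : R) : 0 <= s < b -> exists n1, forall n, (n1 <= n)%N ->
  s * precision n <= (hS n)%:R.
Proof.
move=> /andP[s0 sb]; have [n1 Hn1] := eventually_estimates (b - s) ltac:(lra).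
exists n1 => n /Hn1[Ki /andP[K0 Ke] [h1 h2 h3 _]].
rewrite precisionE; move: h1 h2 h3; set S := (sgS n)%:R; set d := (depth _)%:R => h1 h2 h3.
have d0 : 0 <= d by [].
have S0 : 0 <= S by [].
have Kb : Ki * b <= Ki by rewrite ler_piMr // ltW.
have sK : s <= (1 - Ki) * b by lra.
apply: le_trans h3; apply: (@le_trans _ _ (s * (2 * S + d))).
  by apply: ler_wpM2l => //; rewrite gerBl mulr_ge0.
by apply: ler_wpM2r => //; lra.
Qed.

(** At an ordinary level the new scale is negligible. At a gap of depth d it adds about 2 d on the
    left; the choices contribute d on the right, and the depth inside the precision contributes b d
    + (1 - s) d, which is at least d. The margin b - s absorbs the errors. *)
Lemma choices_scale (s : R) : 0 <= s < b -> exists n1, forall n, (n1 <= n)%N ->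
  2 * (sgS n.+1)%:R + 2 * n.+1%:R <= (hS n.+1)%:R + (1 - s) * precision n.
Proof.
move=> /andP[s0 sb]; set dl := (b - s) / 10.
have [n1 Hn1] := eventually_estimates dl ltac:(rewrite /dl; lra).
exists n1 => n /Hn1[Ki /andP[K0 Ke] [h1 h2 h3 h4]].
have n1E : n.+1%:R = n%:R + 1 :> R by rewrite natr1.
rewrite precisionE !big_ord_recr /= !natrD n1E.
move: h1 h2 h3 h4; set S := (sgS n)%:R; set d := (depth _)%:R; set H := (hS n)%:R.
set sc := (scale _)%:R; set ch := (choices _)%:R => h1 h2 h3 h4.
have d0 : 0 <= d by [].
have ch0 : 0 <= ch by [].
have S0 : 0 <= S by [].
have KS : Ki * S <= dl * S by rewrite ler_wpM2r.
have n0 : 0 <= (n%:R : R) by [].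
have sn : 0 <= s * n%:R by rewrite mulr_ge0.
have Kb : Ki * b <= Ki by rewrite ler_piMr // ltW.
have bE : b = s + 10 * dl by rewrite /dl; field.
clearbody dl.
have h5 : (s + 9 * dl) * (2 * S + d) <= (1 - Ki) * b * (2 * S + d).
  by apply: ler_wpM2r; lra.
have dd : 0 <= dl * d by rewrite mulr_ge0 //; lra.
case: h4 => [[d_0 scS]|[scE chE aS d1 scS]].
  by rewrite d_0 in h5 h3 *; lra.
rewrite scE chE; lra.
Qed.

Lemma precision_unbounded n1 (l : nat) : exists2 n, (n1 <= n)%N & l%:R <= precision n.
Proof.
have [n2 Hn2] := eventually_estimates 8^-1 ltac:(lra).
exists (maxn n1 (maxn n2 l)); first exact: leq_maxl.
set n := maxn _ _; have nn2 : (n2 <= n)%N by rewrite /n leq_max leq_max leqnn orbT.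
have ln : l%:R <= n%:R :> R by rewrite ler_nat /n !leq_max leqnn !orbT.
have [Ki /andP[K0 Ke] [h1 h2 _ _]] := Hn2 n nn2.
rewrite precisionE; move: h1 h2; set S := (sgS n)%:R => h1 h2.
have S0 : 0 <= S by [].
have d0 : 0 <= (depth (lev n))%:R :> R by [].
have KS : Ki * S <= 8^-1 * S by rewrite ler_wpM2r.
lra.
Qed.

Lemma lev_ok i : pool_ok (scale (lev i)) (depth (lev i)) (pool (lev i)).
Proof. exact: pool_okP (scale_lev _ _ _ a2 b0 ab2 _). Qed.

Lemma size_pool_lev i : size (pool (lev i)) = (2 ^ choices (lev i))%N.
Proof. exact: size_pool (scale_lev _ _ _ a2 b0 ab2 _). Qed.

Section Path.
Variable D : nat -> nat * nat.
Hypothesis DS : forall n, D n \in pool (lev n).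

Local Notation q n := (colq (prod_blocks (mkseq D n))).

Lemma path_block i : block (D i).
Proof. by have [_ H] := lev_ok i; have /and4P[] := H _ (DS i). Qed.

Lemma mem_mkseq_paths n : mkseq D n \in paths _ (fun i => pool (lev i)) n.
Proof.
elim: n => [|n IH]; first by rewrite mem_head.
by rewrite mkseqS; apply/allpairsP; exists (mkseq D n, D n); split => //=.
Qed.

Let p2D (x y : R) : 2 `^ (x + y) = 2 `^ x * 2 `^ y.
Proof. by rewrite powRD // pnatr_eq0 implybT. Qed.

Let p2lt (x y : R) : x < y -> 2 `^ x < 2 `^ y.
Proof. by move=> xy; rewrite /powR !gt_eqF // ltr_expR ltr_pM2r // ln_gt0 // ltr1n. Qed.

Lemma colq_bounds n : 2 `^ ((sgS n)%:R - 2 * n%:R) <= (q n)%:R :> R /\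
  (q n)%:R <= 2 `^ ((sgS n)%:R + n%:R) :> R.
Proof.
have [h1 h2] := colq_paths _ _ _ lev_ok _ _ (mem_mkseq_paths n).
split; last by rewrite p2D !powR_mulrn // -exprD -natrX ler_nat.
rewrite p2D powRN -natrM !powR_mulrn // ler_pdivrMr ?exprn_gt0 // mulrC.
by rewrite -!natrX -natrM ler_nat expnM.
Qed.

Lemma colq_growth e : 0 < e -> exists n1, forall n, (n1 <= n)%N ->
  (q n.+1)%:R <= (q n)%:R `^ (a - 1 + e) :> R.
Proof.
(* The errors Ki S, 1 and 2 n (a - 2 + e) add up to at most 2 e' (a - 1 + e) S = e S. *)
move=> e0; set e' := e / (2 * (a - 1 + e)).
have ae : 0 < 2 * (a - 1 + e) by have := a2; lra.
have e'0 : 0 < e' by rewrite divr_gt0.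
have e'E : e' * (2 * (a - 1 + e)) = e by rewrite divfK // gt_eqF.
have [n1 Hn1] := eventually_estimates e' e'0; exists n1 => n /Hn1[Ki /andP[K0 Ke]].
have [q1 _] := colq_bounds n.
set S := (sgS n)%:R in q1 *; set d := (depth _)%:R => -[h1 h2 _ h4].
have S0 : 0 <= S by [].
have Q0 : 0 < (q n)%:R :> R by rewrite ltr0n (colq_gt0 D path_block).
have scS : (scale (lev n))%:R <= (a - 2) * S + Ki * S.
  case: h4 => [[_ h]|[_ _ _ _ //]].
  by apply: (le_trans h); rewrite lerDr mulr_ge0 // subr_ge0.
have -> : a - 1 + e = 1 + (a - 2 + e) by ring.
rewrite powRD ?(gt_eqF Q0) ?implybT // powRr1 ?(ltW Q0) //.
apply: (@le_trans _ _ ((q n)%:R * 2 `^ ((scale (lev n))%:R + 1))).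
  rewrite p2D powRr1 // powR_mulrn // -natrX -!natrM ler_nat mkseqS.
  have am : all block (mkseq D n) by exact: block_paths lev_ok _ _ (mem_mkseq_paths n).
  have /andP[_ h] := leq_colq _ _ am (path_block n); apply: (leq_trans h).
  rewrite mulnC -mulnA leq_mul2l leq_mul2r; apply/orP; right; apply/orP; right.
  by have [_ H] := lev_ok n; have /and4P[_ _ -> _] := H _ (DS n).
rewrite ler_pM2l //; apply: (@le_trans _ _ ((2 `^ (S - 2 * n%:R)) `^ (a - 2 + e))).
  rewrite -powRrM; apply: ler_powR; first by lra.
  have KS : Ki * S <= e' * S by rewrite ler_wpM2r.
  have ae2 : 0 <= a - 2 + e by have := a2; lra.
  have nS : n%:R * (a - 2 + e) <= e' * S * (a - 2 + e).
    by rewrite ler_wpM2r // (le_trans h1).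
  have e'S : e' * (2 * (a - 1 + e)) * S = e * S by rewrite e'E.
  clearbody e'; lra.
apply: ge0_ler_powR; rewrite ?nnegrE ?powR_ge0 ?ler0n //.
by have := a2; lra.
Qed.

Lemma gap_estimates k : (0 < k)%N ->
  let n := (start k + stage_free k (hist k) + stage_digits R a b k (hist k))%N in
  let Ki : R := k.+1%:R^-1 in
  [/\ n%:R <= Ki * (sgS n)%:R, 1 <= Ki * (sgS n)%:R,
    (a - 2) * (sgS n)%:R <= (depth (lev n))%:R & 1 <= (depth (lev n))%:R :> R].
Proof.
move=> k0 n Ki; have [[kn vE _ _] _] := gap_facts _ _ _ a2 b0 ab2 k.
have [h1 h2 _ [[d0 _]|[_ _ h3 h4 _]]] := stage_estimates k n k0 kn; last by split.
move: d0; rewrite vE /=; have w2 : (2 <= stage_scale k)%N by rewrite /stage_scale mulnS ltn_addr.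
have g2 : (2 <= stage_gap R a b k (hist k))%N by apply: leq_trans w2 _; exact: leq_addr.
move=> /eqP; rewrite pnatr_eq0 => /eqP e.
by move: g2; case: (stage_gap _ _ _ _ _) e => // g /= ->.
Qed.

Lemma gap_approximation z B : z < a -> exists2 n, (B <= n)%N &
  (D n).1%:R / (D n).2%:R * (q n)%:R `^ z < (q n)%:R ^+ 2 :> R.
Proof.
(* For z > 2 this gives (1 + e) (z - 2) = a - 2 - e, which leaves room for the n in the bound 2 ^ (S
   + n) on q. *)
move=> za; pose e : R := if 2 < z then (a - z) / (z - 1) else 1.
have e0 : 0 < e by rewrite /e; case: ifP => // z2; rewrite divr_gt0 //; lra.
have [k0 Hk0] := exists_invr_le e e0; pose k := maxn B (maxn k0 1).
have Bk : (B <= k)%N by exact: leq_maxl.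
have Ke : k.+1%:R^-1 <= e by apply: Hk0; rewrite /k !leq_max leqnn orbT.
have kpos : (0 < k)%N by rewrite /k !leq_max leqnn !orbT.
have [h1 h2 h3 h4] := gap_estimates k kpos.
set n := (start k + stage_free k (hist k) + stage_digits R a b k (hist k))%N in h1 h2 h3 h4.
set Ki := _^-1 in h1 h2 Ke; set S := (sgS n)%:R in h1 h2 h3.
set d := (depth _) in h3 h4; exists n.
  by apply: (leq_trans Bk); apply: (leq_trans (leq_history R a b k)); rewrite /n -addnA leq_addr.
have Q0 : 0 < (q n)%:R :> R by rewrite ltr0n (colq_gt0 D path_block).
have PQ : (D n).1%:R / (D n).2%:R <= 2 `^ (- d%:R) :> R.
  have /and3P[P0 PQ _] := path_block n.
  have D20 : 0 < (D n).2%:R :> R by rewrite ltr0n; apply: leq_trans PQ; rewrite muln_gt0.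
  rewrite powRN powR_mulrn // ler_pdivrMr // mulrC ler_pdivlMr ?exprn_gt0 //.
  rewrite -natrX -natrM ler_nat.
  by have [_ H] := lev_ok n; have /and4P[_ _ _] := H _ (DS n).
have qz : (q n)%:R `^ (z - 2) < 2 `^ d%:R :> R.
  have d1 : 1 < 2 `^ d%:R :> R.
    have : 2 `^ 1 <= 2 `^ d%:R :> R by apply: ler_powR => //; lra.
    by rewrite powRr1 //; apply: lt_le_trans; lra.
  have [z2|z2] := leP z 2.
    apply: le_lt_trans d1; rewrite -[leRHS](powRr0 (q n)%:R); apply: ler_powR; last by lra.
    by rewrite ler1n (colq_gt0 D path_block).
  have [_ q2] := colq_bounds n.
  apply: (@le_lt_trans _ _ ((2 `^ (S + n%:R)) `^ (z - 2))).
    by apply: ge0_ler_powR; rewrite ?nnegrE ?powR_ge0 ?ler0n //; lra.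
  rewrite -powRrM.
  have S0 : 0 < S.
    by rewrite lt_neqAle ler0n andbT; apply: contraTneq h2 => <-; rewrite mulr0 -ltNge.
  have ez : e * (z - 1) = a - z by rewrite /e z2 divfK // gt_eqF //; lra.
  have lt : (S + n%:R) * (z - 2) < d%:R.
    have KS : Ki * S <= e * S by rewrite ler_pM2r.
    have eS : 0 < e * S by rewrite mulr_gt0.
    have nS : n%:R * (z - 2) <= e * S * (z - 2).
      by rewrite ler_pM2r ?(le_trans h1) //; lra.
    have : e * (z - 1) * S = (a - z) * S by rewrite ez.
    clearbody e; lra.
  exact: p2lt.
have -> : (q n)%:R ^+ 2 = (q n)%:R `^ 2 :> R by rewrite -powR_mulrn ?ler0n.
have {1}-> : z = (z - 2) + 2 by ring.
rewrite powRD ?(gt_eqF Q0) ?implybT // mulrA gtr_pMl ?powR_gt0 //.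
apply: (@lt_le_trans _ _ (2 `^ (- d%:R) * 2 `^ d%:R)); last by rewrite -p2D addNr powRr0.
apply: (@le_lt_trans _ _ (2 `^ (- d%:R) * (q n)%:R `^ (z - 2))).
  by rewrite ler_pM2r ?powR_gt0.
by rewrite ltr_pM2l ?powR_gt0.
Qed.

End Path.

End Asymptotics.

Lemma leq_stage_scale k : (k <= stage_scale k)%N.
Proof. by rewrite /stage_scale; lia. Qed.

(** * Digit runs for the upper bound *)

Section DigitRuns.
Variables (R : realType) (a b : R).
Hypothesis a2 : 2 <= a.
Hypothesis b0 : 0 <= b.
Hypothesis ab2 : a * b <= 2.

Local Notation lev := (level_seq R a b).
Local Notation hist := (history R a b).
Local Notation start k := (size (hist k)).
Local Notation sgS n := ((\sum_(i < n) scale (lev i))%N).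
Local Notation precision := (precision R (fun i => scale (lev i)) (fun i => depth (lev i))).

(** Asymptotically a times the stage ratio is the number of bits of x determined per unit of m. It
    tends to 2 / b, or to infinity when b = 0, and so passes a value above 2 / s. *)
Lemma stage_ratio_limit (s : R) : b < s -> exists2 rho, 2 / s < rho & exists k0,
  forall k, (k0 <= k)%N ->
    rho <= (a - 4 * k.+1%:R^-1) * (stage_ratio R a b k - k.+1%:R^-1).
Proof.
move=> bs; have s0 : 0 < s by exact: le_lt_trans bs.
have [b_0|b_n0] := eqVneq b 0.
  exists (2 / s + 1); first by rewrite ltrDl.
  have [k0 Hk0] := exists_invr_le R 4^-1 ltac:(lra).
  exists (maxn k0 (Num.truncn (2 / s + 1)).+1) => k; rewrite geq_max => /andP[kk0 kt].
  set Ki : R := k.+1%:R^-1.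
  have Ke := Hk0 k kk0; rewrite -/Ki in Ke.
  have -> : stage_ratio R a b k = k.+1%:R by rewrite /stage_ratio b_0 mulr0 mul0r ler0n.
  have /truncn_itv/andP[_ h] : 0 <= 2 / s + 1 by rewrite addr_ge0 // divr_ge0 // ltW.
  have k1 : 2 / s + 1 <= k%:R by apply: (le_trans (ltW h)); rewrite ler_nat.
  have Ki0 : 0 < Ki by rewrite invr_gt0 ltr0n.
  have kE : k.+1%:R = k%:R + 1 :> R by rewrite natr1.
  apply: (@le_trans _ _ (1 * k%:R)); first by rewrite mul1r.
  rewrite kE; clearbody Ki; have := a2 => ha.
  by apply: ler_pM => //; lra.
have bpos : 0 < b by rewrite lt_neqAle eq_sym b_n0.
have apos : 0 < a by exact: lt_le_trans a2.
pose kap := 2 / (a * b); have kap0 : 0 < kap by rewrite divr_gt0 // mulr_gt0.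
have akap : a * kap = 2 / b by rewrite /kap; field; rewrite !gt_eqF.
have lt2 : 2 / s < 2 / b by rewrite ltr_pM2l // ltf_pV2.
pose e := (2 / b - 2 / s) / (2 * (a + 4 * kap)).
have den : 0 < 2 * (a + 4 * kap) by lra.
have e0 : 0 < e by rewrite divr_gt0 // subr_gt0.
have eE : e * (2 * (a + 4 * kap)) = 2 / b - 2 / s by rewrite divfK // gt_eqF.
exists ((2 / s + 2 / b) / 2); first by lra.
have [k0 Hk0] := exists_invr_le R e e0.
exists (maxn k0 (Num.truncn kap).+1) => k; rewrite geq_max => /andP[kk0 kt].
set Ki : R := k.+1%:R^-1.
have Ke := Hk0 k kk0; rewrite -/Ki in Ke.
have Ki0 : 0 < Ki by rewrite invr_gt0 ltr0n.
have -> : stage_ratio R a b k = kap.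
  rewrite /stage_ratio; case: leP => // h; exfalso.
  have /truncn_itv/andP[_ h2] := ltW kap0.
  have : kap < k.+1%:R by apply: (lt_le_trans h2); rewrite ler_nat ltnW.
  by rewrite ltr_pdivrMr ?mulr_gt0 // mulrC ltNge h.
have KK : 0 <= Ki * Ki by rewrite mulr_ge0 // ltW.
have Kea : Ki * (2 * (a + 4 * kap)) <= e * (2 * (a + 4 * kap)) by rewrite ler_pM2r.
clearbody e Ki kap; lra.
Qed.

Lemma digit_runs (s : R) (D : nat -> nat * nat) : b < s ->
  (forall n, D n \in pool (lev n)) ->
  exists kap lam : nat, (2 * kap + 3)%N%:R <= s * lam%:R /\
  (forall N, exists j n0 r c, [/\ (N <= j)%N,
     forall i, (i < r)%N -> D (n0 + i)%N = (1%N, (2 ^ c)%N),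
     (sgS n0 + n0 <= kap * j)%N,
     (c <= kap * j)%N /\ (r <= kap * j * (kap * j))%N &
     (lam * j)%N%:R <= precision (n0 + r)]).
Proof.
move=> bs DS; have s0 : 0 < s by exact: le_lt_trans bs.
have [rho rho_s [k0 Hk0]] := stage_ratio_limit s bs.
pose mu := (2 / s + rho) / 2.
have smu : 2 < s * mu.
  have -> : 2 = s * (2 / s) :> R by rewrite mulrC divfK // gt_eqF.
  by rewrite ltr_pM2l // /mu; lra.
have s2 : 0 < 2 / s by rewrite divr_gt0.
have mu_rho : mu < rho by rewrite /mu; lra.
have mu0 : 0 < mu by rewrite /mu; lra.
(* Large enough for s mu kap > 2 kap + s + 3, so that rounding mu kap down to [lam] does no harm. *)
pose kap := (Num.truncn ((s + 3) / (s * mu - 2))).+1.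
pose lam := Num.truncn (mu * kap%:R).
exists kap, lam.
have kap_gt0 : 0 < kap%:R :> R by rewrite ltr0n.
have /truncn_itv/andP[lam1 lam2] : 0 <= mu * kap%:R by rewrite mulr_ge0 // ltW.
rewrite -/lam in lam1 lam2.
split.
  have /truncn_itv/andP[_ h] : 0 <= (s + 3) / (s * mu - 2).
    by rewrite divr_ge0 // ?subr_ge0 ?ltW // addr_gt0.
  rewrite -/kap ltr_pdivrMr ?subr_gt0 // in h.
  have lamE : lam.+1%:R = lam%:R + 1 :> R by rewrite natr1.
  have : s * (mu * kap%:R) < s * (lam%:R + 1) by rewrite ltr_pM2l // -lamE.
  rewrite natrD natrM => h2; lra.
move=> N.
pose e := (rho - mu) / (mu * (1 + kap%:R)).
have den : 0 < mu * (1 + kap%:R) by rewrite mulr_gt0 // addr_gt0.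
have e0 : 0 < e by rewrite divr_gt0 // subr_gt0.
have eE : e * (mu * (1 + kap%:R)) = rho - mu by rewrite divfK // gt_eqF.
have [k1 Hk1] := exists_invr_le R e e0.
pose k := maxn (maxn k0 k1) (maxn (kap * N) 4).
have kk0 : (k0 <= k)%N by rewrite /k !leq_max leqnn.
have kk1 : (k1 <= k)%N by rewrite /k !leq_max leqnn orbT.
have kN : (kap * N <= k)%N by rewrite /k !leq_max leqnn !orbT.
have k4 : (4 <= k)%N by rewrite /k !leq_max leqnn !orbT.
have {}Hk0 := Hk0 k kk0; have {}Hk1 := Hk1 k kk1.
have kpos : (0 < k)%N by exact: leq_trans k4.
have [[/andP[kn nk] vE tE mE] digits] := gap_facts _ _ _ a2 b0 ab2 k.
have [g1 g2 g3 g4] := gap_estimates _ _ _ a2 b0 ab2 k kpos.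
set n0 := (start k + stage_free k (hist k))%N in kn nk vE tE mE digits g1 g2 g3 g4.
set r := stage_digits R a b k (hist k) in kn nk vE tE mE digits g1 g2 g3 g4.
set m := stage_mid k (hist k) in mE.
have n0k : (start k <= n0 < start k.+1)%N.
  by rewrite leq_addr (leq_ltn_trans _ nk) // leq_addr.
have [h1 _ h3 _] := level_facts _ _ _ a2 b0 ab2 _ _ n0k; have {}h3 := h3 kpos.
rewrite mE in h1 h3.
have [d1 d2] := stage_digits_bounds R a b a2 b0 ab2 k (hist k); rewrite -/r -/m in d1 d2.
have [r1 r2 _] := stage_ratioP R a b a2 b0 ab2 k.
set w := stage_scale k in digits h3 d1 d2.
have kw : (k <= w)%N by exact: leq_stage_scale.
have wm : (w <= m)%N by apply: leq_trans h3; rewrite leq_pmull.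
have km : (k < m)%N by apply: leq_trans h3; rewrite leq_pmulr // (leq_trans kpos kw).
have rm : (r <= m)%N.
  rewrite -(leq_pmul2r kpos) -(ler_nat R) !natrM.
  apply: (@le_trans _ _ (r%:R * w%:R)); first by rewrite ler_wpM2l // ler_nat.
  apply: (le_trans d1); rewrite mulrC ler_wpM2l //.
  have kE : k.+1%:R = k%:R + 1 :> R by rewrite natr1.
  by rewrite kE in r2; lra.
(* m + n0 is rounded up to a multiple of kap; the excess, at most kap, is small against m. *)
pose j := ((m + n0) %/ kap).+1.
have j1 : (m + n0 <= kap * j)%N by rewrite mulnC ltnW // ltn_ceil.
have j2 : (kap * j <= m + n0 + kap)%N by rewrite mulnS addnC leq_add2r mulnC leq_divM.
have mj : (m <= kap * j)%N by apply: leq_trans j1; exact: leq_addr.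
exists j, n0, r, w; split.
- have kap1 : (0 < kap)%N by [].
  by rewrite -(leq_pmul2l kap1) (leq_trans kN) // (leq_trans (ltnW km)).
- by move=> i ir; have := DS (n0 + i)%N; rewrite (digits _ ir) inE => /eqP.
- by rewrite mE.
- split; first exact: leq_trans mj.
  by apply: (leq_trans rm); apply: (leq_trans mj); rewrite leq_pmulr //.
set Ki : R := k.+1%:R^-1 in Hk0 Hk1 g1 g2.
have Ki0 : 0 < Ki by rewrite invr_gt0 ltr0n.
have KM x : (k.+1 * x <= m)%N -> x%:R <= Ki * m%:R.
  by move=> h; rewrite mulrC ler_pdivlMr ?ltr0n // -natrM ler_nat mulnC.
have n0m := KM _ h1; have wKm := KM _ h3.
have onem : 1 <= Ki * m%:R by have := KM 1%N; rewrite muln1; apply.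
have Ki4 : Ki * 4 <= 1.
  by rewrite mulrC ler_pdivrMr ?ltr0n // mul1r ler_nat ltnW.
have m0 : 0 <= m%:R :> R by [].
have lj : (lam * j)%N%:R <= rho * m%:R.
  apply: (@le_trans _ _ (mu * (m%:R + n0%:R + kap%:R))).
    apply: (@le_trans _ _ (mu * (kap * j)%N%:R)).
      by rewrite !natrM mulrA ler_wpM2r.
    by rewrite ler_pM2l // -!natrD ler_nat.
  have Kie : Ki * (mu * (1 + kap%:R)) <= rho - mu by rewrite -eE ler_pM2r.
  have := ler_wpM2r m0 Kie.
  have : mu * n0%:R <= mu * (Ki * m%:R) by rewrite ler_pM2l.
  have : mu * kap%:R * 1 <= mu * kap%:R * (Ki * m%:R) by rewrite ler_pM2l // mulr_gt0.
  clearbody Ki mu kap; lra.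
(* The depth of the gap at n0 + r counts towards the precision there, which is thus at least (a - 4
   Ki) m'. *)
apply: (le_trans lj); apply: le_trans (ler_wpM2r m0 Hk0) _.
rewrite precisionE tE in g1 g3 *.
set m' := stage_end R a b k (hist k) in g1 g3 *.
have m'E : m'%:R = m%:R + r%:R * w%:R :> R by rewrite /m' /stage_end natrD natrM.
have h5 : (stage_ratio R a b k - Ki) * m%:R <= m'%:R by lra.
apply: (@le_trans _ _ ((a - 4 * Ki) * m'%:R)).
  by rewrite -mulrA ler_wpM2l //; have := a2; lra.
lra.
Qed.

End DigitRuns.

(** * Singletons as Cantor-like sets *)

HB.instance Definition _ d (T : measurableType d) (x : T) (R : realType) :=
  Measure_isProbability.Build d T R (dirac x) (diracT R x).

Section Singleton.
Variables (R : realType) (x : R).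
Hypothesis x01 : 0 < x < 1.

(** The image of [0, 1] under the homothety of centre x and ratio 1 / (k + 1): all of [0, 1] at k =
    0, and of length [harmonic k]. *)
Definition shrinking (k : nat) : seq (R * R) :=
  [:: (x - x * harmonic k, x + (1 - x) * harmonic k)].

Let h (k : nat) : 0 < (harmonic k : R).
Proof. exact: harmonic_gt0. Qed.

Lemma mem_shrinking k : cinterval (x - x * harmonic k, x + (1 - x) * harmonic k) x.
Proof.
have /andP[x0 x1] := x01.
rewrite /cinterval /= in_itv /= gerBl lerDl !mulr_ge0 ?subr_ge0 //; exact: ltW.
Qed.

Lemma shrinking_construction : cantor_construction shrinking (fun=> 1%N).
Proof.
have /andP[x0 x1] := x01.
have sub k : cinterval (x - x * harmonic k.+1, x + (1 - x) * harmonic k.+1)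
    `<=` cinterval (x - x * harmonic k, x + (1 - x) * harmonic k).
  have hk : (harmonic k.+1 : R) <= harmonic k.
    by rewrite /harmonic lef_pV2 ?posrE ?ltr0n // ler_nat.
  rewrite /cinterval => y /=; rewrite !in_itv /= => /andP[y1 y2]; apply/andP; split.
    by apply: le_trans y1; rewrite lerD2l lerN2 ler_pM2l.
  by apply: (le_trans y2); rewrite lerD2l ler_pM2l // subr_gt0.
split.
- by rewrite /shrinking /harmonic /= invr1 !mulr1 subrr addrC subrK.
- by [].
- move=> k J; rewrite inE => /eqP ->/=.
  apply: (@lt_trans _ _ x); first by rewrite gtrBl mulr_gt0.
  by rewrite ltrDl mulr_gt0 // subr_gt0.
- by move=> k J K; rewrite !inE => /eqP -> /eqP -> ne; case: ne.
- by move=> k J; rewrite inE => /eqP ->; eexists; first exact: mem_head.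
- by [].
- move=> k J; rewrite inE => /eqP -> /=; rewrite addn0.
  by rewrite (_ : `[< _ >] = true) //; apply/asboolP; exact: sub.
- rewrite (_ : (fun k => _) = harmonic); first exact: cvg_harmonic.
  apply/funext => k; rewrite big_cons big_nil /=.
  rewrite (_ : _ - _ = harmonic k) ?max_l ?ltW //=; ring.
Qed.

Lemma cantor_set_shrinking : cantor_set shrinking = [set x].
Proof.
apply/seteqP; split=> [y Ey|_ -> k _]; last first.
  by exists (x - x * harmonic k, x + (1 - x) * harmonic k);
    [exact: mem_head|exact: mem_shrinking].
apply/eqP; rewrite -subr_eq0 -normr_le0.
have /andP[x0 x1] := x01.
apply: (cvgr_to_ge cvg_harmonic); apply: nearW => k.
have [_ /[!inE]/eqP-> ] := Ey k I.
rewrite /cinterval /= in_itv /= ler_norml => /andP[y1 y2].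
have hk := h k; rewrite /= in hk y1 y2 *; move: (k.+1%:R^-1) hk y1 y2 => t t0 y1 y2; apply/andP; split; nra.
Qed.

Lemma dirac_uniform : is_uniform_measure shrinking (fun=> 1%N)
  (dirac (x : measurableTypeR R) : probability _ R).
Proof.
split=> [|k J k0].
  by rewrite /= diracE cantor_set_shrinking memNset //= => /(_ erefl).
rewrite inE => /eqP ->; rewrite /= diracE mem_set; last exact: mem_shrinking.
by rewrite big1 // invr1.
Qed.

Lemma singleton_cantor (P : R -> Prop) : P x ->
  exists (lev : nat -> seq (R * R)) (d : nat -> nat),
    cantor_construction lev d /\
    exists mu : probability (measurableTypeR R) R,
      is_uniform_measure lev d mu /\ {ae mu, forall y : R, cantor_set lev y -> P y}.
Proof.
move=> Px; exists shrinking, (fun=> 1%N); split; first exact: shrinking_construction.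
exists (dirac (x : measurableTypeR R)); split; first exact: dirac_uniform.
by apply: aeW => y; rewrite cantor_set_shrinking => ->.
Qed.

End Singleton.

(** * A real number with prescribed exponent and dimension *)

Lemma exists_exponent_dim (R : realType) (a b : R) : 2 <= a -> 0 <= b <= 2 / a ->
  exists2 x : R, 0 < x < 1 &
    irrationality_exponent x = a%:E /\ effective_hausdorff_dim [set x] = b%:E.
Proof.
move=> a2 /andP[b0 ba].
have a0 : 0 < a by exact: lt_le_trans a2.
have ab2 : a * b <= 2 by rewrite mulrC -ler_pdivlMr.
have b1 : b <= 1 by apply: (le_trans ba); rewrite ler_pdivrMr // mul1r.
have S_ok := lev_ok R a b a2 b0 ab2.
have size_S := size_pool_lev R a b a2 b0 ab2.
have [D [DS dim_ge]] := exists_path_dim_ge R _ _ _ _ S_ok size_S b b1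
  (choices_precision R a b a2 b0 ab2) (choices_scale R a b a2 b0 ab2)
  (precision_unbounded R a b a2 b0 ab2).
have bD := path_block R a b a2 b0 ab2 D DS.
exists (tail R D 0); first exact: tail_lt1.
split; apply/eqP; rewrite eq_le; apply/andP; split.
- apply: irrationality_exponent_le => //; first by lra.
  exact: (colq_growth R a b a2 b0 ab2 D DS).
- apply: irrationality_exponent_ge => // z B za.
  exact: (gap_approximation R a b a2 b0 ab2 D DS z B za).
- apply/lee_addgt0Pr => e e0; apply: ereal_inf_lbound; exists (b + e) => //.
  split; first by rewrite addr_ge0 // ltW.
  have [kap [lam [sl runs]]] := digit_runs R a b a2 b0 ab2 (b + e) D ltac:(lra) DS.
  exact: (null_of_digit_runs R _ _ _ S_ok D DS _ _ _ sl runs).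
by apply: le_ereal_inf_tmp => _ [s [s0 snull] <-]; rewrite lee_fin; exact: dim_ge.
Qed.

Theorem theorem2 (R : realType) (a b : R) (ha : 2 <= a)
    (hb : 0 <= b <= 2 / a) :
  exists (lev : nat -> seq (R * R)) (d : nat -> nat),
    cantor_construction lev d /\
    exists mu : probability (measurableTypeR R) R,
      is_uniform_measure lev d mu /\
      {ae mu, forall x : R, cantor_set lev x ->
        irrationality_exponent x = a%:E /\
        effective_hausdorff_dim [set x] = b%:E}.
Proof.
have [x x01 [irr dim]] := exists_exponent_dim R a b ha hb.
exact: (singleton_cantor R x x01 (fun x => irrationality_exponent x = a%:E /\
  effective_hausdorff_dim [set x] = b%:E)).
Qed.
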